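(* Let $W:[0,1]^2\to[0,1]$ be continuous and symmetric ($W(x,y)=W(y,x)$) with $W\not\equiv 0$, let $K(x)=\int_0^1 W(x,y)\,dy$, and let $T_W$ be the integral operator on $L^2[0,1]$ given by $(T_Wf)(x)=\int_0^1W(x,y)f(y)\,dy$. Let $\rho=\lambda_1(T_W)$ denote the largest eigenvalue of $T_W$ and $\phi$ the corresponding eigenfunction. Assume: (A1) there is a constant $k_{\min}$ such that $K(x)\ge k_{\min}>0$ for all $x\in[0,1]$; (A2) $\rho$ is a simple and isolated eigenvalue, with $\mathrm{dist}(\rho,\sigma(T_W)\setminus\{\rho\})\ge\gamma$ for some $\gamma>0$; (A3) $\phi>0$ on $[0,1]$ and $\|\phi\|_{L^2[0,1]}=1$. For each $n$, let $A_n$ be the adjacency matrix of a random graph on $[n]=\{1,\dots,n\}$ generated according to either Model A or Model B, and let $\mu_n^E=\frac1n\sum_{i=1}^n\delta_{\Delta^E_{i,n}}$ be the empirical distribution of its eigen friendship-biases. Then, as $n\to\infty$, $$\mu_n^E\Rightarrow\mu_\infty\quad\text{in probability},$$ where $\mu_\infty$ is the law of $$\Delta_\infty=\left(\frac{\rho}{K(U)}-1\right)\phi(U),\qquad U\sim U(0,1).$$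
   Context: Model A: $A_n=(A_{ij})$ is a symmetric $\{0,1\}$-valued matrix with $A_{ii}=0$ and with $(A_{ij})_{i<j}$ independent, $\mathbb P(A_{ij}=1)=W(i/n,j/n)$ for $i\ne j$. Model B: $X_1,X_2,\dots$ are i.i.d. $U(0,1)$, $\mathbb X=(X_1,\dots,X_n)$, and $X_{(i)}$ is the $i$-th order statistic of $\mathbb X$ (increasing order). The sequence $\varepsilon_n\in(0,1]$ satisfies $\lim_{n\to\infty}\frac{(\log n)^\xi}{n\varepsilon_n}=0$ for some fixed $\xi>4$. Conditionally on $\mathbb X$, $A_n$ is a symmetric $\{0,1\}$-valued matrix with $A_{ii}=0$ and with $(A_{ij})_{i<j}$ independent, $A_{ij}\sim\mathrm{Ber}(\varepsilon_nW(X_{(i)},X_{(j)}))$ for $i\neq j$. Eigen friendship-bias: let $d_i=\sum_jA_{ij}$ be the degree of vertex $i$, $\lambda_1$ the largest eigenvalue of $A_n$, and $r^{(n)}=(r^{(n)}_i)_{i\in[n]}$ a corresponding eigenvector with nonnegative entries, $A_nr^{(n)}=\lambda_1r^{(n)}$, normalized by $\frac1n\sum_{i=1}^n(r_i^{(n)})^2=1$. The eigen friendship-bias of vertex $i$ is $$\Delta^E_{i,n}=\left[\frac1{d_i}\sum_{j\in[n]}A_{ij}r_j^{(n)}-r_i^{(n)}\right]\mathbf 1_{\{d_i\ne0\}}.$$ ''$\mu_n^E\Rightarrow\mu_\infty$ in probability'' means weak convergence in probability of the random probability measures: $\int F\,d\mu_n^E\to\int F\,d\mu_\infty$ in probability for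 every bounded continuous $F:\mathbb R\to\mathbb R$. *)

(* Defs.v *)
From HB Require Import structures.
From mathcomp Require Import all_boot all_order all_algebra finmap.
From mathcomp Require Import all_classical all_reals all_analysis.

Set Implicit Arguments.
Unset Strict Implicit.
Unset Printing Implicit Defensive.

Import Order.TTheory GRing.Theory Num.Theory.
Import numFieldNormedType.Exports.

Local Open Scope classical_set_scope.
Local Open Scope ring_scope.

(* Kernels on [0,1]^2 are total functions R -> R -> R of which only the values
   on the square matter; L^2[0,1] is L^2 of the real line for the Lebesgue
   measure restricted to [0,1], its elements being represented by measurable
   functions and compared almost everywhere. *)
Section integral_operator.
Context {R : realType}.
Implicit Types (W : R -> R -> R) (lam : R) (f : R -> R).

Lemma measurable_I01 : measurable (`[0, 1]%classic : set (measurableTypeR R)).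
Proof. exact: measurable_itv. Qed.

Definition lebesgue01 : {measure set (measurableTypeR R) -> \bar R} :=
  mrestr (@lebesgue_measure R) measurable_I01.

Definition L2 : {pred R -> R} := Lfun lebesgue01 2%:E.

Definition L2norm f : \bar R := 'N[lebesgue01]_2%:E [EFin \o f].

Definition degree_fun W : R -> R :=
  fun x => \int[lebesgue_measure]_(y in `[0, 1]) W x y.

Definition integral_op W f : R -> R :=
  fun x => \int[lebesgue_measure]_(y in `[0, 1]) (W x y * f y).

Definition eigenfunction W lam f : Prop :=
  [/\ f \in L2, ~ (f = cst 0 %[ae lebesgue01])
    & integral_op W f = lam \*: f %[ae lebesgue01] ].

Definition op_eigenvalue W lam : Prop := exists f, eigenfunction W lam f.

Definition largest_op_eigenvalue W lam : Prop :=
  op_eigenvalue W lam /\ forall lam', op_eigenvalue W lam' -> lam' <= lam.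

(* T_W is self-adjoint, so algebraic and geometric multiplicities agree. *)
Definition simple_op_eigenvalue W lam : Prop :=
  exists f, eigenfunction W lam f /\
    forall g, eigenfunction W lam g ->
      exists c : R, g = c \*: f %[ae lebesgue01].

(* [T_W - lam] is a bijection of L^2[0,1] with bounded inverse. *)
Definition resolvent_set W : set R := [set lam | exists C : R,
  forall g, g \in L2 -> exists f,
    [/\ f \in L2,
        (fun x => integral_op W f x - lam * f x) = g %[ae lebesgue01],
        (forall f', f' \in L2 ->
           (fun x => integral_op W f' x - lam * f' x) = g %[ae lebesgue01] ->
           f' = f %[ae lebesgue01])
      & (L2norm f <= C%:E * L2norm g)%E ] ].

(* T_W being self-adjoint, its spectrum is real. *)
Definition op_spectrum W : set R := ~` resolvent_set W.

End integral_operator.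

Section probability_notions.
Context {R : realType} {d : measure_display} {Omega : measurableType d}.
Variable P : probability Omega R.

Definition mutually_independent {d' : measure_display}
    {T : measurableType d'} {I : choiceType} (D : set I)
    (X : I -> {RV P >-> T}) : Prop :=
  forall (J : {fset I}) (B : I -> set T), [set` J] `<=` D ->
    (forall i, measurable (B i)) ->
    P (\bigcap_(i in [set` J]) (X i @^-1` B i)) =
      (\prod_(i <- J) P (X i @^-1` B i))%E.

(* [g = P(E | G)] almost surely, for a sub-sigma-algebra [G]. *)
Definition cond_prob (G : set (set Omega)) (E : set Omega)
    (g : Omega -> R) : Prop :=
  exists h : Omega -> R,
    [/\ P.-integrable setT (EFin \o h),
        (forall B : set R, measurable B -> G (h @^-1` B)),
        (forall B : set Omega, G B ->
           \int[P]_(w in B) (h w)%:E = P (E `&` B))%E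
      & {ae P, forall w, h w = g w} ].

Definition cond_independent {d' : measure_display}
    {T : measurableType d'} {I : choiceType} (G : set (set Omega))
    (D : set I) (X : I -> {RV P >-> T}) : Prop :=
  forall (J : {fset I}) (B : I -> set T) (g : I -> Omega -> R),
    [set` J] `<=` D -> (forall i, measurable (B i)) ->
    (forall i, i \in J -> cond_prob G (X i @^-1` B i) (g i)) ->
    cond_prob G (\bigcap_(i in [set` J]) (X i @^-1` B i))
      (fun w => \prod_(i <- J) g i w).

Definition uniform01 (U : {RV P >-> R}) : Prop :=
  forall B : set R, measurable B ->
    distribution P U B = uniform_prob (@ltr01 R) B.

Definition cvg_in_prob (Y : nat -> Omega -> R) (l : R) : Prop :=
  forall e : R, 0 < e ->
    P [set w | e <= `|Y n w - l|] @[n --> \oo] --> 0%E.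

Definition weak_cvg_in_prob (mu : nat -> Omega -> {measure set R -> \bar R})
    (nu : {measure set R -> \bar R}) : Prop :=
  forall F : R -> R, continuous F -> (exists M : R, forall x, `|F x| <= M) ->
    cvg_in_prob (fun n w => \int[mu n w]_x F x) (\int[nu]_x F x).

End probability_notions.

Section random_graphs.
Context {R : realType} {d : measure_display} {Omega : measurableType d}.
Variable P : probability Omega R.
Variable W : R -> R -> R.

(* Vertices and sample points are numbered from 0: [i : 'I_n] is vertex [i+1]
   and [X i] is X_(i+1). *)
Definition edge_pairs n : set ('I_n * 'I_n) := [set p : 'I_n * 'I_n | (p.1 < p.2)%N].

Definition random_adjacency n (A : 'I_n -> 'I_n -> {RV P >-> bool}) : Prop :=
  (forall i j w, A i j w = A j i w) /\ (forall i w, A i i w = false).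

Definition modelA n (A : 'I_n -> 'I_n -> {RV P >-> bool}) : Prop :=
  [/\ random_adjacency A,
      mutually_independent (@edge_pairs n) (fun p => A p.1 p.2)
    & forall i j, i != j ->
        P (A i j @^-1` [set true]) =
          (W (i.+1%:R / n%:R) (j.+1%:R / n%:R))%:E ].

Definition order_stat (X : nat -> {RV P >-> R}) n (i : 'I_n) (w : Omega) : R :=
  nth 0 (sort <=%O [seq X k w | k <- iota 0 n]) i.

Definition modelB_graph (e : R) (X : nat -> {RV P >-> R}) n
    (A : 'I_n -> 'I_n -> {RV P >-> bool}) : Prop :=
  let G := g_sigma_preimage (fun k : 'I_n => X k : Omega -> R) in
  [/\ random_adjacency A,
      cond_independent G (@edge_pairs n) (fun p => A p.1 p.2)
    & forall i j, i != j ->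
        cond_prob P G (A i j @^-1` [set true])
          (fun w => e * W (order_stat X i w) (order_stat X j w)) ].

Definition modelB (xi : R) (eps : nat -> R) (X : nat -> {RV P >-> R})
    (A : forall n, 'I_n -> 'I_n -> {RV P >-> bool}) : Prop :=
  [/\ (forall k, uniform01 (X k)) /\ mutually_independent setT X,
      forall n, (0 < n)%N -> 0 < eps n <= 1,
      4 < xi,
      (ln n%:R `^ xi) / (n%:R * eps n) @[n --> \oo] --> (0 : R)
    & forall n, modelB_graph (eps n) X (A n) ].

Definition adjacency n (A : 'I_n -> 'I_n -> {RV P >-> bool}) (w : Omega) :
  'M[R]_n := \matrix_(i, j) (A i j w)%:R.

End random_graphs.

Section eigen_friendship_bias.
Context {R : realType}.

Definition degree n (A : 'M[R]_n) (i : 'I_n) : R := \sum_j A i j.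

Definition largest_eigenvalue n (A : 'M[R]_n) (lam : R) : Prop :=
  eigenvalue A lam /\ forall lam', eigenvalue A lam' -> lam' <= lam.

Definition top_eigenvector n (A : 'M[R]_n) (r : 'cV[R]_n) : Prop :=
  exists lam, [/\ largest_eigenvalue A lam, A *m r = lam *: r,
    forall i, 0 <= r i 0 & n%:R^-1 * \sum_i r i 0 ^+ 2 = 1].

Definition eigen_bias n (A : 'M[R]_n) (r : 'cV[R]_n) (i : 'I_n) : R :=
  ((degree A i)^-1 * (\sum_j A i j * r j 0) - r i 0) * (degree A i != 0)%:R.

Definition empirical_measure n (x : 'I_n -> R) : set R -> \bar R :=
  fun B => ((n%:R^-1)%:E * \sum_(i < n) \d_(x i) B)%E.

Section measure_instance.
Variables (n : nat) (x : 'I_n -> R).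

Let mu : {measure set R -> \bar R} :=
  mscale (n%:R^-1)%:nng
    (msum (fun k => if insub k is Some i then dirac (x i) : {measure set R -> \bar R}
                    else mzero) n).

Let empirical_measureE : empirical_measure x = mu.
Proof.
apply/funext => B; rewrite /empirical_measure /mu /= /mscale /= /msum.
by congr (_ * _)%E; apply: eq_bigr => i _; rewrite valK.
Qed.

Let empirical_measure0 : empirical_measure x set0 = 0%E.
Proof. by rewrite empirical_measureE measure0. Qed.

Let empirical_measure_ge0 B : (0 <= empirical_measure x B)%E.
Proof. by rewrite empirical_measureE measure_ge0. Qed.

Let empirical_measure_sigma_additive :
  semi_sigma_additive (empirical_measure x).
Proof. rewrite empirical_measureE; exact: measure_semi_sigma_additive. Qed.

HB.instance Definition _ := isMeasure.Build _ R R (empirical_measure x)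
  empirical_measure0 empirical_measure_ge0 empirical_measure_sigma_additive.

End measure_instance.

End eigen_friendship_bias.

(* Main.v *)
Require Import Defs.
From HB Require Import structures.
From mathcomp Require Import all_boot all_order all_algebra finmap.
From mathcomp Require Import all_classical all_reals all_analysis.
From mathcomp Require Import measurable_realfun ring lra zify.

Set Implicit Arguments.
Unset Strict Implicit.
Unset Printing Implicit Defensive.

Import Order.TTheory GRing.Theory Num.Theory.
Import numFieldNormedType.Exports.

(** A nonnegative eigenvector r of the adjacency matrix A, for the eigenvalue
    lam, is compared with the vector v_i = phi(i/n), where phi is taken in its
    continuous version (T_W phi) / rho ([continuous_eigenfunction]).  Write
    N = n eps_n, with eps_n = 1 in Model A.  Two properties of the graph force
    r to be close to v in mean square.  Both hold outside an event of vanishing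
    probability as soon as N dominates log n, by Chernoff and union bounds
    ([typical_graph]).

    First, v almost solves the eigenvalue equation row by row:
    (A v)_i = N (rho + o(1)) v_i uniformly in i, and d_i = N (K(i/n) + o(1)).
    Pairing A r = lam r with v > 0 gives lam = N (rho + o(1))
    ([nearly_perron_value]).  With g = r / v, the identity
      sum_ij A_ij v_i v_j (g_i - g_j)^2
        = 2 sum_i (r_i^2 / v_i) ((A v)_i - lam v_i)
    then shows that the Dirichlet energy of g is o(n N)
    ([nearly_perron_dirichlet]).

    Second, the graph expands: every set S of at most n/2 vertices sends at
    least c N |S| edges to its complement.  The union over all S is affordable
    because the failure probability decays like exp (- c N |S|).  Through the
    layer-cake form of Cheeger's argument ([coarea], [poincare]), expansion
    turns the small Dirichlet energy into: g is close in mean square to a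
    constant.  As r and v have asymptotically the same norm, the constant is
    close to 1 ([avg_norm2_profile], [bias_close]).

    Expansion of the graph comes from expansion of the kernel, which comes from
    K >= kmin: nearby points x, x' of [0,1] both have a y with W(x,y) and
    W(x',y) bounded below, so a cut that separates x from x' must cut the pair
    (x,y) or the pair (x',y), and a chain of nearby points joins any two points
    ([chained_blocks_cut], [grid_expands]).

    The models enter through the record [sandwiched] alone: on a likely event,
    the probability that given edges are all present, or all absent, is at most
    the product of the probabilities eps_n (W(i/n,j/n) + eta), or
    1 - eps_n (W(i/n,j/n) - eta).  In Model B the likely event is that every
    order statistic X_(i) is close to i/n.

    Hence the friendship-biases (lam / d_i - 1) r_i are close in mean square to
    the values of (rho / K - 1) phi at the points i/n, and integrals against
    the empirical measure become Riemann sums. *)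

Local Open Scope ring_scope.

(** * Discrete Cheeger and Poincare inequalities *)

Section isoperimetry.
Context {R : realFieldType} {I : finType}.
Implicit Types (A : I -> I -> R) (u g : I -> R) (S : {set I}).

Definition cut A S : R := \sum_(i in S) \sum_(j in ~: S) A i j.

Definition expands A (c : R) (k : nat) : Prop :=
  forall S, (#|S| <= k)%N -> c * #|S|%:R <= cut A S.

Definition dirichlet A g : R := \sum_i \sum_j A i j * (g i - g j) ^+ 2.

Lemma cutE A S : cut A S = \sum_i \sum_j A i j * ((i \in S) && (j \notin S))%:R.
Proof.
rewrite /cut [LHS]big_mkcond; apply: eq_bigr => i _; case: (i \in S) => /=.
  by rewrite big_mkcond; apply: eq_bigr => j _; rewrite inE; case: ifP => _;
    rewrite ?mulr1 ?mulr0.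
by rewrite big1 // => j _; rewrite mulr0.
Qed.

(** The sum over the superlevel sets of u, without integrals: subtracting
    from u its least positive value t times the indicator of its support T
    lowers the right-hand side by at least t times the cut of T, and shrinks
    the support. *)
Lemma coarea A c k : (forall i j, 0 <= A i j) -> expands A c k ->
  forall u, (forall i, 0 <= u i) -> (#|[set i | u i != 0%R]| <= k)%N ->
  c * \sum_i u i <= \sum_i \sum_j A i j * `|u i - u j|.
Proof.
move=> A0 HA u; have [m] := ubnP #|[set i | u i != 0%R]|.
elim: m u => // m IH u + u0 uk; rewrite ltnS => um.
have [T0|[i0 i0T]] := finset.set_0Vmem [set i | u i != 0%R].
  have uE i : u i = 0.
    by apply/eqP/negPn/negP => ui; have := finset.in_set0 i; rewrite -T0 inE ui.
  rewrite big1 ?mulr0; last by move=> i _; rewrite uE.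
  by apply: sumr_ge0 => i _; apply: sumr_ge0 => j _; rewrite mulr_ge0.
set T := [set i | u i != 0%R] in um uk i0T.
pose i1 := [arg min_(i < i0 in T) u i]%O.
have [i1T i1min] : i1 \in T /\ forall j, j \in T -> u i1 <= u j.
  by rewrite /i1; case: arg_minP.
pose t := u i1.
have t0 : 0 < t by move: i1T; rewrite inE lt0r => ->; rewrite /= u0.
pose v i := u i - t * (i \in T)%:R.
have vE i : u i = v i + t * (i \in T)%:R by rewrite subrK.
have vN i : i \notin T -> v i = 0.
  move=> iT; rewrite /v (negbTE iT) mulr0 subr0.
  by move: iT; rewrite inE negbK => /eqP.
have v0 i : 0 <= v i.
  have [iT|iT] := boolP (i \in T); last by rewrite vN.
  by rewrite /v iT mulr1 subr_ge0 i1min.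
have vT : [set i | v i != 0%R] \proper T.
  apply/fintype.properP; split.
    by apply/fintype.subsetP => i; rewrite !inE; apply: contraNN => /eqP ui;
      apply/eqP/vN; rewrite inE ui eqxx.
  by exists i1 => //; rewrite inE negbK /v i1T mulr1 subrr.
have IHv := IH v (leq_trans (proper_card vT) um) v0
  (leq_trans (ltnW (proper_card vT)) uk).
have -> : \sum_i u i = \sum_i v i + t * #|T|%:R.
  under eq_bigr do rewrite vE.
  rewrite big_split /= -mulr_sumr; congr (_ + _ * _).
  rewrite -sum1_card natr_sum [RHS]big_mkcond.
  by apply: eq_bigr => i _; case: (i \in T).
clearbody v t; rewrite mulrDr mulrCA.
apply: (@le_trans _ _ (\sum_i \sum_j A i j * `|v i - v j| + t * cut A T)).
  by rewrite lerD // ler_wpM2l ?(ltW t0) // HA.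
rewrite cutE mulr_sumr -big_split /=; apply: ler_sum => i _.
rewrite mulr_sumr -big_split /=; apply: ler_sum => j _.
rewrite mulrCA -mulrDr ler_wpM2l //.
rewrite (vE i) (vE j); have [iT|iT] := boolP (i \in T);
  have [jT|jT] := boolP (j \in T); rewrite /= ?mulr1 ?mulr0 ?addr0.
- by rewrite opprD addrACA subrr addr0.
- by rewrite (vN j) // !subr0 !ger0_norm ?addr_ge0 // ltW.
- by rewrite (vN i) // !sub0r !normrN !ger0_norm ?addr_ge0 ?lerDl // ltW.
- by [].
Qed.

Lemma median g (i0 : I) : exists i,
  (2 * #|[set j | (g i < g j)%R]| <= #|I|)%N /\ (2 * #|[set j | (g j < g i)%R]| <= #|I|)%N.
Proof.
pose Q i := (2 * #|[set j | (g i < g j)%R]| <= #|I|)%N.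
have [imax imaxP] : exists i, forall j, g j <= g i.
  by case: (@arg_maxP _ _ _ i0 xpredT g isT) => i _ H; exists i => j; apply: H.
have Qmax : Q imax.
  rewrite /Q (_ : [set _ | _] = finset.set0) ?cards0 //.
  by apply/finset.setP => j; rewrite !inE ltNge imaxP.
case: (@arg_minP _ _ _ imax Q g Qmax) => i Qi imin; exists i; split => //.
have [T0|[j0 j0T]] := finset.set_0Vmem [set j | (g j < g i)%R].
  by rewrite T0 cards0.
case: (@arg_maxP _ _ _ j0 [in [set j | (g j < g i)%R]] g j0T) => j.
rewrite inE => ji jmax.
have : ~~ Q j by apply/negP => /imin; rewrite leNgt ji.
rewrite -ltnNge => H.
have HS : [set k | (g k < g i)%R] \subset ~: [set k | (g j < g k)%R].
  by apply/fintype.subsetP => k; rewrite !inE -leNgt => ki; apply: jmax; rewrite /= inE.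
have HC := subset_leq_card HS.
have HD := cardsC [set k | (g j < g k)%R].
by lia.
Qed.

(** Cheeger's trick: [coarea] is applied to g^2, and
    |g_i^2 - g_j^2| = |g_i - g_j| (g_i + g_j) is split by the weighted
    arithmetic-geometric inequality between the Dirichlet energy and the
    left-hand side, which absorbs its share. *)
Lemma half_poincare A c k b g : 0 < c -> 0 < b ->
  (forall i j, 0 <= A i j) -> (forall i j, A i j = A j i) ->
  (forall i, \sum_j A i j <= b) -> expands A c k ->
  (forall i, 0 <= g i) -> (#|[set i | g i != 0%R]| <= k)%N ->
  c ^+ 2 * \sum_i g i ^+ 2 <= 4 * b * dirichlet A g.
Proof.
move=> c0 b0 A0 Asym Ab HA g0 gk.
have gk2 : (#|[set i | g i ^+ 2 != 0%R]| <= k)%N.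
  by rewrite (eq_card (_ : _ =i [set i | g i != 0%R])) // => i; rewrite !inE sqrf_eq0.
have := @coarea A c k A0 HA (fun i => g i ^+ 2) (fun i => sqr_ge0 _) gk2.
set Q := \sum_i g i ^+ 2 => HQ.
(* This weight makes the absorbed term half of the left-hand side. *)
pose t := c / (4 * b).
have t0 : 0 < t by rewrite divr_gt0 // mulr_gt0.
have symsum : \sum_i \sum_j A i j * (g i + g j) ^+ 2 <= 4 * b * Q.
  apply: (@le_trans _ _ (\sum_i \sum_j (A i j * (2 * g i ^+ 2) + A i j * (2 * g j ^+ 2)))).
    apply: ler_sum => i _; apply: ler_sum => j _; rewrite -mulrDr ler_wpM2l ?A0 //.
    by have := sqr_ge0 (g i - g j); rewrite sqrrB sqrrD; lra.
  have E1 : \sum_i \sum_j A i j * (2 * g i ^+ 2) <= 2 * b * Q.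
    rewrite /Q mulr_sumr; apply: ler_sum => i _.
    by rewrite -mulr_suml mulrCA mulrA ler_wpM2r ?sqr_ge0 // ler_wpM2l.
  have E2 : \sum_i \sum_j A i j * (2 * g j ^+ 2) <= 2 * b * Q.
    rewrite exchange_big /=; apply: le_trans E1; apply: ler_sum => i _.
    by apply: ler_sum => j _; rewrite Asym.
  under eq_bigr do rewrite big_split.
  rewrite big_split /=; lra.
have H : c * Q <= t^-1 / 2 * dirichlet A g + t / 2 * (4 * b * Q).
  apply: le_trans HQ _.
  apply: (@le_trans _ _ (t^-1 / 2 * dirichlet A g +
     t / 2 * (\sum_i \sum_j A i j * (g i + g j) ^+ 2))); last first.
    by rewrite lerD2l ler_wpM2l // ltW // divr_gt0.
  rewrite /dirichlet !mulr_sumr -big_split /=; apply: ler_sum => i _.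
  rewrite !mulr_sumr -big_split /=; apply: ler_sum => j _.
  rewrite mulrCA (mulrCA (t / 2)) -mulrDr ler_wpM2l //.
  rewrite subr_sqr normrM (ger0_norm (addr_ge0 (g0 i) (g0 j))).
  set x := g i - g j; set y := g i + g j.
  have -> : x ^+ 2 = `|x| ^+ 2 by rewrite real_normK ?num_real.
  have : 0 <= (`|x| - t * y) ^+ 2 by apply: sqr_ge0.
  rewrite -(pmulr_rge0 _ (_ : 0 < t^-1 / 2)) ?divr_gt0 ?invr_gt0 //.
  have -> : t^-1 / 2 * (`|x| - t * y) ^+ 2 =
     t^-1 / 2 * `|x| ^+ 2 + t / 2 * y ^+ 2 - `|x| * y by field; rewrite gt_eqF.
  lra.
have -> : 4 * b * dirichlet A g = c ^+ 2 * 4 * b / c ^+ 2 * dirichlet A g.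
  by field; rewrite gt_eqF.
move: H; rewrite /t invf_div.
have -> : 4 * b / c / 2 * dirichlet A g + c / (4 * b) / 2 * (4 * b * Q) =
  2 * b / c * dirichlet A g + c / 2 * Q by field; rewrite !gt_eqF.
move=> H.
have {}H : c * Q <= 4 * b / c * dirichlet A g.
  have -> : 4 * b / c * dirichlet A g = 2 * (2 * b / c * dirichlet A g).
    by field; rewrite gt_eqF.
  lra.
have -> : c ^+ 2 * Q = c * (c * Q) by ring.
have -> : c ^+ 2 * 4 * b / c ^+ 2 * dirichlet A g = c * (4 * b / c * dirichlet A g).
  by field; rewrite gt_eqF.
by rewrite ler_pM2l.
Qed.

Lemma dirichlet_contraction A (f : R -> R) g : (forall i j, 0 <= A i j) ->
  (forall x y, `|f x - f y| <= `|x - y|) ->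
  dirichlet A (f \o g) <= dirichlet A g.
Proof.
move=> A0 fL; apply: ler_sum => i _; apply: ler_sum => j _.
rewrite ler_wpM2l //= -(real_normK (num_real (f _ - _))).
by rewrite -(real_normK (num_real (g i - _))) ler_sqr ?nnegrE.
Qed.

(** The parts of g above and below a median are each supported on at most
    half of the vertices, and taking them does not increase the energy. *)
Lemma poincare A c b g (i0 : I) : 0 < c -> 0 < b ->
  (forall i j, 0 <= A i j) -> (forall i j, A i j = A j i) ->
  (forall i, \sum_j A i j <= b) -> expands A c (#|I| %/ 2) ->
  exists i, c ^+ 2 * \sum_j (g j - g i) ^+ 2 <= 8 * b * dirichlet A g.
Proof.
move=> c0 b0 A0 Asym Ab HA; have [i [iu il]] := median g i0; exists i.
pose fp x := Num.max (x - g i) 0; pose fm x := Num.max (g i - x) 0.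
have fpL x y : `|fp x - fp y| <= `|x - y|.
  rewrite /fp; case: (leP (x - g i) 0) => hx; case: (leP (y - g i) 0) => hy;
  rewrite ?subrr ?normr0 //; rewrite ler_norml; apply/andP; split;
  have := ler_norm (x - y); have := ler_norm (y - x); rewrite -(distrC x y); lra.
have fmL x y : `|fm x - fm y| <= `|x - y|.
  rewrite /fm; case: (leP (g i - x) 0) => hx; case: (leP (g i - y) 0) => hy;
  rewrite ?subrr ?normr0 //; rewrite ler_norml; apply/andP; split;
  have := ler_norm (x - y); have := ler_norm (y - x); rewrite -(distrC x y); lra.
have kp : (#|[set j | (fp \o g) j != 0%R]| <= #|I| %/ 2)%N.
  rewrite leq_divRL // mulnC; apply: leq_trans iu; rewrite leq_mul2l /=.
  apply: subset_leq_card; apply/fintype.subsetP => j; rewrite !inE /fp /=.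
  by apply: contraNT; rewrite -leNgt -subr_le0 => h; rewrite max_r.
have km : (#|[set j | (fm \o g) j != 0%R]| <= #|I| %/ 2)%N.
  rewrite leq_divRL // mulnC; apply: leq_trans il; rewrite leq_mul2l /=.
  apply: subset_leq_card; apply/fintype.subsetP => j; rewrite !inE /fm /=.
  by apply: contraNT; rewrite -leNgt -subr_le0 => h; rewrite max_r.
have fp0 j : 0 <= (fp \o g) j by rewrite /fp /= le_max lexx orbT.
have fm0 j : 0 <= (fm \o g) j by rewrite /fm /= le_max lexx orbT.
have Hp := half_poincare c0 b0 A0 Asym Ab HA fp0 kp.
have Hm := half_poincare c0 b0 A0 Asym Ab HA fm0 km.
have Dp := ler_wpM2l (ltW (mulr_gt0 (ltr0n R 4) b0)) (dirichlet_contraction g A0 fpL).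
have Dm := ler_wpM2l (ltW (mulr_gt0 (ltr0n R 4) b0)) (dirichlet_contraction g A0 fmL).
rewrite (_ : \sum_j _ = \sum_j (fp \o g) j ^+ 2 + \sum_j (fm \o g) j ^+ 2).
  by move: Hp Hm Dp Dm; simpl; lra.
rewrite -big_split /=; apply: eq_bigr => j _; rewrite /fp /fm.
case: (leP (g j - g i) 0) => h1; case: (leP (g i - g j) 0) => h2;
  rewrite ?expr0n ?addr0 ?add0r //; last by lra.
- have -> : g j - g i = 0 by lra.
  by rewrite expr0n.
- by rewrite -(sqrrN (g i - g j)) opprB.
Qed.

End isoperimetry.

(** * Vectors that are nearly Perron eigenvectors *)

Section nearly_perron.
Context {R : realFieldType} {n : nat}.
Implicit Types (A : 'I_n -> 'I_n -> R) (u v r f : 'I_n -> R).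

Definition avg f : R := n%:R^-1 * \sum_i f i.

Lemma avgD f1 f2 : avg (fun i => f1 i + f2 i) = avg f1 + avg f2.
Proof. by rewrite /avg big_split mulrDr. Qed.

Lemma avgZ c f : avg (fun i => c * f i) = c * avg f.
Proof. by rewrite /avg -mulr_sumr mulrCA. Qed.

Lemma ler_avg f1 f2 : (forall i, f1 i <= f2 i) -> avg f1 <= avg f2.
Proof. by move=> f12; rewrite /avg ler_wpM2l ?invr_ge0 // ler_sum. Qed.

Lemma eq_avg f1 f2 : f1 =1 f2 -> avg f1 = avg f2.
Proof. by move=> f12; rewrite /avg (eq_bigr _ (fun i _ => f12 i)). Qed.

Lemma avg_ge0 f : (forall i, 0 <= f i) -> 0 <= avg f.
Proof. by move=> f0; rewrite /avg mulr_ge0 ?invr_ge0 ?sumr_ge0. Qed.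

Lemma avg_sqr_lin (a b : R) u v : avg (fun i => (a * u i + b * v i) ^+ 2) =
  a ^+ 2 * avg (fun i => u i ^+ 2) + 2 * a * b * avg (fun i => u i * v i) +
  b ^+ 2 * avg (fun i => v i ^+ 2).
Proof. by rewrite -!avgZ -!avgD; apply: eq_avg => i; ring. Qed.

(** If r has norm 1, v has norm close to 1 and r is close to m v with
    m >= 0, then m is close to 1.  The averages of r^2, r v and v^2 carry all
    the information, and Cauchy-Schwarz is the only relation between them that
    enters. *)
Lemma avg_norm2_profile r v (m tau : R) : 0 <= m -> 0 < tau <= 1/16 ->
  avg (fun i => r i ^+ 2) = 1 -> `|avg (fun i => v i ^+ 2) - 1| <= tau ->
  avg (fun i => (r i - m * v i) ^+ 2) <= tau ^+ 2 ->
  avg (fun i => (r i - v i) ^+ 2) <= 100 * tau ^+ 2.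
Proof.
move=> m0 /andP[tau0 taule] r1.
have E a b := avg_sqr_lin a b r v.
rewrite (@eq_avg (fun i => (r i - v i) ^+ 2) (fun i => (1 * r i + (-1) * v i) ^+ 2));
  last by move=> i /=; ring.
rewrite (@eq_avg (fun i => (r i - m * v i) ^+ 2) (fun i => (1 * r i + (- m) * v i) ^+ 2));
  last by move=> i /=; ring.
have CS0 : 0 <= avg (fun i => (avg (fun i => v i ^+ 2) * r i +
    (- avg (fun i => r i * v i)) * v i) ^+ 2).
  by apply: avg_ge0 => i; apply: sqr_ge0.
move: CS0; rewrite !E r1.
set d := avg (fun i => v i ^+ 2); set b := avg (fun i => r i * v i).
rewrite !mulr1 ?sqrrN ?expr1n !mul1r => CS0; rewrite ler_norml => /andP[d1 d2] H.
have d0 : 0 < d by lra.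
have CS : b ^+ 2 <= d.
  have : 0 <= d * (d - b ^+ 2).
    have -> : d * (d - b ^+ 2) = d ^+ 2 + 2 * d * - b * b + b ^+ 2 * d by ring.
    by [].
  by rewrite pmulr_rge0 // subr_ge0.
have [q qE] : exists q, q = m ^+ 2 * d by exists (m ^+ 2 * d).
have q0 : 0 <= q by rewrite qE mulr_ge0 ?sqr_ge0 // ltW.
have t2 : 0 <= tau ^+ 2 <= 1/256 by nra.
have q1 : (q + 1 - tau ^+ 2) ^+ 2 <= 4 * q.
  have h1 : 0 <= q + 1 - tau ^+ 2 <= 2 * m * b by lra.
  have : (q + 1 - tau ^+ 2) ^+ 2 <= (2 * m * b) ^+ 2.
    by rewrite ler_sqr ?nnegrE; lra.
  have -> : (2 * m * b) ^+ 2 = 4 * (m ^+ 2 * b ^+ 2) by ring.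
  move=> /le_trans; apply; rewrite ler_pM2l // qE.
  by rewrite ler_wpM2l // sqr_ge0.
clear CS0 E.
have q2 : (q - 1) ^+ 2 <= 2 * tau ^+ 2 * (q + 1).
  have : 0 <= tau ^+ 4 by apply: exprn_ge0; lra.
  nra.
have q3 : q <= 5/4.
  rewrite leNgt; apply/negP => q3.
  have : (q - 1) ^+ 2 <= (q + 1) / 128 by nra.
  nra.
have q4 : (q - 1) ^+ 2 <= (3 * tau) ^+ 2 by nra.
have q5 : `|q - 1| <= 3 * tau.
  by rewrite -(@ler_sqr _ _ (3 * tau)) ?nnegrE ?real_normK ?num_real //; lra.
move: q5; rewrite ler_norml => /andP[q5 q6].
have m1 : - (6 * tau) <= m ^+ 2 - 1 <= 6 * tau by nra.
have m2 : - (6 * tau) <= m - 1 <= 6 * tau by nra.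
have m3 : 1/2 <= m by lra.
have H2 : m * (1 + d - 2 * b) <= (m - 1) * (1 - m * d) + tau ^+ 2 by lra.
have H3 : (m - 1) * (1 - m * d) <= 48 * tau ^+ 2.
  have -> : (m - 1) * (1 - m * d) = (m-1) * (1 - d) - d * (m-1)^+2 by ring.
  have : 0 <= d * (m - 1) ^+ 2 by rewrite mulr_ge0 ?sqr_ge0 // ltW.
  have : (m - 1) * (1 - d) <= 6 * tau * tau.
    apply: le_trans (ler_norm _) _; rewrite normrM.
    by apply: ler_pM => //; rewrite ler_norml; lra.
  nra.
have : m * (1 + d - 2 * b) <= 49 * tau ^+ 2 by lra.
have h : 49 * tau ^+ 2 <= m * (98 * tau ^+ 2) by nra.
move=> /le_trans /(_ h); rewrite ler_pM2l; lra.
Qed.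

(** Both sides are tested against r: sum_i v_i (A r)_i = sum_i r_i (A v)_i
    by symmetry, and sum_i r_i v_i > 0. *)
Lemma nearly_perron_value A r v (lam c0 d0 mu : R) :
  (forall i j, A i j = A j i) -> 0 < c0 ->
  (forall i, c0 <= v i) -> (forall i, 0 <= r i) -> 0 < avg (fun i => r i ^+ 2) ->
  (forall i, \sum_j A i j * r j = lam * r i) ->
  (forall i, `|\sum_j A i j * v j - mu * v i| <= d0 * v i) ->
  `|lam - mu| <= d0.
Proof.
move=> Asym c00 vc r0 r1 Ar Av.
have v0 i : 0 < v i by apply: lt_le_trans (vc i).
have sum_gt0 : 0 < \sum_i r i * v i.
  rewrite lt0r sumr_ge0 ?andbT => [|i _]; last by rewrite mulr_ge0 // ltW.
  apply: contraTN r1 => /eqP s0; rewrite -leNgt /avg big1 ?mulr0 // => i _.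
  have := psumr_eq0P (fun i (_ : true) => mulr_ge0 (r0 i) (ltW (v0 i))) s0 (erefl : true).
  by move=> /(_ i)/eqP; rewrite mulf_eq0 (gt_eqF (v0 i)) orbF => /eqP->; rewrite expr0n.
have E : (lam - mu) * \sum_i r i * v i =
    \sum_i r i * (\sum_j A i j * v j - mu * v i).
  under [RHS]eq_bigr do rewrite mulrBr mulr_sumr.
  rewrite sumrB exchange_big /= mulrBl !mulr_sumr; congr (_ - _).
    apply: eq_bigr => i _; rewrite mulrA -Ar mulr_suml; apply: eq_bigr => j _.
    by rewrite Asym; ring.
  by apply: eq_bigr => i _; ring.
rewrite -(ler_pM2r sum_gt0) -{1}(gtr0_norm sum_gt0) -normrM E.
apply: le_trans (ler_norm_sum _ _ _) _; rewrite mulr_sumr; apply: ler_sum => i _.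
by rewrite normrM (ger0_norm (r0 i)) mulrCA ler_wpM2l.
Qed.

(** The Doob transform of A by v turns the quadratic form of mu - A into the
    Dirichlet form of r / v, up to the error terms (A v)_i - mu v_i. *)
Lemma nearly_perron_dirichlet A r v (lam c0 d0 mu : R) :
  (forall i j, 0 <= A i j) -> (forall i j, A i j = A j i) -> 0 < c0 ->
  (forall i, c0 <= v i) -> (forall i, 0 <= r i) ->
  (forall i, \sum_j A i j * r j = lam * r i) ->
  (forall i, `|\sum_j A i j * v j - mu * v i| <= d0 * v i) ->
  `|lam - mu| <= d0 ->
  c0 ^+ 2 * dirichlet A (fun i => r i / v i) <= 4 * d0 * \sum_i r i ^+ 2.
Proof.
move=> A0 Asym c00 vc r0 Ar Av lm.
have v0 i : 0 < v i by apply: lt_le_trans (vc i).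
apply: (@le_trans _ _ (\sum_i \sum_j A i j * (v i * v j) * (r i / v i - r j / v j) ^+ 2)).
  rewrite /dirichlet mulr_sumr; apply: ler_sum => i _.
  rewrite mulr_sumr; apply: ler_sum => j _.
  rewrite mulrCA -mulrA ler_wpM2l // ler_wpM2r ?sqr_ge0 // expr2.
  by apply: ler_pM => //; apply: ltW.
have -> : \sum_i \sum_j A i j * (v i * v j) * (r i / v i - r j / v j) ^+ 2 =
   \sum_i (r i ^+ 2 / v i * \sum_j A i j * v j) - 2 * \sum_i (r i * \sum_j A i j * r j)
   + \sum_i (r i ^+ 2 / v i * \sum_j A i j * v j).
  under [in RHS]eq_bigr do rewrite mulr_sumr.
  rewrite mulr_sumr.
  under [in X in _ - X]eq_bigr do rewrite !mulr_sumr.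
  rewrite [X in _ + X]exchange_big /= -sumrB -big_split /=; apply: eq_bigr => i _.
  rewrite -sumrB -big_split /=; apply: eq_bigr => j _; rewrite (Asym j i); field.
  by rewrite !gt_eqF.
have -> : \sum_i r i * (\sum_j A i j * r j) = lam * \sum_i r i ^+ 2.
  by rewrite mulr_sumr; apply: eq_bigr => i _; rewrite Ar; ring.
have : \sum_i (r i ^+ 2 / v i * \sum_j A i j * v j) <= (mu + d0) * \sum_i r i ^+ 2.
  rewrite mulr_sumr; apply: ler_sum => i _.
  have -> : (mu + d0) * r i ^+ 2 = r i ^+ 2 / v i * ((mu + d0) * v i).
    by field; rewrite gt_eqF.
  rewrite ler_wpM2l ?divr_ge0 ?sqr_ge0 ?(ltW (v0 i)) //.
  by move: (Av i); rewrite ler_norml; lra.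
have : 0 <= \sum_i r i ^+ 2 by apply: sumr_ge0 => i _; apply: sqr_ge0.
move: lm; rewrite ler_norml; nra.
Qed.

End nearly_perron.

Section bias.
Context {R : realFieldType}.

(** What is used of a typical graph: v is nearly an eigenvector, degrees
    follow K, sets of at most half of the vertices expand, v is nearly
    normalized.  N is the scale of
    the degrees. *)
Definition nearly_perron n (A : 'I_n -> 'I_n -> R) (v K : 'I_n -> R) (N rho c d : R) : Prop :=
  [/\ forall i, `|\sum_j A i j * v j - N * rho * v i| <= N * d * v i,
      forall i, `|\sum_j A i j - N * K i| <= N * d,
      expands A (N * c) (n %/ 2) &
      `|avg (fun i => v i ^+ 2) - 1| <= d].

Lemma perron_vector_close (c0 C0 c rho tau : R) :
  0 < c0 -> 0 < C0 -> 0 < c -> 0 < tau <= 1/16 ->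
  exists2 d, 0 < d <= 1 &
  forall n (A : 'I_n -> 'I_n -> R) (v K r : 'I_n -> R) (N lam : R),
  (0 < n)%N -> 0 < N ->
  (forall i j, 0 <= A i j) -> (forall i j, A i j = A j i) ->
  (forall i, c0 <= v i <= C0) -> (forall i, K i <= 1) ->
  (forall i, 0 <= r i) -> avg (fun i => r i ^+ 2) = 1 ->
  (forall i, \sum_j A i j * r j = lam * r i) ->
  nearly_perron A v K N rho c d ->
  `|lam - N * rho| <= N * d /\ avg (fun i => (r i - v i) ^+ 2) <= 100 * tau ^+ 2.
Proof.
move=> c00 C00 c_gt0 /andP[tau0 taule].
(* 64 = 8 * 2 * 4: the constant of the Poincare inequality, the bound 2 N on
   the degrees, and the constant of the energy bound. *)
pose d1 := tau ^+ 2 * (c ^+ 2 * c0 ^+ 2) / (64 * C0 ^+ 2).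
have d10 : 0 < d1 by rewrite divr_gt0 ?mulr_gt0 ?exprn_gt0.
exists (Num.min tau d1).
  by rewrite lt_min tau0 d10 /= ge_min (le_trans taule) //; lra.
set d := Num.min _ _ => n A v K r N lam n0 N0 A0 Asym vb K1 r0 r1 Ar [Hv Hd He Hn].
have dtau : d <= tau by rewrite ge_min lexx.
have dd1 : d <= d1 by rewrite ge_min lexx orbT.
have d0 : 0 < d by rewrite lt_min tau0 d10.
have v0 i : 0 < v i by case/andP: (vb i) => h _; apply: lt_le_trans h.
have vc i : c0 <= v i by case/andP: (vb i).
have lamN : `|lam - N * rho| <= N * d.
  by apply: (@nearly_perron_value _ _ A r v _ c0) => //; rewrite r1.
split => //.
have nR : 0 < n%:R :> R by rewrite ltr0n.
have sumr : \sum_i r i ^+ 2 = n%:R.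
  by move: r1; rewrite /avg => /(congr1 ( *%R n%:R)); rewrite mulVKf ?gt_eqF // mulr1.
have := nearly_perron_dirichlet A0 Asym c00 vc r0 Ar Hv lamN.
rewrite sumr; set D := dirichlet _ _ => HD.
have Ab i : \sum_j A i j <= 2 * N.
  by move: (Hd i) (K1 i); rewrite ler_norml => /andP[_]; nra.
have i0 : 'I_n by exact: Ordinal n0.
have Nc : 0 < N * c by rewrite mulr_gt0.
have := @poincare _ 'I_n A (N * c) (2 * N) (fun i => r i / v i) i0 Nc
  (mulr_gt0 (ltr0n _ 2) N0) A0 Asym Ab.
rewrite card_ord => /(_ He)[i1]; set m := r i1 / v i1; rewrite -/D => HP.
have m0 : 0 <= m by rewrite divr_ge0 // ltW.
apply: (@avg_norm2_profile _ _ r v m tau) => //; first by rewrite tau0.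
  exact: le_trans Hn dtau.
have E1 : \sum_i (r i - m * v i) ^+ 2 <= C0 ^+ 2 * \sum_i (r i / v i - m) ^+ 2.
  rewrite mulr_sumr; apply: ler_sum => i _.
  have -> : r i - m * v i = v i * (r i / v i - m) by field; rewrite gt_eqF.
  rewrite exprMn ler_wpM2r ?sqr_ge0 // ler_sqr ?nnegrE ?(ltW C00) ?(ltW (v0 i)) //.
  by case/andP: (vb i).
rewrite /avg ler_pdivrMl //.
apply: le_trans E1 _; move: HP; set S := \sum_i _ => HP.
have P0 : 0 < N ^+ 2 * (c ^+ 2 * c0 ^+ 2) by rewrite !mulr_gt0 ?exprn_gt0.
rewrite -(ler_pM2l P0).
apply: (@le_trans _ _ (C0 ^+ 2 * (16 * N * (4 * (N * d) * n%:R)))).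
  have -> : N ^+ 2 * (c ^+ 2 * c0 ^+ 2) * (C0 ^+ 2 * S) =
    C0 ^+ 2 * (c0 ^+ 2 * ((N * c) ^+ 2 * S)) by ring.
  rewrite ler_wpM2l ?sqr_ge0 //.
  apply: (@le_trans _ _ (c0 ^+ 2 * (8 * (2 * N) * D))).
    by rewrite ler_wpM2l ?sqr_ge0.
  have -> : c0 ^+ 2 * (8 * (2 * N) * D) = 16 * N * (c0 ^+ 2 * D) by ring.
  by rewrite ler_wpM2l // mulr_ge0 // ltW.
have -> : C0 ^+ 2 * (16 * N * (4 * (N * d) * n%:R)) =
  (64 * C0 ^+ 2 * N ^+ 2 * n%:R) * d by ring.
have -> : N ^+ 2 * (c ^+ 2 * c0 ^+ 2) * (n%:R * tau ^+ 2) =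
  (64 * C0 ^+ 2 * N ^+ 2 * n%:R) * d1 by rewrite /d1; field; rewrite gt_eqF.
apply: ler_wpM2l dd1.
by exact: mulr_ge0 (mulr_ge0 (mulr_ge0 (ler0n _ 64) (sqr_ge0 _)) (sqr_ge0 _)) (ler0n _ _).
Qed.

(** With lam = N (rho + O(d)) and d_i = N (K_i + O(d)), the bias is
    (lam / d_i - 1) r_i, and the error splits as
    (lam / d_i - rho / K_i) r_i + (rho / K_i - 1) (r_i - v_i). *)
Lemma bias_close (c0 C0 c rho km kappa : R) :
  0 < c0 -> 0 < C0 -> 0 < c -> 0 < rho -> 0 < km -> 0 < kappa ->
  exists2 d, 0 < d <= 1 &
  forall n (A : 'I_n -> 'I_n -> R) (v K r : 'I_n -> R) (N lam : R),
  (0 < n)%N -> 0 < N ->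
  (forall i j, 0 <= A i j) -> (forall i j, A i j = A j i) ->
  (forall i, c0 <= v i <= C0) -> (forall i, km <= K i <= 1) ->
  (forall i, 0 <= r i) -> avg (fun i => r i ^+ 2) = 1 ->
  (forall i, \sum_j A i j * r j = lam * r i) ->
  nearly_perron A v K N rho c d ->
  avg (fun i => (((\sum_j A i j)^-1 * (\sum_j A i j * r j) - r i)
                  * (\sum_j A i j != 0)%:R - (rho / K i - 1) * v i) ^+ 2) <= kappa.
Proof.
move=> c00 C00 c_gt0 rho0 km0 kappa0.
pose B := 2 * (2 * (1 + rho) / km ^+ 2) ^+ 2 + 200 * (rho / km + 1) ^+ 2.
have B0 : 0 < B.
  have h1 : 0 < 2 * (2 * (1 + rho) / km ^+ 2) ^+ 2.
    by rewrite mulr_gt0 // exprn_gt0 // divr_gt0 ?exprn_gt0 // mulr_gt0 // addr_gt0.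
  have h2 : 0 <= 200 * (rho / km + 1) ^+ 2 by rewrite mulr_ge0 ?sqr_ge0.
  by rewrite /B; lra.
have [tau [tau0 tau1 tauB]] : exists t, [/\ 0 < t, t <= 1/16 & t * B <= kappa].
  exists (Num.min (1/16) (kappa / B)).
  by rewrite lt_min -ler_pdivlMr // !ge_min !lexx orbT !divr_gt0.
have [|d' /andP[d'0 d'1] H] := @perron_vector_close c0 C0 c rho tau c00 C00 c_gt0.
  by rewrite tau0.
have [d [d0 dd' dtau dkm]] : exists d, [/\ 0 < d, d <= d', d <= tau & d <= km / 2].
  exists (Num.min d' (Num.min tau (km / 2))).
  by rewrite !lt_min !ge_min !lexx !orbT d'0 tau0 divr_gt0.
exists d; first by rewrite d0 /= (le_trans dd').
move=> n A v K r N lam n0 N0 A0 Asym vb Kb r0 r1 Ar [Hv Hd He Hn].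
have K1 i : K i <= 1 by case/andP: (Kb i).
have Kkm i : km <= K i by case/andP: (Kb i).
have K0 i : 0 < K i by apply: lt_le_trans (Kkm i).
have v0 i : 0 < v i by case/andP: (vb i) => h _; apply: lt_le_trans h.
have [_ prof] : `|lam - N * rho| <= N * d' /\ avg (fun i => (r i - v i) ^+ 2) <= 100 * tau ^+ 2.
  apply: (H n A v K) => //; split => //.
  - by move=> i; apply: le_trans (Hv i) _; rewrite ler_wpM2r ?(ltW (v0 i)) // ler_wpM2l // ltW.
  - by move=> i; apply: le_trans (Hd i) _; rewrite ler_wpM2l // ltW.
  - exact: le_trans Hn dd'.
have lamN : `|lam - N * rho| <= N * d.
  by apply: (@nearly_perron_value _ _ A r v _ c0) => //; [move=> i; case/andP: (vb i)|rewrite r1].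
have pw i : (((\sum_j A i j)^-1 * (\sum_j A i j * r j) - r i)
      * (\sum_j A i j != 0)%:R - (rho / K i - 1) * v i) ^+ 2 <=
    2 * (2 * (1 + rho) / km ^+ 2) ^+ 2 * tau ^+ 2 * r i ^+ 2 +
    2 * (rho / km + 1) ^+ 2 * (r i - v i) ^+ 2.
  rewrite Ar; set D := \sum_j A i j.
  have Dlow : N * km / 2 <= D by move: (Hd i) (Kkm i); rewrite ler_norml -/D; nra.
  have D0 : 0 < D by apply: lt_le_trans Dlow; rewrite divr_gt0 ?mulr_gt0.
  rewrite (gt_eqF D0) mulr1.
  have -> : D^-1 * (lam * r i) - r i - (rho / K i - 1) * v i =
     (lam / D - rho / K i) * r i + (rho / K i - 1) * (r i - v i) by ring.
  set a := lam / D - rho / K i; set b := rho / K i - 1.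
  have ha : a ^+ 2 <= (2 * (1 + rho) / km ^+ 2) ^+ 2 * tau ^+ 2.
    have h : `|a| <= 2 * (1 + rho) / km ^+ 2 * tau.
      have -> : a = (lam * K i - rho * D) / (D * K i) by rewrite /a; field; rewrite !gt_eqF.
      rewrite normrM normfV [ `|D * _|]gtr0_norm ?mulr_gt0 // ler_pdivrMr ?mulr_gt0 //.
      apply: (@le_trans _ _ (N * tau * (1 + rho))).
        have -> : lam * K i - rho * D = (lam - N * rho) * K i - rho * (D - N * K i) by ring.
        apply: le_trans (ler_normB _ _) _; rewrite !normrM (gtr0_norm (K0 i)) (gtr0_norm rho0).
        rewrite mulrDr mulr1; apply: lerD.
          apply: (@le_trans _ _ (`|lam - N * rho|)); first by rewrite ler_piMr.
          by apply: le_trans lamN _; rewrite ler_wpM2l // ltW.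
        rewrite mulrC ler_wpM2r ?(ltW rho0) //.
        by apply: le_trans (Hd i) _; rewrite ler_wpM2l // ltW.
      have -> : N * tau * (1 + rho) = 2 * (1 + rho) / km ^+ 2 * tau * (N * km / 2 * km).
        by field; rewrite gt_eqF.
      apply: ler_wpM2l; last first.
        by apply: ler_pM => //; [apply/ltW; rewrite divr_gt0 ?mulr_gt0 | apply: ltW].
      apply: mulr_ge0; last exact: ltW.
      by rewrite divr_ge0 ?sqr_ge0 // mulr_ge0 // addr_ge0 // ltW.
    rewrite -exprMn -(real_normK (num_real a)) ler_sqr ?nnegrE //.
    exact: le_trans h.
  have hb : b ^+ 2 <= (rho / km + 1) ^+ 2.
    have h : 0 <= rho / km + 1 by rewrite addr_ge0 // divr_ge0 // ltW.
    rewrite -(real_normK (num_real b)) ler_sqr ?nnegrE //.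
    apply: le_trans (ler_normB _ _) _; rewrite normr1 lerD2r gtr0_norm ?divr_gt0 //.
    by rewrite ler_pM2l // lef_pV2 ?posrE.
  apply: (@le_trans _ _ (2 * a ^+ 2 * r i ^+ 2 + 2 * b ^+ 2 * (r i - v i) ^+ 2)).
    have := sqr_ge0 (a * r i - b * (r i - v i)).
    have -> : (a * r i - b * (r i - v i)) ^+ 2 = 2 * a ^+ 2 * r i ^+ 2 +
        2 * b ^+ 2 * (r i - v i) ^+ 2 - (a * r i + b * (r i - v i)) ^+ 2 by ring.
    by rewrite subr_ge0.
  apply: lerD; apply: ler_wpM2r; rewrite ?sqr_ge0 //; last by rewrite ler_pM2l.
  by rewrite -mulrA ler_pM2l.
apply: le_trans (ler_avg pw) _; rewrite avgD !avgZ r1 mulr1.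
apply: le_trans tauB.
apply: (@le_trans _ _ (tau ^+ 2 * B)).
  have h : 0 <= 2 * (rho / km + 1) ^+ 2 by rewrite mulr_ge0 ?sqr_ge0.
  have := ler_wpM2l h prof; rewrite /B; set b := (_ + 1) ^+ 2; set a := (_ / _) ^+ 2.
  lra.
rewrite ler_wpM2r ?(ltW B0) //; nra.
Qed.

End bias.

(** * Expansion of a continuous kernel on the grid *)

Section chain_of_blocks.
Context {R : realFieldType} {I : finType}.

(** With p_a the fraction of the block a that lies in S, the quantity
    f a c = p_a (1 - p_c) satisfies the triangle inequality, since
    p_a (1 - p_c) is split according to whether a point of the middle block
    lies in S.  Consecutive blocks share a neighbouring block b, whence
    f a (a+1) <= f a b + f b (a+1), and both terms are bounded by the cut.
    A chain of at most m blocks joins any two. *)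
Lemma chained_blocks_cut (M : I -> I -> R) (m q : nat) (cl : I -> 'I_m) (theta : R) :
  (0 < q)%N -> 0 < theta -> (forall i j, 0 <= M i j) ->
  (forall a : 'I_m, (q <= #|[set i | cl i == a]|)%N) ->
  (forall a : 'I_m, exists b : 'I_m, forall i j : I,
     (a <= cl i <= a.+1)%N -> cl j = b -> theta <= M i j /\ theta <= M j i) ->
  forall S : {set I},
  theta * q%:R ^+ 2 * (#|S|%:R * #|~: S|%:R) <= 2 * m%:R * #|I|%:R ^+ 2 * cut M S.
Proof.
move=> q0 theta0 M0 qcell link S.
pose s (a : 'I_m) : R := #|[set i in S | cl i == a]|%:R.
pose t (a : 'I_m) : R := #|[set i in ~: S | cl i == a]|%:R.
pose z (a : 'I_m) : R := #|[set i | cl i == a]|%:R.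
have st a : s a + t a = z a.
  rewrite /s /t /z -natrD; congr _%:R; rewrite -(cardsID S [set i | cl i == a]).
  by congr (_ + _)%N; apply: eq_card => i; rewrite !inE andbC.
have qR : 0 < q%:R :> R by rewrite ltr0n.
have qz a : q%:R <= z a by rewrite ler_nat qcell.
have z0 a : 0 < z a by apply: lt_le_trans (qz a).
have zn a : z a != 0 by rewrite gt_eqF.
have zge0 a : 0 <= z a by apply: ltW.
have s0 a : 0 <= s a by rewrite /s.
have t0 a : 0 <= t a by rewrite /t.
pose e := cut M S / (theta * q%:R ^+ 2).
pose f a c := (s a / z a) * (t c / z c).
have f_tri a b c : f a c <= f a b + f b c.
  have -> : f a b + f b c = f a c + ((s a / z a) * (t b / z b) * (s c / z c)
        + (t a / z a) * (s b / z b) * (t c / z c)).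
    by rewrite /f -(st a) -(st b) -(st c); field; rewrite !st !gt_eqF.
  by rewrite lerDl addr_ge0 // !mulr_ge0 ?invr_ge0.
have cutst a b : (forall i j, cl i = a -> cl j = b -> theta <= M i j) -> f a b <= e.
  move=> H; rewrite /e ler_pdivlMr ?mulr_gt0 ?exprn_gt0 //.
  apply: (@le_trans _ _ (theta * (s a * t b))).
    have -> : f a b * (theta * q%:R ^+ 2) =
        theta * (s a * t b) * (q%:R / z a * (q%:R / z b)).
      by rewrite /f; field; rewrite !zn.
    rewrite ler_piMr ?mulr_ge0 ?(ltW theta0) //.
    by rewrite mulr_ile1 ?divr_ge0 ?ler_pdivrMr ?mul1r.
  rewrite /cut /s /t -sum1_card !natr_sum mulr_suml mulr_sumr.
  rewrite [leRHS](bigID (fun i => cl i == a)) /=.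
  rewrite ler_wpDr ?sumr_ge0 // => [i _|]; first by rewrite sumr_ge0.
  rewrite (eq_bigl (fun i => (i \in S) && (cl i == a))) /=; last by move=> i; rewrite inE.
  apply: ler_sum => i /andP[iS /eqP ia]; rewrite mul1r.
  rewrite -sum1_card natr_sum mulr_sumr [leRHS](bigID (fun i => cl i == b)) /=.
  rewrite ler_wpDr ?sumr_ge0 //.
  rewrite (eq_bigl (fun i => (i \in ~: S) && (cl i == b))) /=; last by move=> j; rewrite !inE.
  by apply: ler_sum => j /andP[jS /eqP jb]; rewrite mulr1; apply: H.
have step (a c : 'I_m) : (a <= c <= a.+1)%N -> f a c <= 2 * e /\ f c a <= 2 * e.
  move=> ac; have [b Hb] := link a; have -> : 2 * e = e + e by ring.
  split; apply: le_trans (f_tri _ b _) _; apply: lerD; apply: cutst => i j.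
  - by move=> ia jb; case: (Hb i j) => //; rewrite ia; lia.
  - by move=> ib jc; case: (Hb j i) => //; rewrite jc.
  - by move=> ic jb; case: (Hb i j) => //; rewrite ic.
  - by move=> ib ja; case: (Hb j i) => //; rewrite ja; lia.
(* The case k = 0 is included: two points of one block are joined through the
   common neighbour of that block. *)
have walk k : forall a c : 'I_m, (c = a + k :> nat)%N ->
    f a c <= 2 * k.+1%:R * e /\ f c a <= 2 * k.+1%:R * e.
  elim: k => [|k IHk] a c ck.
    by rewrite mulr1; apply: step; lia.
  have bm : (a + k < m)%N by have := ltn_ord c; lia.
  have [h1 h2] := IHk a (Ordinal bm) (erefl _).
  have [h3 h4] : f (Ordinal bm) c <= 2 * e /\ f c (Ordinal bm) <= 2 * e.
    by apply: step => /=; lia.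
  have E : 2 * k.+2%:R * e = 2 * k.+1%:R * e + 2 * e by rewrite -[k.+2]addn1 natrD; ring.
  split; first by apply: le_trans (f_tri _ (Ordinal bm) _) _; rewrite E lerD.
  by apply: le_trans (f_tri _ (Ordinal bm) _) _; rewrite E addrC lerD.
have e0 : 0 <= e.
  rewrite divr_ge0 ?mulr_ge0 ?(ltW theta0) ?sqr_ge0 //.
  by apply: sumr_ge0 => i _; apply: sumr_ge0.
have fall a c : f a c <= 2 * m%:R * e.
  have kle k : (k.+1 <= m)%N -> 2 * k.+1%:R * e <= 2 * m%:R * e.
    by move=> km; rewrite ler_wpM2r // ler_pM2l // ler_nat.
  have [ac|/ltnW ca] := leqP a c.
    have [h _] := @walk (c - a)%N a c ltac:(lia); apply: le_trans h _; apply: kle.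
    by have := ltn_ord c; lia.
  have [_ h] := @walk (a - c)%N c a ltac:(lia); apply: le_trans h _; apply: kle.
  by have := ltn_ord a; lia.
have sumcl (B : {set I}) : #|B|%:R = \sum_a #|[set i in B | cl i == a]|%:R :> R.
  rewrite -natr_sum -sum1_card (partition_big cl xpredT) //=; congr _%:R.
  by apply: eq_bigr => a _; rewrite sum1dep_card.
have zI : \sum_a z a = #|I|%:R.
  rewrite -cardsT sumcl; apply: eq_bigr => a _; congr _%:R.
  by apply: eq_card => i; rewrite !inE.
have key : #|S|%:R * #|~: S|%:R <= 2 * m%:R * e * #|I|%:R ^+ 2.
  rewrite (sumcl S) (sumcl (~: S)) big_distrlr /= -zI expr2 big_distrlr /= mulr_sumr.
  apply: ler_sum => a _; rewrite mulr_sumr; apply: ler_sum => c _.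
  rewrite -/(s a) -/(t c).
  have -> : s a * t c = f a c * (z a * z c) by rewrite /f; field; rewrite !zn.
  by rewrite ler_wpM2r ?mulr_ge0.
have P : 0 < theta * q%:R ^+ 2 by rewrite mulr_gt0 ?exprn_gt0.
rewrite -(ler_pM2l P) in key; apply: le_trans key _.
rewrite le_eqVlt; apply/orP; left; apply/eqP; rewrite /e; field.
by rewrite !gt_eqF.
Qed.

Definition grid n (i : 'I_n) : R := i.+1%:R / n%:R.

End chain_of_blocks.

Section grid_expansion.
Context {R : realType}.
Implicit Types (W : R -> R -> R).

Definition unif_cont01 W := forall eta : R, 0 < eta -> exists2 delta : R, 0 < delta &
  forall x x' y y' : R, x \in `[0, 1] -> x' \in `[0, 1] -> y \in `[0, 1] -> y' \in `[0, 1] ->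
  `|x - x'| <= delta -> `|y - y'| <= delta -> `|W x y - W x' y'| <= eta.

Lemma grid01 n (i : 'I_n) : (@grid R n i \in `[0, 1]).
Proof.
have n0 : 0 < n%:R :> R by rewrite ltr0n; case: (n) i => // -[].
by rewrite in_itv /= /grid divr_ge0 ?ler0n //= ler_pdivrMr // mul1r ler_nat ltn_ord.
Qed.

(** The cell is the integer part of m y, except at y = 1, which belongs to
    the last cell. *)
Lemma floor_cell (m : nat) (y : R) : (0 < m)%N -> y \in `[0, 1] ->
  exists b : 'I_m, `|y - b%:R / m%:R| <= m%:R^-1.
Proof.
case: m => // m _; rewrite in_itv /= => /andP[y0 y1].
have mR : 0 < m.+1%:R :> R by rewrite ltr0n.
have ym0 : 0 <= y * m.+1%:R by rewrite mulr_ge0.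
have /andP[h1 h2] := Num.Theory.truncn_itv ym0.
set k := Num.truncn _ in h1 h2.
have key (b : nat) : `|y * m.+1%:R - b%:R| <= 1 -> `|y - b%:R / m.+1%:R| <= m.+1%:R^-1.
  move=> h; rewrite -(ler_pM2r mR) mulVf ?gt_eqF // -{2}(gtr0_norm mR) -normrM.
  by rewrite mulrBl divfK ?gt_eqF.
have [km|mk] := leqP k m.
  exists (inord k); rewrite inordK ?ltnS //; apply: key.
  by move: h2; rewrite ler_norml -natr1; lra.
exists ord_max => /=; apply: key.
have : m.+1%:R <= k%:R :> R by rewrite ler_nat.
have : y * m.+1%:R <= m.+1%:R by rewrite ler_piMl.
by rewrite ler_norml -natr1; lra.
Qed.

(** Blocks of n %/ m consecutive indices; the last one also takes the at most
    m - 1 indices that remain.  The condition m * m <= n keeps the drift of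
    the block a from a / m below 1 / m. *)
Lemma grid_blocks (m n : nat) : (0 < m)%N -> (m * m <= n)%N ->
  exists cl : 'I_n -> 'I_m,
    (forall a : 'I_m, (n %/ m <= #|[set i | cl i == a]|)%N) /\
    (forall i, `|@grid R n i - (cl i)%:R / m%:R| <= m%:R^-1).
Proof.
move=> m0 mn; pose q := (n %/ m)%N.
have nE := divn_eq n m; have rm := ltn_pmod n m0; rewrite -/q in nE.
have q0 : (0 < q)%N by rewrite divn_gt0 //; nia.
have clP (i : 'I_n) : (minn (i %/ q) m.-1 < m)%N by rewrite gtn_min; lia.
exists (fun i => Ordinal (clP i)); split=> [a|i].
  have aq (t : 'I_q) : (a * q + t < n)%N by have := ltn_ord a; have := ltn_ord t; nia.
  pose g (t : 'I_q) : 'I_n := Ordinal (aq t).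
  have ginj : injective g by move=> t u /(congr1 val) /= /addnI /val_inj.
  rewrite -/q -[leqLHS](card_ord q) -(card_imset _ ginj).
  apply: subset_leq_card; apply/fintype.subsetP => _ /imsetP[t _ ->].
  rewrite inE -val_eqE /= divnMDl // divn_small // addn0.
  by apply/eqP/minn_idPl; have := ltn_ord a; lia.
set a := Ordinal _.
have mR : 0 < m%:R :> R by rewrite ltr0n.
have n0 : (0 < n)%N by nia.
have nR : 0 < n%:R :> R by rewrite ltr0n.
have aE : (a : nat) = minn (i %/ q) m.-1 by [].
have iE := divn_eq i q; have iq := ltn_pmod i q0; have ilt := ltn_ord i.
have [h1 h2] : (a * n <= i.+1 * m + n)%N /\ (i.+1 * m <= a.+1 * n)%N.
  have [h|h] := leqP (i %/ q) m.-1.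
    have ->: (a : nat) = (i %/ q)%N by rewrite aE; lia.
    set k := (i %/ q)%N in iE h *; set r1 := (i %% q)%N in iE iq.
    set r2 := (n %% m)%N in nE rm.
    split; last by nia.
    have : (k * m <= m * m)%N by nia.
    have : (k * r2 <= k * m)%N by nia.
    nia.
  have -> : (a : nat) = m.-1 by rewrite aE; lia.
  set k := (i %/ q)%N in iE h *; set r1 := (i %% q)%N in iE iq.
  set r2 := (n %% m)%N in nE rm.
  split; last by rewrite prednK //; nia.
  have : (m.-1 * q <= i)%N by nia.
  have : (m.-1 * r2 <= m * m)%N by nia.
  nia.
have {}h1 : a%:R * n%:R <= i.+1%:R * m%:R + n%:R :> R by rewrite -!natrM -natrD ler_nat.
have {}h2 : i.+1%:R * m%:R <= (a%:R + 1) * n%:R :> R.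
  by rewrite natr1 -!natrM ler_nat.
have mn0 : 0 < n%:R * m%:R :> R by rewrite mulr_gt0.
rewrite /grid -(ler_pM2r mn0) -{1}(gtr0_norm mn0) -normrM.
have -> : (i.+1%:R / n%:R - a%:R / m%:R) * (n%:R * m%:R) = i.+1%:R * m%:R - a%:R * n%:R :> R.
  by field; rewrite !gt_eqF.
have -> : m%:R^-1 * (n%:R * m%:R) = n%:R :> R by field; rewrite gt_eqF.
by rewrite ler_norml; apply/andP; split; lra.
Qed.

(** Every x has a y with W x y >= km; by uniform continuity W stays above
    km / 2 on the blocks around x and y, so that two consecutive blocks have a
    common neighbour and [chained_blocks_cut] applies. *)
Lemma grid_expands W (km : R) : unif_cont01 W -> 0 < km ->
  (forall x y : R, x \in `[0, 1] -> y \in `[0, 1] -> 0 <= W x y) ->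
  (forall x y : R, x \in `[0, 1] -> y \in `[0, 1] -> W x y = W y x) ->
  (forall x : R, x \in `[0, 1] -> exists2 y : R, y \in `[0, 1] & km <= W x y) ->
  exists2 c : R, 0 < c & exists n0, forall n, (n0 <= n)%N ->
    expands (fun i j : 'I_n => W (grid i) (grid j)) (c * n%:R) (n %/ 2).
Proof.
move=> Wuc km0 W0 Wsym Wnb.
have [delta delta0 Hd] := Wuc (km / 2) (divr_gt0 km0 (ltr0n _ 2)).
(* Points of neighbouring blocks are within 2 / m of the point a / m. *)
pose m := (Num.truncn (2 / delta)).+1.
have m0 : (0 < m)%N by [].
have mR : 0 < m%:R :> R by rewrite ltr0n.
have md : 2 / m%:R <= delta.
  rewrite ler_pdivrMr // mulrC -ler_pdivrMr //.
  apply: ltW; case/andP: (Num.Theory.truncn_itv (ltW (divr_gt0 (ltr0n R 2) delta0))) => _.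
  by [].
have m1d : m%:R^-1 <= delta by apply: le_trans md; rewrite ler_peMl ?invr_ge0 // ler1n.
exists (km / 2 / (16 * m%:R ^+ 3)); first by rewrite !divr_gt0 // mulr_gt0 // exprn_gt0.
exists (m * m)%N => n mn S Sn.
have [cl [clq clP]] := grid_blocks m0 mn.
have n0 : (0 < n)%N by apply: leq_trans mn.
have nR : 0 < n%:R :> R by rewrite ltr0n.
pose q := (n %/ m)%N.
have q0 : (0 < q)%N by rewrite divn_gt0 //; apply: leq_trans mn; rewrite leq_pmulr.
have link (a : 'I_m) : exists b : 'I_m, forall i j : 'I_n,
     (a <= cl i <= a.+1)%N -> cl j = b ->
     km / 2 <= W (grid i) (grid j) /\ km / 2 <= W (grid j) (grid i).
  have a01 : a%:R / m%:R \in `[0, (1:R)].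
    by rewrite in_itv /= divr_ge0 //= ler_pdivrMr // mul1r ler_nat ltnW.
  have [y y01 ky] := Wnb _ a01.
  have [b bP] := floor_cell m0 y01.
  exists b => i j ai jb.
  have b1 : `|a%:R / m%:R - grid i| <= delta.
    apply: le_trans md; have -> : 2 / m%:R = m%:R^-1 + m%:R^-1 :> R by ring.
    have -> : a%:R / m%:R - grid i = (a%:R - (cl i)%:R) / m%:R - (grid i - (cl i)%:R / m%:R) :> R by ring.
    apply: le_trans (ler_normB _ _) _; apply: lerD (clP i).
    rewrite normrM [ `|_^-1|]ger0_norm ?invr_ge0 ?(ltW mR) // ler_piMl ?invr_ge0 ?(ltW mR) //.
    have [->|->] : (cl i : nat) = a \/ (cl i : nat) = a.+1 by clear -ai; lia.
      by rewrite subrr normr0.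
    by rewrite -[a.+1%:R]natr1 ler_norml; lra.
  have b2 : `|y - grid j| <= delta.
    apply: le_trans md; have -> : 2 / m%:R = m%:R^-1 + m%:R^-1 :> R by ring.
    have -> : y - grid j = y - b%:R / m%:R - (grid j - (cl j)%:R / m%:R) :> R by rewrite jb; ring.
    by apply: le_trans (ler_normB _ _) _; apply: lerD.
  have h : km / 2 <= W (grid i) (grid j).
    have := Hd _ _ _ _ a01 (grid01 i) y01 (grid01 j) b1 b2.
    by rewrite ler_norml; lra.
  by split => //; rewrite Wsym ?grid01.
have M0 (i j : 'I_n) : 0 <= W (grid i) (grid j) by rewrite W0 ?grid01.
have := @chained_blocks_cut _ _ (fun i j : 'I_n => W (grid i) (grid j)) m q cl _ q0
  (divr_gt0 km0 (ltr0n _ 2)) M0 clq link S.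
set E := cut _ _; rewrite card_ord => key.
have Sc : n%:R / 2 <= #|~: S|%:R :> R.
  have := cardsC S; rewrite card_ord => hS.
  have : (n <= 2 * #|~: S|)%N by clear -hS Sn; lia.
  by rewrite -(ler_nat R) natrM; lra.
have qn : n%:R / (2 * m%:R) <= q%:R :> R.
  have : (n <= 2 * m * q)%N by have := divn_eq n m; have := ltn_pmod n m0; clear -n0 m0 mn; nia.
  by rewrite -(ler_nat R) !natrM ler_pdivrMr ?mulr_gt0 // => /le_trans; apply; lra.
have : km / 2 * (n%:R / (2 * m%:R)) ^+ 2 * (#|S|%:R * (n%:R / 2)) <= 2 * m%:R * n%:R ^+ 2 * E.
  apply: le_trans key; apply: ler_pM.
  - by rewrite mulr_ge0 ?sqr_ge0 // divr_ge0 // ltW.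
  - by rewrite mulr_ge0 // divr_ge0.
  - rewrite ler_pM2l ?divr_gt0 // ler_sqr ?nnegrE ?divr_ge0 ?mulr_ge0 //.
  - by rewrite ler_wpM2l.
have P : 0 < 2 * m%:R * n%:R ^+ 2 :> R by rewrite mulr_gt0 ?mulr_gt0 ?exprn_gt0.
rewrite -ler_pdivrMl // => h; apply: le_trans h; rewrite le_eqVlt; apply/orP; left; apply/eqP.
by field; rewrite !gt_eqF.
Qed.

End grid_expansion.

Local Open Scope classical_set_scope.
Local Open Scope ring_scope.

(** * Chernoff bounds from joint probabilities *)

Section exponential_bounds.
Context {R : realType}.

Lemma expR_le_quadratic (x : R) : 0 <= x <= 1/2 -> expR x <= 1 + x + 2 * x ^+ 2.
Proof.
move=> /andP[x0 x1]; have h := expR_ge1Dx (- x).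
have e0 := expR_gt0 x.
have : expR x * (1 - x) <= 1.
  by rewrite -[leRHS](expRxMexpNx_1 x) ler_wpM2l // ltW.
have x1' : 0 < 1 - x by lra.
rewrite -ler_pdivlMr // => /le_trans; apply.
rewrite ler_pdivrMr //.
by have : 0 <= x ^+ 2 * (1 - 2 * x); [rewrite mulr_ge0 ?sqr_ge0|]; lra.
Qed.

Lemma expRN_le_quadratic (x : R) : 0 <= x -> expR (- x) <= 1 - x + x ^+ 2.
Proof.
move=> x0; have h := expR_ge1Dx x.
have e0 := expR_gt0 (- x).
have : expR (- x) * (1 + x) <= 1.
  by rewrite -[leRHS](expRxMexpNx_1 x) mulrC ler_wpM2r // ltW.
have x1' : 0 < 1 + x by lra.
rewrite -ler_pdivlMr // => /le_trans; apply.
rewrite ler_pdivrMr //.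
by have : 0 <= x ^+ 3; [exact: exprn_ge0|]; lra.
Qed.

End exponential_bounds.

Lemma measurable_natr_bool {R : realType} {d : measure_display} {T : measurableType d}
    (b : T -> bool) : measurable [set w | b w] ->
  measurable_fun setT (fun w => (b w)%:R : R).
Proof.
move=> mb; rewrite (_ : (fun w => _) = \1_[set w | b w]); first exact: measurable_indic.
apply/funext => w; rewrite indicE; congr (nat_of_bool _)%:R.
by apply/idP/idP => [?|/set_mem//]; rewrite mem_set.
Qed.

Section chernoff.
Context {R : realType} {d : measure_display} {Omega : measurableType d}.
Variable P : probability Omega R.
Context {I : finType}.
Implicit Types (G E : set Omega) (D : {pred I}) (Y : I -> Omega -> bool)
  (q c b : I -> R).

(** Independence enters the Chernoff bounds only through upper bounds for
    joint occurrences, and these survive the restriction to an event G. *)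
Definition jointly_at_most G D Y q : Prop := forall J : {set I}, J \subset D ->
  (P (G `&` [set w | [forall i in J, Y i w]]) <= (\prod_(i in J) q i)%:E)%E.

Lemma measurable_allY Y (J : {set I}) : (forall i, measurable [set w | Y i w]) ->
  measurable [set w | [forall i in J, Y i w]].
Proof.
move=> mY.
have -> : [set w | [forall i in J, Y i w]] = \bigcap_(i in [set` J]) [set w | Y i w].
  by apply/seteqP; split=> w /= => [/forall_inP//|h]; apply/forall_inP => i /h.
by apply: fin_bigcap_measurable => //; exact: finite_finset.
Qed.

(** Markov's inequality for the product, whose expectation on G is bounded by
    expanding it over subsets J: each term is a coefficient times the joint
    probability of the Y_i with i in J. *)
Lemma markov_prod G D Y q c E (T : R) :
  measurable G -> (forall i, measurable [set w | Y i w]) -> measurable E ->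
  jointly_at_most G D Y q ->
  (forall i, 0 <= c i) -> (forall i, i \notin D -> c i = 0) -> 0 <= T ->
  E `<=` G -> (forall w, E w -> T <= \prod_i (1 + c i * (Y i w)%:R)) ->
  (T%:E * P E <= (\prod_i (1 + c i * q i))%:E)%E.
Proof.
move=> mG mY mE YD c0 cD T0 EG ET.
pose F (J : {set I}) := G `&` [set w | [forall i in J, Y i w]].
have mF J : measurable (F J) by apply: measurableI => //; exact: measurable_allY.
pose C (J : {set I}) := \prod_(i in J) c i.
have C0 J : 0 <= C J by apply: prodr_ge0.
have prodE (x : I -> R) : \prod_i (1 + c i * x i) = \sum_(J : {set I}) C J * \prod_(i in J) x i.
  under eq_bigr do rewrite addrC.
  rewrite (@bigA_distr R 0 1 *%R +%R) big_mkcond /=; apply: eq_bigr => J _.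
  rewrite -big_split /= [RHS]big_mkcond /=.
  by apply: eq_bigr => i _; case: (i \in J).
have prodY w J : \prod_(i in J) (Y i w)%:R = [forall i in J, Y i w]%:R :> R.
  case: forall_inP => [h|/existsNP[i /not_implyP[iJ /negP/negbTE Yi]]].
    by rewrite big1 // => i /h ->.
  by rewrite (bigD1 i) //= Yi mul0r.
have -> : (T%:E * P E = \int[P]_w (T%:E * (\1_E w)%:E))%E.
  by rewrite ge0_integralZl_EFin // ?integral_indic ?setIT //;
    exact/measurable_EFinP/measurable_indic.
apply: (@le_trans _ _ (\int[P]_w (\sum_(J : {set I}) (C J)%:E * (\1_(F J) w)%:E))%E).
  apply: ge0_le_integral => //.
  - by move=> w _; rewrite -EFinM lee_fin mulr_ge0.
  - by apply/measurable_EFinP; apply: measurable_funM => //; exact: measurable_indic.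
  - apply: emeasurable_sum => J; apply/measurable_EFinP; apply: measurable_funM => //.
  move=> w _; under [leRHS]eq_bigr do rewrite -EFinM.
  rewrite sumEFin -EFinM lee_fin indicE.
  have [/set_mem wE|wE] := boolP (w \in E); last first.
    by rewrite mulr0; apply: sumr_ge0 => J _; rewrite mulr_ge0.
  rewrite mulr1; apply: le_trans (ET w wE) _.
  rewrite prodE; apply: ler_sum => J _; rewrite prodY ler_wpM2l // indicE ler_nat.
  case: forall_inP => // h; rewrite mem_set //; split; first exact: EG.
  exact/forall_inP.
rewrite ge0_integral_sum //; last 2 first.
- move=> J; apply/measurable_EFinP; apply: measurable_funM => //.
- by move=> J w _; rewrite -EFinM lee_fin mulr_ge0.
rewrite prodE -sumEFin; apply: lee_sum => J _.
rewrite ge0_integralZl_EFin //; last exact/measurable_EFinP/measurable_indic.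
rewrite integral_indic // setIT EFinM.
have [JD|/subsetPn[i iJ iD]] := boolP (J \subset D).
  by rewrite lee_wpmul2l ?lee_fin //; exact: YD.
have -> : C J = 0 by rewrite /C (bigD1 i) //= cD // mul0r.
by rewrite !mul0e.
Qed.

Lemma measurable_weighted_sum Y b : (forall i, measurable [set w | Y i w]) ->
  measurable_fun setT (fun w => \sum_i b i * (Y i w)%:R).
Proof.
move=> mY; apply: measurable_sum => i; apply: measurable_funM => //.
exact: measurable_natr_bool.
Qed.

Lemma measurable_weighted_sum_le Y b G s (sg : bool) : measurable G ->
  (forall i, measurable [set w | Y i w]) ->
  measurable (G `&` [set w | if sg then s <= \sum_i b i * (Y i w)%:R
                             else \sum_i b i * (Y i w)%:R <= s]).
Proof.
move=> mG mY; have mf := measurable_weighted_sum b mY.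
by case: sg; apply: measurable_fun_le => //; exact: measurable_funS mf.
Qed.

(** [markov_prod] with 1 + c_i Y_i = exp (t b_i Y_i). *)
Lemma chernoff_upper G D Y q b (t s : R) :
  measurable G -> (forall i, measurable [set w | Y i w]) ->
  jointly_at_most G D Y q -> (forall i, 0 <= q i) ->
  (forall i, 0 <= b i) -> (forall i, i \notin D -> b i = 0) ->
  0 <= t -> (forall i, t * b i <= 1/2) ->
  (P (G `&` [set w | (s <= \sum_i b i * (Y i w)%:R)%R]) <=
   (expR (- (t * s) + \sum_i (t * b i + 2 * (t * b i) ^+ 2) * q i))%:E)%E.
Proof.
move=> mG mY YD q0 b0 bD t0 tb.
have tb0 i : 0 <= t * b i by rewrite mulr_ge0.
set E := _ `&` _.
have mE : measurable E by exact: (measurable_weighted_sum_le b s true mG mY).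
have c0 i : 0 <= expR (t * b i) - 1.
  by have := expR_ge1Dx (t * b i); have := tb0 i; lra.
have := @markov_prod G D Y q (fun i => expR (t * b i) - 1) E (expR (t * s)) mG mY mE YD c0.
move=> H; have {}H : ((expR (t * s))%:E * P E <=
    (\prod_i (1 + (expR (t * b i) - 1) * q i))%:E)%E.
  apply: H.
  - by move=> i iD; rewrite bD // mulr0 expR0 subrr.
  - exact: expR_ge0.
  - by move=> w [].
  - move=> w [_ /= sw].
    have -> : \prod_i (1 + (expR (t * b i) - 1) * (Y i w)%:R) =
              expR (t * \sum_i b i * (Y i w)%:R).
      rewrite mulr_sumr expR_sum; apply: eq_bigr => i _.
      by case: (Y i w); rewrite ?mulr1 ?mulr0 ?expR0 ?addr0 //; ring.
    by rewrite ler_expR ler_wpM2l.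
rewrite expRD expRN EFinM lee_pdivlMl ?expR_gt0 //.
apply: le_trans H _; rewrite lee_fin expR_sum; apply: ler_prod => i _.
apply/andP; split; first by rewrite addr_ge0 // mulr_ge0.
apply: le_trans (expR_ge1Dx _); rewrite lerD2l ler_wpM2r //.
by have := @expR_le_quadratic R (t * b i); rewrite tb0 tb => /(_ isT); lra.
Qed.

(** The upper bound for the complementary events: a small weighted sum of the
    Y_i is a large weighted sum of the 1 - Y_i. *)
Lemma chernoff_lower G D Y q b (t s : R) :
  measurable G -> (forall i, measurable [set w | Y i w]) ->
  jointly_at_most G D (fun i w => ~~ Y i w) (fun i => 1 - q i) ->
  (forall i, 0 <= q i <= 1) ->
  (forall i, 0 <= b i) -> (forall i, i \notin D -> b i = 0) -> 0 <= t ->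
  (P (G `&` [set w | (\sum_i b i * (Y i w)%:R <= s)%R]) <=
   (expR (t * s - \sum_i (t * b i - (t * b i) ^+ 2) * q i))%:E)%E.
Proof.
move=> mG mY YD q01 b0 bD t0.
have tb0 i : 0 <= t * b i by rewrite mulr_ge0.
set E := _ `&` _.
have mE : measurable E by exact: (measurable_weighted_sum_le b s false mG mY).
have mY' i : measurable [set w | ~~ Y i w].
  rewrite (_ : [set w | _] = ~` [set w | Y i w]); first exact: measurableC.
  by apply/seteqP; split=> w /= /negP.
have c0 i : 0 <= expR (t * b i) - 1.
  by have := expR_ge1Dx (t * b i); have := tb0 i; lra.
pose B := \sum_i t * b i.
have := @markov_prod G D (fun i w => ~~ Y i w) (fun i => 1 - q i)
  (fun i => expR (t * b i) - 1) E (expR (B - t * s)) mG mY' mE YD c0.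
move=> H; have {}H : ((expR (B - t * s))%:E * P E <=
    (\prod_i (1 + (expR (t * b i) - 1) * (1 - q i)))%:E)%E.
  apply: H.
  - by move=> i iD; rewrite bD // mulr0 expR0 subrr.
  - exact: expR_ge0.
  - by move=> w [].
  - move=> w [_ /= sw].
    have -> : \prod_i (1 + (expR (t * b i) - 1) * (~~ Y i w)%:R) =
              expR (B - t * \sum_i b i * (Y i w)%:R).
      rewrite mulr_sumr -sumrB expR_sum; apply: eq_bigr => i _.
      by case: (Y i w); rewrite /= ?mulr1 ?mulr0 ?subrr ?expR0 ?addr0 ?subr0 //; ring.
    by rewrite ler_expR lerD2l lerN2 ler_wpM2l.
have {}H : (P E <= (expR (t * s - B))%:E * (\prod_i (1 + (expR (t * b i) - 1) * (1 - q i)))%:E)%E.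
  by rewrite -opprB expRN lee_pdivlMl ?expR_gt0.
apply: le_trans H _; rewrite -EFinM lee_fin.
set S := \sum_i (_ - _) * q _.
have -> : t * s - S = (t * s - B) + (B - S) by ring.
rewrite [leRHS]expRD ler_wpM2l ?expR_ge0 // /B /S -sumrB expR_sum.
apply: ler_prod => i _; set x := t * b i; case/andP: (q01 i) => q0 q1.
apply/andP; split; first by apply: addr_ge0 => //; apply: mulr_ge0; [exact: c0|rewrite subr_ge0].
have -> : 1 + (expR x - 1) * (1 - q i) = expR x * (1 - (1 - expR (- x)) * q i).
  have -> : expR x * (1 - (1 - expR (- x)) * q i) =
    expR x - expR x * q i + (expR x * expR (- x)) * q i by ring.
  by rewrite expRxMexpNx_1; ring.
rewrite expRD ler_wpM2l ?expR_ge0 //; apply: le_trans (expR_ge1Dx _).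
have := expRN_le_quadratic (tb0 i); rewrite -/x => h.
have : (x - x ^+ 2) * q i <= (1 - expR (- x)) * q i by rewrite ler_wpM2r //; lra.
lra.
Qed.

End chernoff.

(** * Concentration of row sums and cuts *)

Section sums_over_edges.
Context {R : realType} {n : nat}.
Implicit Types (b g : 'I_n -> 'I_n -> R).

Definition edge : pred ('I_n * 'I_n) := fun p => (p.1 < p.2)%N.

(** Edges are indexed by pairs i < j; folding turns a sum over ordered pairs
    against a symmetric matrix into a sum over edges. *)
Definition fold_edges b (p : 'I_n * 'I_n) : R :=
  if edge p then b p.1 p.2 + b p.2 p.1 else 0.

Lemma sum_fold_edges b g : (forall i j, g i j = g j i) ->
  \sum_i \sum_j b i j * g i j =
  \sum_p fold_edges b p * g p.1 p.2 + \sum_i b i i * g i i.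
Proof.
move=> gsym.
have -> : \sum_p fold_edges b p * g p.1 p.2 =
    \sum_(i < n) \sum_(j < n) (if (i < j)%N then (b i j + b j i) * g i j else 0).
  rewrite pair_bigA /=; apply: eq_bigr => -[i j] _.
  by rewrite /fold_edges /edge /=; case: ifP; rewrite ?mul0r.
have -> : \sum_(i < n) \sum_(j < n) (if (i < j)%N then (b i j + b j i) * g i j else 0) =
   \sum_(i < n) \sum_(j < n) (if (i < j)%N then b i j * g i j else 0) +
   \sum_(i < n) \sum_(j < n) (if (j < i)%N then b i j * g i j else 0).
  rewrite [X in _ = _ + X]exchange_big /= -big_split; apply: eq_bigr => i _.
  rewrite -big_split; apply: eq_bigr => j _ /=; rewrite (gsym j i).
  by case: ifP; rewrite ?addr0 ?mulrDl.
have -> : \sum_i b i i * g i i = \sum_(i < n) \sum_(j < n) (if i == j then b i j * g i j else 0).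
  by apply: eq_bigr => i _; rewrite -big_mkcond (big_pred1 i).
rewrite -!big_split /=; apply: eq_bigr => i _; rewrite -!big_split /=.
apply: eq_bigr => j _; rewrite -val_eqE /=.
by case: (ltngtP i j); rewrite ?addr0 ?add0r.
Qed.

Lemma fold_edges_ge0 b : (forall i j, 0 <= b i j) -> forall p, 0 <= fold_edges b p.
Proof. by move=> b0 p; rewrite /fold_edges; case: ifP => // _; rewrite addr_ge0. Qed.

Lemma fold_edges_out b p : p \notin edge -> fold_edges b p = 0.
Proof. by rewrite -[p \notin edge]/(~~ edge p) /fold_edges => /negbTE ->. Qed.

End sums_over_edges.

Section random_graph.
Context {R : realType} {d : measure_display} {Omega : measurableType d}.
Variable P : probability Omega R.
Context {n : nat}.
Implicit Types (A : 'I_n -> 'I_n -> Omega -> bool) (M : 'I_n -> 'I_n -> R).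

Definition adj A w : 'I_n -> 'I_n -> R := fun i j => (A i j w)%:R.

(** On the event G, edges are present, or absent, at most as often as if they
    were independent with probabilities eps (M + eta), or eps (M - eta)
    truncated at 0.  This covers both models with weights that are not
    random: M is the kernel on the grid, and eta absorbs the fluctuation of
    the sample points. *)
Record sandwiched G A M (eps eta : R) : Prop := {
  sw_meas : measurable G;
  sw_measA : forall i j, measurable [set w | A i j w];
  sw_sym : forall i j w, A i j w = A j i w;
  sw_diag : forall i w, A i i w = false;
  sw_eps : 0 < eps <= 1;
  sw_eta : 0 <= eta <= 1;
  sw_M01 : forall i j, 0 <= M i j <= 1;
  sw_Msym : forall i j, M i j = M j i;
  sw_upper : jointly_at_most P G edge (fun p => A p.1 p.2)
                (fun p => eps * (M p.1 p.2 + eta));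
  sw_lower : jointly_at_most P G edge (fun p w => ~~ A p.1 p.2 w)
                (fun p => 1 - eps * Num.max (M p.1 p.2 - eta) 0) }.

Variables (G : set Omega) (A : 'I_n -> 'I_n -> Omega -> bool) (M : 'I_n -> 'I_n -> R).
Variables (eps eta : R).
Hypothesis AM : sandwiched G A M eps eta.

Let eps0 : 0 < eps. Proof. by case/andP: (sw_eps AM). Qed.
Let eps1 : eps <= 1. Proof. by case/andP: (sw_eps AM). Qed.
Let eta0 : 0 <= eta. Proof. by case/andP: (sw_eta AM). Qed.
Let eta1 : eta <= 1. Proof. by case/andP: (sw_eta AM). Qed.
Let M0 i j : 0 <= M i j. Proof. by case/andP: (sw_M01 AM i j). Qed.
Let M1 i j : M i j <= 1. Proof. by case/andP: (sw_M01 AM i j). Qed.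

Let lowq01 (p : 'I_n * 'I_n) : 0 <= eps * Num.max (M p.1 p.2 - eta) 0 <= 1.
Proof.
have h : 0 <= Num.max (M p.1 p.2 - eta) 0 <= 1.
  by rewrite le_max lexx orbT ge_max ler01 andbT /=; have := M1 p.1 p.2; have := eta0; have := eta1; lra.
by case/andP: h => h1 h2; rewrite mulr_ge0 ?(ltW eps0) //= mulr_ile1 ?(ltW eps0).
Qed.

Lemma sum_adj (b : 'I_n -> 'I_n -> R) w :
  \sum_i \sum_j b i j * adj A w i j = \sum_p fold_edges b p * (A p.1 p.2 w)%:R.
Proof.
rewrite sum_fold_edges; last by move=> i j; rewrite /adj (sw_sym AM).
by rewrite [X in _ + X]big1 ?addr0 // => i _; rewrite /adj (sw_diag AM) mulr0.
Qed.

Section weighted.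
Variables (b : 'I_n -> 'I_n -> R) (B L : R).
Hypothesis b0 : forall i j, 0 <= b i j.
Hypothesis B0 : 0 <= B.
Hypothesis bB : forall p, fold_edges b p <= B.
Hypothesis bL : \sum_i \sum_j b i j <= L.

Let f0 := fold_edges_ge0 b0.

Let sumf : \sum_p fold_edges b p <= L.
Proof.
apply: le_trans bL.
have -> : \sum_i \sum_j b i j = \sum_i \sum_j b i j * 1.
  by apply: eq_bigr => i _; apply: eq_bigr => j _; rewrite mulr1.
rewrite (sum_fold_edges b (g := fun _ _ => 1)) //.
rewrite (eq_bigr (fun p => fold_edges b p * 1)); last by move=> p _; rewrite mulr1.
by rewrite lerDl sumr_ge0 // => i _; rewrite mulr_ge0.
Qed.

Let sumf2 : \sum_p fold_edges b p ^+ 2 <= B * L.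
Proof.
apply: le_trans (ler_wpM2l B0 sumf); rewrite mulr_sumr; apply: ler_sum => p _.
by rewrite expr2 ler_wpM2r.
Qed.

Let bM := \sum_i \sum_j b i j * M i j.

Lemma weighted_upper (t y : R) : 0 <= t -> t * B <= 1/2 ->
  (P (G `&` [set w | (eps * bM + y <= \sum_i \sum_j b i j * adj A w i j)%R]) <=
   (expR (- (t * y) + eps * L * (t * eta + 4 * t ^+ 2 * B)))%:E)%E.
Proof.
move=> t0 tB.
have -> : [set w | eps * bM + y <= \sum_i \sum_j b i j * adj A w i j] =
   [set w | eps * bM + y <= \sum_p fold_edges b p * (A p.1 p.2 w)%:R].
  by apply/seteqP; split=> w /=; rewrite sum_adj.
have q0 (p : 'I_n * 'I_n) : 0 <= eps * (M p.1 p.2 + eta).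
  by rewrite mulr_ge0 ?addr_ge0 ?(ltW eps0).
have tb p : t * fold_edges b p <= 1 / 2.
  by apply: le_trans tB; rewrite ler_wpM2l.
apply: le_trans (chernoff_upper (eps * bM + y) (sw_meas AM) (fun p => sw_measA AM p.1 p.2)
  (sw_upper AM) q0 f0 (@fold_edges_out _ _ b) t0 tb) _.
rewrite lee_fin ler_expR.
have -> : \sum_p (t * fold_edges b p + 2 * (t * fold_edges b p) ^+ 2) *
      (eps * (M p.1 p.2 + eta)) =
   t * eps * (\sum_p fold_edges b p * M p.1 p.2) + t * eps * eta * (\sum_p fold_edges b p) +
   2 * t ^+ 2 * eps * \sum_p fold_edges b p ^+ 2 * (M p.1 p.2 + eta).
  by rewrite !mulr_sumr -!big_split; apply: eq_bigr => p _ /=; ring.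
have h1 : \sum_p fold_edges b p * M p.1 p.2 <= bM.
  rewrite /bM sum_fold_edges; last exact: sw_Msym AM.
  by rewrite lerDl sumr_ge0 // => i _; rewrite mulr_ge0.
have h2 : \sum_p fold_edges b p ^+ 2 * (M p.1 p.2 + eta) <= 2 * (B * L).
  apply: le_trans (ler_wpM2l (ler0n _ 2) sumf2).
  rewrite mulr_sumr; apply: ler_sum => p _; rewrite mulrC ler_wpM2r ?sqr_ge0 //.
  by have := M1 p.1 p.2; have := eta0; have := eta1; lra.
have te : 0 <= t * eps by rewrite mulr_ge0 ?(ltW eps0).
have tee : 0 <= t * eps * eta by rewrite mulr_ge0.
have tte : 0 <= 2 * t ^+ 2 * eps by rewrite !mulr_ge0 ?sqr_ge0 ?(ltW eps0).
have := ler_wpM2l te h1; have := ler_wpM2l tee sumf; have := ler_wpM2l tte h2.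
lra.
Qed.

(** Diagonal terms of b contribute to the expected value but not to the sum
    over edges, hence the correction by diag. *)
Lemma weighted_lower (t y diag : R) : 0 <= t -> \sum_i b i i <= diag ->
  (P (G `&` [set w | (\sum_i \sum_j b i j * adj A w i j <= eps * bM - y)%R]) <=
   (expR (- (t * y) + eps * (t * diag + L * (t * eta + t ^+ 2 * B))))%:E)%E.
Proof.
move=> t0 bdiag.
have -> : [set w | \sum_i \sum_j b i j * adj A w i j <= eps * bM - y] =
   [set w | \sum_p fold_edges b p * (A p.1 p.2 w)%:R <= eps * bM - y].
  by apply/seteqP; split=> w /=; rewrite sum_adj.
apply: le_trans (chernoff_lower (eps * bM - y) (sw_meas AM) (fun p => sw_measA AM p.1 p.2)
  (sw_lower AM) lowq01 f0 (@fold_edges_out _ _ b) t0) _.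
rewrite lee_fin ler_expR.
set q := fun p : 'I_n * 'I_n => Num.max (M p.1 p.2 - eta) 0.
have -> : \sum_p (t * fold_edges b p - (t * fold_edges b p) ^+ 2) *
      (eps * Num.max (M p.1 p.2 - eta) 0) =
   t * eps * (\sum_p fold_edges b p * q p) - t ^+ 2 * eps * \sum_p fold_edges b p ^+ 2 * q p.
  by rewrite !mulr_sumr -sumrB; apply: eq_bigr => p _ /=; rewrite -/(q p); ring.
have h1 : bM - diag - eta * L <= \sum_p fold_edges b p * q p.
  have : \sum_p fold_edges b p * M p.1 p.2 - eta * \sum_p fold_edges b p <=
      \sum_p fold_edges b p * q p.
    rewrite mulr_sumr -sumrB; apply: ler_sum => p _.
    by rewrite mulrC -mulrBl mulrC ler_wpM2l // /q le_max lexx.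
  have : \sum_i b i i * M i i <= diag.
    by apply: le_trans bdiag; apply: ler_sum => i _; rewrite ler_piMr.
  have := ler_wpM2l eta0 sumf.
  rewrite /bM sum_fold_edges; last exact: sw_Msym AM.
  lra.
have h2 : \sum_p fold_edges b p ^+ 2 * q p <= B * L.
  apply: le_trans sumf2.
  apply: ler_sum => p _; rewrite ler_piMr ?sqr_ge0 //.
  by rewrite /q ge_max ler01 andbT; have := M1 p.1 p.2; have := eta0; have := eta1; lra.
have te : 0 <= t * eps by rewrite mulr_ge0 ?(ltW eps0).
have tte : 0 <= t ^+ 2 * eps by rewrite !mulr_ge0 ?sqr_ge0 ?(ltW eps0).
have := ler_wpM2l te h1; have := ler_wpM2l tte h2.
lra.
Qed.

End weighted.

Lemma measurable_adj_sum (b : 'I_n -> 'I_n -> R) :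
  measurable_fun setT (fun w => \sum_i \sum_j b i j * adj A w i j).
Proof.
apply: measurable_sum => i.
exact: (measurable_weighted_sum (fun j => b i j) (fun j => sw_measA AM i j)).
Qed.

(** The weights are those of the i-th row.  The constants come from
    t = x / (16 B^2); the size condition on n absorbs the diagonal term. *)
Lemma row_concentration (i : 'I_n) (v : 'I_n -> R) (B x : R) :
  0 < x <= B -> (forall j, 0 <= v j <= B) ->
  eta <= x / (4 * B) -> 4 * B / x <= n%:R ->
  (P (G `&` [set w | (n%:R * eps * x <=
       `|\sum_j adj A w i j * v j - eps * \sum_j M i j * v j|)%R]) <=
   (2 * expR (- (n%:R * eps * (x ^+ 2 / (64 * B ^+ 2)))))%:E)%E.
Proof.
move=> /andP[x0 xB] vB etax nB.
have Bgt0 : 0 < B by apply: lt_le_trans xB.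
pose b k l : R := (k == i)%:R * v l.
have bsum (g : 'I_n -> 'I_n -> R) : \sum_k \sum_l b k l * g k l = \sum_l g i l * v l.
  rewrite (bigD1 i) //= [X in _ + X]big1 ?addr0 => [|k /negbTE ki].
    by apply: eq_bigr => l _; rewrite /b eqxx mul1r mulrC.
  by rewrite big1 // => l _; rewrite /b ki !mul0r.
have v0 j : 0 <= v j by case/andP: (vB j).
have v1 j : v j <= B by case/andP: (vB j).
have b0 k l : 0 <= b k l by rewrite /b mulr_ge0.
have bB p : fold_edges b p <= B.
  rewrite /fold_edges /b; case: ifPn => [/ltn_eqF e|]; last by rewrite (ltW Bgt0).
  have [p1|p1] := eqVneq p.1 i; have [p2|p2] := eqVneq p.2 i; rewrite ?mul1r ?mul0r ?addr0 ?add0r //.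
    by move: e; rewrite p1 p2 eqxx.
  exact: ltW.
have bL : \sum_k \sum_l b k l <= n%:R * B.
  have -> : \sum_k \sum_l b k l = \sum_k \sum_l b k l * 1.
    by apply: eq_bigr => k _; apply: eq_bigr => l _; rewrite mulr1.
  rewrite (bsum (fun _ _ => 1)); apply: (@le_trans _ _ (\sum_(l < n) B)).
    by apply: ler_sum => l _; rewrite mul1r.
  by rewrite sumr_const card_ord mulr_natl.
have bdiag : \sum_k b k k <= B.
  rewrite (bigD1 i) //= [X in _ + X]big1 ?addr0 => [|k /negbTE ki].
    by rewrite /b eqxx mul1r.
  by rewrite /b ki mul0r.
pose N := n%:R * eps.
have nge0 : 0 <= n%:R :> R by [].
have N0 : 0 <= N by rewrite /N mulr_ge0 ?(ltW eps0).
pose t := x / (16 * B ^+ 2).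
have t0 : 0 < t by rewrite divr_gt0 // mulr_gt0 // exprn_gt0.
have tB2 : t * B ^+ 2 = x / 16 by rewrite /t; field; rewrite gt_eqF.
have tx : x ^+ 2 / (64 * B ^+ 2) = t * x / 4 by rewrite /t; field; rewrite gt_eqF.
have tB : t * B <= 1/2.
  rewrite -(ler_pM2r Bgt0) -mulrA -expr2 tB2; lra.
have Beta : B * eta <= x / 4.
  move: etax; rewrite ler_pdivlMr ?mulr_gt0 //; lra.
have Bn : B * eps <= N * (x / 4).
  move: nB; rewrite ler_pdivrMr // => /(ler_wpM2l (ltW eps0)); rewrite /N; lra.
(* A large deviation is either upwards or downwards; both are weighted sums
   with the weights b. *)
set E := [set w | _].
set Up := [set w | (eps * (\sum_k \sum_l b k l * M k l) + N * x <= \sum_k \sum_l b k l * adj A w k l)%R].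
set Dn := [set w | (\sum_k \sum_l b k l * adj A w k l <= eps * (\sum_k \sum_l b k l * M k l) - N * x)%R].
have mUp : measurable (G `&` Up).
  by apply: measurable_fun_le; [exact: sw_meas AM| |]; rewrite // ; exact/measurable_funTS/measurable_adj_sum.
have mDn : measurable (G `&` Dn).
  by apply: measurable_fun_le; [exact: sw_meas AM| |]; rewrite // ; exact/measurable_funTS/measurable_adj_sum.
have GE : G `&` E = (G `&` Up) `|` (G `&` Dn).
  rewrite -setIUr; congr (_ `&` _); apply/seteqP; split=> w; rewrite /E /Up /Dn /= !bsum.
    by rewrite ler_normr => /orP[h|h]; [left|right]; rewrite -/N in h; lra.
  by rewrite ler_normr => -[h|h]; apply/orP; [left|right]; rewrite -/N; lra.
rewrite GE; apply: le_trans (measureU2 _ mUp mDn) _.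
rewrite mulr2n mulrDl mul1r EFinD; apply: leeD.
  apply: le_trans (weighted_upper b0 (ltW Bgt0) bB bL (N * x) (ltW t0) tB) _.
  rewrite lee_fin ler_expR tx.
  have -> : eps * (n%:R * B) * (t * eta + 4 * t ^+ 2 * B) =
     N * t * (B * eta) + 4 * N * t * (t * B ^+ 2) by rewrite /N; ring.
  rewrite tB2 -/N.
  have := ler_wpM2l (mulr_ge0 N0 (ltW t0)) Beta.
  have := mulr_ge0 (mulr_ge0 N0 (ltW t0)) (ltW x0).
  lra.
apply: le_trans (weighted_lower b0 (ltW Bgt0) bB bL (N * x) (ltW t0) bdiag) _.
rewrite lee_fin ler_expR tx.
have -> : eps * (t * B + n%:R * B * (t * eta + t ^+ 2 * B)) =
   t * (B * eps) + N * t * (B * eta) + N * t * (t * B ^+ 2) by rewrite /N; ring.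
rewrite tB2 -/N.
have := ler_wpM2l (mulr_ge0 N0 (ltW t0)) Beta.
have := ler_wpM2l (ltW t0) Bn.
have := mulr_ge0 (mulr_ge0 N0 (ltW t0)) (ltW x0).
lra.
Qed.

(** The weights are the indicator of the pairs separated by S, whose total is
    at most n |S|, and t = c / 8.  The exponent is proportional to |S|, which
    pays for the union over all sets of that size. *)
Lemma cut_concentration (S : {set 'I_n}) (c : R) :
  0 < c -> c * n%:R * #|S|%:R <= cut M S -> eta <= c / 8 ->
  (P (G `&` [set w | (cut (adj A w) S <= n%:R * eps * (c / 2) * #|S|%:R)%R]) <=
   (expR (- (n%:R * eps * (c ^+ 2 / 32))) ^+ #|S|)%:E)%E.
Proof.
move=> c0 cS etac.
pose b (k l : 'I_n) : R := ((k \in S) && (l \notin S))%:R.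
have b0 k l : 0 <= b k l by [].
have bcut (g : 'I_n -> 'I_n -> R) : \sum_k \sum_l b k l * g k l = cut g S.
  rewrite cutE; apply: eq_bigr => i _; apply: eq_bigr => j _; exact: mulrC.
have bB p : fold_edges b p <= 1.
  rewrite /fold_edges /b; case: ifP => // _.
  by case: (p.1 \in S); case: (p.2 \in S); rewrite /= ?addr0 ?add0r.
pose L : R := n%:R * #|S|%:R.
have bL : \sum_k \sum_l b k l <= L.
  have -> : \sum_k \sum_l b k l = \sum_k \sum_l b k l * 1.
    by apply: eq_bigr => k _; apply: eq_bigr => l _; rewrite mulr1.
  rewrite (bcut (fun _ _ => 1)) /cut /L mulrC mulr_natl.
  rewrite -[leRHS]sumr_const; apply: ler_sum => i _.
  by rewrite sumr_const ler_nat; have := max_card (mem (~: S)); rewrite card_ord.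
have bdiag : \sum_k b k k <= 0 by rewrite big1 // => k _; rewrite /b andbN.
have L0 : 0 <= L by rewrite mulr_ge0.
pose t := c / 8.
have t0 : 0 < t by rewrite divr_gt0.
have -> : [set w | cut (adj A w) S <= n%:R * eps * (c / 2) * #|S|%:R] =
  [set w | \sum_k \sum_l b k l * adj A w k l <= eps * (\sum_k \sum_l b k l * M k l) -
     (eps * (\sum_k \sum_l b k l * M k l) - n%:R * eps * (c / 2) * #|S|%:R)].
  by apply/seteqP; split=> w /=; rewrite !bcut; lra.
apply: le_trans (weighted_lower b0 ler01 bB bL _ (ltW t0) bdiag) _.
rewrite lee_fin -expRM_natl ler_expR bcut -/L mulr1.
have -> : t * 0 = 0 by rewrite mulr0.
have h1 : eps * (c * L) <= eps * cut M S by rewrite ler_wpM2l ?(ltW eps0) // /L mulrA.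
have h2 : eps * L * (t * eta) <= eps * L * (t * (c / 8)).
  by rewrite ler_wpM2l ?mulr_ge0 ?(ltW eps0) // ler_wpM2l // ltW.
have h3 := ler_wpM2l (ltW t0) h1.
have -> : n%:R * eps * (c / 2) * #|S|%:R = eps * L * (c / 2) by rewrite /L; ring.
have -> : #|S|%:R * - (n%:R * eps * (c ^+ 2 / 32)) = - (eps * L * (c ^+ 2 / 32)) by rewrite /L; ring.
move: h2 h3; rewrite /t; lra.
Qed.

End random_graph.

(** * The typical graph *)

Section union_bound.
Context {R : realType} {d : measure_display} {Omega : measurableType d}.
Variable P : probability Omega R.

Lemma union_bound (I : finType) (D : {pred I}) (F : I -> set Omega) (x : I -> R) :
  (forall i, i \in D -> measurable (F i)) ->
  (forall i, i \in D -> (P (F i) <= (x i)%:E)%E) ->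
  measurable (\bigcup_(i in [set` D]) F i) /\
  (P (\bigcup_(i in [set` D]) F i) <= (\sum_(i in D) x i)%:E)%E.
Proof.
move=> mF PF.
have -> : \bigcup_(i in [set` D]) F i = \big[setU/set0]_(i in D) F i.
  exact: bigcup_pred.
rewrite -sumEFin.
suff [] : measurable (\big[setU/set0]_(i in D) F i) /\
  (P (\big[setU/set0]_(i in D) F i) <= \sum_(i in D) (x i)%:E)%E by [].
elim/big_rec2: _ => [|i y s iD [ms Ps]]; first by rewrite measure0.
split; first by apply: measurableU => //; exact: mF.
apply: le_trans (measureU2 _ (mF _ iD) ms) _.
by rewrite leeD // PF.
Qed.

Lemma sum_subset_exp (I : finType) (x : R) :
  \sum_(S : {set I}) x ^+ #|S| = (1 + x) ^+ #|I|.
Proof.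
transitivity (\prod_(i : I) (x + 1)); last by rewrite prodr_const addrC.
rewrite (@bigA_distr R 0 1 *%R +%R) big_mkcond /=; apply: eq_bigr => S _.
by rewrite -big_mkcond prodr_const.
Qed.

End union_bound.

Section typical_graph.
Context {R : realType} {d : measure_display} {Omega : measurableType d}.
Variable P : probability Omega R.

(** The first term is the union bound over the rows, for two weight vectors
    and two tails; the second bounds the sum over nonempty sets S of
    exp (- N k |S|), which is (1 + exp (- N k))^n - 1. *)
Definition failure_bound (n : nat) (N k : R) : R :=
  n%:R * (4 * expR (- (N * k))) + (expR (n%:R * expR (- (N * k))) - 1).

(** The constants k, eta1 and n0 are fixed before the graph, so that the
    conclusion is uniform in n. *)
Lemma typical_graph (c0 C0 c del : R) : 0 < c0 <= 1 -> 1 <= C0 -> 0 < c -> 0 < del <= 1 ->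
  exists2 k, 0 < k &
  exists2 eta1, 0 < eta1 &
  exists n0, forall n G (A : 'I_n -> 'I_n -> Omega -> bool) (M : 'I_n -> 'I_n -> R)
   (v K : 'I_n -> R) (eps eta rho : R),
  (n0 <= n)%N -> sandwiched P G A M eps eta -> eta <= eta1 ->
  (forall i, c0 <= v i <= C0) ->
  (forall i, `|n%:R^-1 * (\sum_j M i j * v j) - rho * v i| <= del * c0 / 2) ->
  (forall i, `|n%:R^-1 * (\sum_j M i j) - K i| <= del / 2) ->
  expands M (c * n%:R) (n %/ 2) ->
  `|avg (fun i => v i ^+ 2) - 1| <= del ->
  exists Bad : set Omega, [/\ measurable Bad,
    (P Bad <= (failure_bound n (n%:R * eps) k)%:E)%E &
    forall w, G w -> ~ Bad w -> nearly_perron (adj A w) v K (n%:R * eps) rho (c / 2) del].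
Proof.
move=> /andP[c00 c01] C01 c_gt0 /andP[del0 del1].
have C00 : 0 < C0 by lra.
pose x := del * c0 / 2.
have x0 : 0 < x by rewrite /x divr_gt0 // mulr_gt0.
have x1 : x <= del / 2 by rewrite /x; nra.
have xC : x <= C0 by lra.
have xd : x + del / 2 <= del by lra.
pose k1 := x ^+ 2 / (64 * C0 ^+ 2).
have k10 : 0 < k1 by rewrite divr_gt0 ?exprn_gt0 // mulr_gt0 // exprn_gt0.
pose k2 := c ^+ 2 / 32.
have k20 : 0 < k2 by rewrite divr_gt0 ?exprn_gt0.
exists (Num.min k1 k2); first by rewrite lt_min k10.
exists (Num.min (x / (4 * C0)) (c / 8)).
  by rewrite lt_min !divr_gt0 // mulr_gt0.
exists (Num.truncn (4 * C0 / x)).+1 => n G A M v K eps eta rho nn AM etale vb Mv MK Mexp vnorm.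
have etax : eta <= x / (4 * C0) by apply: le_trans etale _; rewrite ge_min lexx.
have etac : eta <= c / 8 by apply: le_trans etale _; rewrite ge_min lexx orbT.
have n0 : (0 < n)%N by apply: leq_trans nn.
have nR : 0 < n%:R :> R by rewrite ltr0n.
have nB : 4 * C0 / x <= n%:R.
  have h : 0 <= 4 * C0 / x by rewrite divr_ge0 ?mulr_ge0 ?ltW.
  have /andP[_ /ltW h2] := Num.Theory.truncn_itv h; apply: le_trans h2 _.
  by rewrite ler_nat.
have /andP[eps0 eps1] := sw_eps AM.
pose N := n%:R * eps.
have N0 : 0 < N by rewrite mulr_gt0.
have xx : 0 < x <= C0 by rewrite x0.
have v0 i : 0 <= v i <= C0 by case/andP: (vb i) => h ->; rewrite (le_trans _ h) // ltW.
have one0 (i : 'I_n) : 0 <= (1 : R) <= C0 by rewrite ler01.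
pose F1 i := G `&` [set w | (N * x <= `|\sum_j adj A w i j * v j - eps * \sum_j M i j * v j|)%R].
pose F2 i := G `&` [set w | (N * x <= `|\sum_j adj A w i j * 1 - eps * \sum_j M i j * 1|)%R].
pose F3 (S : {set 'I_n}) := G `&` [set w | (cut (adj A w) S <= N * (c / 2) * #|S|%:R)%R].
pose D3 := [pred S : {set 'I_n} | (0 < #|S| <= n %/ 2)%N].
have PF1 i : (P (F1 i) <= (2 * expR (- (N * k1)))%:E)%E.
  exact: row_concentration AM i v C0 x xx v0 etax nB.
have PF2 i : (P (F2 i) <= (2 * expR (- (N * k1)))%:E)%E.
  exact: row_concentration AM i (fun=> 1) C0 x xx one0 etax nB.
have PF3 S : S \in D3 -> (P (F3 S) <= (expR (- (N * k2)) ^+ #|S|)%:E)%E.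
  by move=> /andP[_ Sn]; apply: (cut_concentration AM c_gt0 _ etac); exact: Mexp.
have mrow i u : measurable (G `&` [set w | (N * x <= `|\sum_j adj A w i j * u j - eps * \sum_j M i j * u j|)%R]).
  apply: measurable_fun_le; [exact: sw_meas AM|by []|].
  apply/measurable_funTS; apply: measurableT_comp => //; apply: measurable_funB => //.
  under eq_fun do under eq_bigr do rewrite mulrC.
  exact: measurable_weighted_sum u (fun j => sw_measA AM i j).
have mcut S : measurable (F3 S).
  apply: measurable_fun_le; [exact: sw_meas AM| |by []].
  apply/measurable_funTS; under eq_fun do rewrite cutE.
  apply: measurable_sum => i; under eq_fun do under eq_bigr do rewrite mulrC.
  exact: measurable_weighted_sum (fun j => ((i \in S) && (j \notin S))%:R) (fun j => sw_measA AM i j).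
have [m1 p1] := @union_bound _ _ _ P 'I_n predT F1 _ (fun i _ => mrow i v) (fun i _ => PF1 i).
have [m2 p2] := @union_bound _ _ _ P 'I_n predT F2 _ (fun i _ => mrow i (fun=> 1)) (fun i _ => PF2 i).
have [m3 p3] := @union_bound _ _ _ P {set 'I_n} D3 F3 _ (fun S _ => mcut S) PF3.
set B1 := \bigcup_(i in _) F1 i in m1 p1.
set B2 := \bigcup_(i in _) F2 i in m2 p2.
set B3 := \bigcup_(i in _) F3 i in m3 p3.
exists (B1 `|` (B2 `|` B3)); split.
- by do !apply: measurableU.
- apply: le_trans (measureU2 _ m1 (measurableU _ _ m2 m3)) _.
  apply: le_trans (leeD p1 (measureU2 _ m2 m3)) _.
  apply: le_trans (leeD (lexx _) (leeD p2 p3)) _.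
  rewrite -!EFinD lee_fin; set km := Num.min k1 k2.
  have e1 : expR (- (N * k1)) <= expR (- (N * km)).
    by rewrite ler_expR lerN2 ler_wpM2l ?(ltW N0) // ge_min lexx.
  have e2 : expR (- (N * k2)) <= expR (- (N * km)).
    by rewrite ler_expR lerN2 ler_wpM2l ?(ltW N0) // ge_min lexx orbT.
  have h12 : \sum_(i in (predT : {pred 'I_n})) 2 * expR (- (N * k1)) <=
      n%:R * (2 * expR (- (N * km))).
    rewrite sumr_const cardT size_enum_ord -[leLHS]mulr_natl.
    by apply: ler_wpM2l => //; apply: ler_wpM2l.
  have h3 : \sum_(S in D3) expR (- (N * k2)) ^+ #|S| <= expR (n%:R * expR (- (N * km))) - 1.
    set y := expR (- (N * k2)) in e2 *.
    have y0 : 0 <= y by exact: expR_ge0.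
    have h : 1 + \sum_(S in D3) y ^+ #|S| <= (1 + y) ^+ n.
      have := @sum_subset_exp R 'I_n y; rewrite card_ord => <-.
      rewrite [leRHS](bigD1 finset.set0) //= cards0 expr0 lerD2l [leLHS]big_mkcond [leRHS]big_mkcond /=.
      apply: ler_sum => S _; rewrite -card_gt0.
      case: ifP => [/andP[-> //]|_]; case: ifP => // _; exact: exprn_ge0.
    have : (1 + y) ^+ n <= expR (n%:R * expR (- (N * km))).
      rewrite expRM_natl; apply: lerXn2r; rewrite ?nnegrE ?expR_ge0 ?addr_ge0 //.
      by apply: le_trans (expR_ge1Dx _); rewrite lerD2l.
    by rewrite lerBrDl; apply: le_trans.
  rewrite /failure_bound -/N -/km addrA; apply: lerD h3.
  have -> : n%:R * (4 * expR (- (N * km))) =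
    n%:R * (2 * expR (- (N * km))) + n%:R * (2 * expR (- (N * km))) by ring.
  exact: lerD.
- move=> w Gw /not_orP[nB1 /not_orP[nB2 nB3]].
  have r1 i : `|\sum_j adj A w i j * v j - eps * \sum_j M i j * v j| <= N * x.
    rewrite leNgt; apply/negP => /ltW h; apply: nB1; exists i => //.
  have r2 i : `|\sum_j adj A w i j - eps * \sum_j M i j| <= N * x.
    rewrite leNgt; apply/negP => /ltW h; apply: nB2; exists i => //; split => //=.
    by under eq_bigr do rewrite mulr1; under [in X in _ - X]eq_bigr do rewrite mulr1.
  have epsN g : eps * g = N * (n%:R^-1 * g) by rewrite /N; field; rewrite gt_eqF.
  split => //.
  + move=> i; have := r1 i; rewrite epsN.
    have := ler_wpM2l (ltW N0) (Mv i).
    rewrite -[X in X * `|_|](gtr0_norm N0) -normrM => h1 h2.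
    have -> : \sum_j adj A w i j * v j - N * rho * v i =
      (\sum_j adj A w i j * v j - N * (n%:R^-1 * (\sum_j M i j * v j))) +
      N * (n%:R^-1 * (\sum_j M i j * v j) - rho * v i) by ring.
    apply: le_trans (ler_normD _ _) _; apply: le_trans (lerD h2 h1) _.
    have -> : N * x + N * (del * c0 / 2) = N * del * c0 by rewrite /x; field.
    by case/andP: (vb i) => cv _; rewrite ler_wpM2l // mulr_ge0 ?(ltW N0) ?(ltW del0).
  + move=> i; have := r2 i; rewrite epsN.
    have := ler_wpM2l (ltW N0) (MK i).
    rewrite -[X in X * `|_|](gtr0_norm N0) -normrM => h1 h2.
    have -> : \sum_j adj A w i j - N * K i =
      (\sum_j adj A w i j - N * (n%:R^-1 * (\sum_j M i j))) +
      N * (n%:R^-1 * (\sum_j M i j) - K i) by ring.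
    apply: le_trans (ler_normD _ _) _; apply: le_trans (lerD h2 h1) _.
    by rewrite -mulrDr ler_wpM2l ?(ltW N0).
  + move=> S Sn; have [->|S0] := eqVneq S finset.set0.
      by rewrite cards0 mulr0 sumr_ge0 // => i _; apply: sumr_ge0.
    rewrite leNgt; apply/negP => /ltW h; apply: nB3; exists S => //.
    by rewrite /= inE /= card_gt0 S0.
Qed.

End typical_graph.

(** * Finite subfamilies and conditional probabilities *)

(** Independence is stated over finite subfamilies of a choice type, Chernoff
    bounds over subsets of a finite type. *)
Lemma fset_of_image (I : finType) (T : choiceType) (h : I -> T) (J : {set I}) :
  injective h -> exists K : {fset T},
  (forall t, (t \in K) <-> exists2 i, i \in J & t = h i) /\
  forall (S : Type) (idx : S) (op : Monoid.com_law idx) (F : T -> S),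
    \big[op/idx]_(t <- K) F t = \big[op/idx]_(i in J) F (h i).
Proof.
move=> hinj; exists [fset t in [seq h i | i <- enum J]]%fset; split=> [t|S idx op F].
  rewrite inE; split=> [/mapP[i]|[i iJ ->]]; first by rewrite mem_enum => ? ->; exists i.
  by apply: map_f; rewrite mem_enum.
rewrite -[RHS]big_enum /= -(big_map h xpredT F); apply: perm_big; apply: uniq_perm.
- exact: fset_uniq.
- by rewrite map_inj_uniq // enum_uniq.
- by move=> t; rewrite inE.
Qed.

Lemma fset_of_set (I : finType) (J : {set I}) : exists K : {fset I},
  (forall i, (i \in K) = (i \in J)) /\
  forall (T : Type) (idx : T) (op : Monoid.com_law idx) (F : I -> T),
    \big[op/idx]_(i <- K) F i = \big[op/idx]_(i in J) F i.
Proof.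
have [K [KJ Kop]] := fset_of_image J (@inj_id I); exists K; split=> // i.
by apply/idP/idP => [/KJ[j jJ ->]|iJ]; last by apply/KJ; exists i.
Qed.

Section conditional_probability.
Context {R : realType} {d : measure_display} {Omega : measurableType d}.
Variable P : probability Omega R.
Implicit Types (H : set (set Omega)) (E B : set Omega) (g : Omega -> R).

Lemma cond_prob_setC H E g : H `<=` measurable -> measurable E ->
  cond_prob P H E g -> cond_prob P H (~` E) (fun w => 1 - g w).
Proof.
move=> Hm mE [h [ih hH hint hg]]; exists (fun w => 1 - h w); split.
- rewrite (_ : EFin \o _ = (cst 1%E \- (EFin \o h))%E).
    by apply: integrableB => //; exact: finite_measure_integrable_cst.
  by apply/funext => w.
- move=> B mB; rewrite (_ : _ @^-1` B = h @^-1` ((fun x => 1 - x) @^-1` B)) //.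
  apply: hH; rewrite -[_ @^-1` _]setTI; apply: measurable_funB => //.
- move=> B HB; have mB := Hm _ HB.
  under eq_integral do rewrite EFinB.
  rewrite integralB //.
  + rewrite integral_cst // mul1e hint //.
    rewrite (setIC (~` E)) -setDE measureD // 1?(setIC E) //.
    exact: le_lt_trans (probability_le1 P mB) (ltry _).
  + by apply: (integrableS measurableT) => //; exact: (finite_measure_integrable_cst P 1).
  + exact: (integrableS measurableT).
- by move: hg; apply: filterS => w ->.
Qed.

(** The conditional probability agrees with g almost surely, and the integral
    of g over B is at most C times the probability of B. *)
Lemma cond_prob_le H E B g (C : R) : H `<=` measurable -> H B -> 0 <= C ->
  (forall w, B w -> 0 <= g w <= C) -> cond_prob P H E g ->
  (P (E `&` B) <= C%:E)%E.
Proof.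
move=> Hm HB C0 gC [h [ih hH hint hg]]; rewrite -hint //.
have mB := Hm _ HB.
have mh : measurable_fun B h.
  by apply/measurable_EFinP; apply: measurable_funS (measurable_int _ ih).
(* h is truncated to [0, C], which changes it on a null subset of B only. *)
pose h' w := Num.max 0 (Num.min (h w) C).
have -> : (\int[P]_(w in B) (h w)%:E = \int[P]_(w in B) (h' w)%:E)%E.
  apply: ae_eq_integral => //.
  - exact/measurable_EFinP.
  - by apply/measurable_EFinP; apply: measurable_maxr => //; apply: measurable_minr.
  - move: hg; apply: filterS => w hw Bw; have /andP[g0 g1] := gC w Bw.
    by rewrite /h' hw (min_idPl g1) (max_idPr g0).
apply: (@le_trans _ _ (\int[P]_(w in B) (cst C%:E w))%E).
  apply: ge0_le_integral => //.
  - by move=> w _; rewrite lee_fin /h' le_max lexx.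
  - by apply/measurable_EFinP; apply: measurable_maxr => //; apply: measurable_minr.
  - by move=> w _; rewrite lee_fin /h' ge_max C0 ge_min lexx orbT.
rewrite integral_cst // -[leRHS]mule1 lee_wpmul2l ?lee_fin //.
exact: probability_le1.
Qed.

End conditional_probability.

(** * Model A *)

Section model_A.
Context {R : realType} {d : measure_display} {Omega : measurableType d}.
Variable P : probability Omega R.

Lemma measurable_rv_bool (X : {RV P >-> bool}) (b : bool) : measurable (X @^-1` [set b]).
Proof. by rewrite -[X in measurable X]setTI; exact: measurable_funP. Qed.

Lemma preimage_true (X : {RV P >-> bool}) : X @^-1` [set true] = [set w | X w].
Proof. by apply/seteqP; split. Qed.

Lemma preimage_false (X : {RV P >-> bool}) : X @^-1` [set false] = [set w | ~~ X w].
Proof. by apply/seteqP; split=> w /=; case: (X w). Qed.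

Lemma prob_false (X : {RV P >-> bool}) (p : R) : P (X @^-1` [set true]) = p%:E ->
  P (X @^-1` [set false]) = (1 - p)%:E.
Proof.
move=> Xp; rewrite (_ : X @^-1` [set false] = ~` (X @^-1` [set true])).
  by rewrite probability_setC ?Xp //; exact: measurable_rv_bool.
by rewrite preimage_false preimage_true; apply/seteqP; split=> w /= /negP.
Qed.

Lemma forall_in_bigcap (I : finType) (J : {set I}) (K : {fset I})
    (X : I -> {RV P >-> bool}) (b : bool) :
  (forall i, (i \in K) = (i \in J)) ->
  [set w | [forall i in J, X i w == b]] =
  \bigcap_(i in [set` K]) (X i @^-1` [set b]).
Proof.
move=> KJ; apply/seteqP; split=> w /=.
  by move=> /forall_inP h i /=; rewrite KJ => /h/eqP.
by move=> h; apply/forall_inP => i iJ; apply/eqP/h; rewrite /= KJ.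
Qed.

Lemma modelA_sandwiched (W : R -> R -> R) n (A : 'I_n -> 'I_n -> {RV P >-> bool}) (eta : R) :
  (forall x y : R, x \in `[0, 1] -> y \in `[0, 1] -> 0 <= W x y <= 1) ->
  (forall x y : R, x \in `[0, 1] -> y \in `[0, 1] -> W x y = W y x) ->
  modelA W A -> 0 <= eta <= 1 ->
  sandwiched P setT (fun i j => A i j) (fun i j => W (grid i) (grid j)) 1 eta.
Proof.
move=> W01 Wsym [[Asym Adiag] Aind Aprob] eta01; have /andP[eta0 eta1] := eta01.
have edge_neq p : p \in @edge n -> p.1 != p.2.
  by rewrite -[p \in _]/(edge p) /edge => /ltn_eqF e; rewrite -val_eqE /= e.
have joint (b : bool) (J : {set 'I_n * 'I_n}) (F : 'I_n * 'I_n -> R) : J \subset @edge n ->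
    (forall p, p \in J -> P (A p.1 p.2 @^-1` [set b]) = (F p)%:E) ->
    P (setT `&` [set w | [forall p in J, A p.1 p.2 w == b]]) = (\prod_(p in J) F p)%:E.
  move=> JE HF; have [K [KJ Kprod]] := fset_of_set J.
  rewrite setTI (forall_in_bigcap (fun p => A p.1 p.2) b KJ).
  rewrite (Aind K (fun=> [set b])).
  - rewrite Kprod -prodEFin; apply: eq_bigr => p pJ; exact: HF.
  - by move=> p /=; rewrite KJ => /(fintype.subsetP JE).
  - by move=> p.
have Wg (i j : 'I_n) : 0 <= W (grid i) (grid j) <= 1 by rewrite W01 ?grid01.
split => //.
- by move=> i j; rewrite -preimage_true; exact: measurable_rv_bool.
- by rewrite ltr01 lexx.
- by move=> i j; rewrite Wsym ?grid01.
- move=> J JE.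
  have -> : [set w | [forall p in J, A p.1 p.2 w]] = [set w | [forall p in J, A p.1 p.2 w == true]].
    by apply/seteqP; split=> w /= /forall_inP h; apply/forall_inP => p /h; rewrite eqb_id.
  rewrite (joint true J (fun p => W (grid p.1) (grid p.2)) JE).
    rewrite lee_fin; apply: ler_prod => p _; have /andP[h _] := Wg p.1 p.2.
    by rewrite h mul1r lerDl.
  by move=> p /(fintype.subsetP JE)/edge_neq/Aprob.
- move=> J JE.
  have -> : [set w | [forall p in J, ~~ A p.1 p.2 w]] = [set w | [forall p in J, A p.1 p.2 w == false]].
    by apply/seteqP; split=> w /= /forall_inP h; apply/forall_inP => p /h; rewrite eqbF_neg.
  rewrite (joint false J (fun p => 1 - W (grid p.1) (grid p.2)) JE).
    rewrite lee_fin; apply: ler_prod => p _; have /andP[h1 h2] := Wg p.1 p.2.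
    rewrite subr_ge0 h2 /= mul1r lerD2l lerN2 ge_max h1 andbT; lra.
  by move=> p /(fintype.subsetP JE)/edge_neq/Aprob/prob_false.
Qed.

End model_A.

(** * Model B *)

Section uniform_samples.
Context {R : realType}.

Lemma uniform_prob01E (B : set R) : measurable B ->
  uniform_prob (@ltr01 R) B = lebesgue_measure (B `&` `[0, 1]).
Proof.
move=> mB; rewrite /uniform_prob integral_uniform_pdf.
rewrite (eq_integral (fun=> 1%E)); last first.
  move=> x; rewrite inE /= in_itv /= => -[_ x01].
  by rewrite /uniform_pdf x01 subr0 invr1.
rewrite integral_cst /= ?mul1e //; apply: measurableI => //.
Qed.

Lemma uniform_prob01_le (t : R) : 0 <= t <= 1 -> uniform_prob (@ltr01 R) `]-oo, t] = t%:E.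
Proof.
move=> /andP[t0 t1]; rewrite uniform_prob01E; last exact: measurable_itv.
have -> : `]-oo, t] `&` `[0, 1] = `[0, t]%classic :> set R.
  apply/seteqP; split=> x /=; rewrite !in_itv /=.
    by move=> [-> /andP[->]].
  by move=> /andP[-> xt]; rewrite xt (le_trans xt).
rewrite lebesgue_measure_itv /= lte_fin; case: ltP => t0'; first by rewrite oppr0 adde0.
by congr EFin; apply/eqP; rewrite eq_le t0 t0'.
Qed.

Definition sample_count {T : Type} (x : nat -> T -> R) n (t : R) (w : T) : R :=
  \sum_(j < n) (x j w <= t)%R%:R.

(** The empirical distribution function of the first n points is within 1/m
    of that of U(0,1) at the points k/m.  Monotonicity then controls it
    everywhere, hence the order statistics. *)
Definition spread {T : Type} (x : nat -> T -> R) n m : set T :=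
  (\bigcap_(j in [set: 'I_n]) [set w | 0 <= x j w <= 1]) `&`
  \bigcap_(k in [set: 'I_m.+1])
     [set w | `|sample_count x n (k%:R / m%:R) w - n%:R * (k%:R / m%:R)| < n%:R / m%:R].

(** Stated for an arbitrary sigma-algebra on T: it is applied both to that of
    Omega and to the one generated by the sample. *)
Lemma measurable_spread d (T : measurableType d) (x : nat -> T -> R) n m :
  (forall j, (j < n)%N -> measurable_fun setT (x j)) -> measurable (spread x n m).
Proof.
move=> mx; have mb (f : T -> bool) : measurable_fun setT f -> measurable [set w | f w].
  by move=> mf; rewrite -[X in measurable X]setTI; exact: mf.
apply: measurableI; apply: fin_bigcap_measurable => //; try exact: finite_finset.
- move=> j _; apply: (mb); apply: measurable_and; apply: measurable_fun_ler => //;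
    exact: mx.
- move=> k _; apply: (mb); apply: measurable_fun_ltr => //.
  apply: measurableT_comp => //; apply: measurable_funB => //.
  apply: measurable_sum => j; apply: measurable_natr_bool; apply: (mb).
  by apply: measurable_fun_ler => //; exact: mx.
Qed.

(** The i-th order statistic is at most t exactly when more than i points
    are; t is taken to be the multiple of 1/m next but one to the grid point,
    on either side. *)
Lemma spread_order_stat d (Omega : measurableType d) (P : probability Omega R)
    (X : nat -> {RV P >-> R}) n m w : (0 < m)%N ->
  spread (fun j => X j : Omega -> R) n m w ->
  forall i : 'I_n, (order_stat X i w \in `[0, 1]) /\ `|grid i - order_stat X i w| <= 2 / m%:R.
Proof.
move=> m0 [X01 Xcnt] i; rewrite /order_stat.
set s := [seq X k w | k <- iota 0 n].
have ss : sorted <=%O (sort <=%O s) by exact: sort_le_sorted.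
have sizes : size (sort <=%O s) = n by rewrite size_sort size_map size_iota.
have cnts t : (count (<= t) (sort <=%O s))%:R = sample_count (fun j => X j : Omega -> R) n t w.
  rewrite /sample_count; have /permP -> : perm_eq (sort <=%O s) s by rewrite perm_sort.
  rewrite /s count_map -sum1_count natr_sum.
  have -> : iota 0 n = index_iota 0 n by rewrite /index_iota subn0.
  rewrite big_mkcond /= big_mkord; apply: eq_bigr => j _.
  by case: (_ <= t).
have x01 : nth 0 (sort <=%O s) i \in `[0, 1].
  have : nth 0 (sort <=%O s) i \in s by rewrite -(mem_sort <=%O) mem_nth // sizes.
  move=> /mapP[k]; rewrite mem_iota add0n /= => kn ->.
  by rewrite in_itv /=; apply: (X01 (Ordinal kn)).
split => //.
set y := nth 0 _ _ in x01 *.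
have n0 : (0 < n)%N by apply: leq_ltn_trans (ltn_ord i).
have nR : 0 < n%:R :> R by rewrite ltr0n.
have mR : 0 < m%:R :> R by rewrite ltr0n.
set x := grid i.
have nx : n%:R * x = i.+1%:R by rewrite /x /grid mulrC divfK // gt_eqF.
have [x0 x1] : 0 <= x /\ x <= 1 by have := @grid01 R _ i; rewrite in_itv /= => /andP.
have mx0 : 0 <= m%:R * x by rewrite mulr_ge0.
have /andP[h1 h2] := Num.Theory.truncn_itv mx0.
set k := Num.truncn (m%:R * x) in h1 h2.
move: x01; rewrite in_itv /= => /andP[y0 y1].
have up : y <= x + 2 / m%:R.
  have kx : k.+2%:R / m%:R <= x + 2 / m%:R.
    rewrite ler_pdivrMr // mulrDl divfK ?gt_eqF //.
    by rewrite -[k.+2]addn2 natrD; lra.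
  have [km|mk] := leqP k.+2 m; last first.
    apply: le_trans kx; apply: le_trans y1 _.
    by rewrite ler_pdivlMr // mul1r ler_nat ltnW.
  apply: le_trans kx; apply: nth_count_le => //.
  rewrite -(ltr_nat R) cnts.
  have := Xcnt (inord k.+2) I; rewrite /= inordK // ltr_norml => /andP[+ _].
  have : i.+1%:R + n%:R / m%:R <= n%:R * (k.+2%:R / m%:R) :> R.
    rewrite -nx -mulrDr ler_wpM2l // ler_pdivlMr // mulrDl mulVf ?gt_eqF //.
    by move: h2; rewrite -[k.+2]addn1 natrD; lra.
  by rewrite -natr1; lra.
have low : x - 2 / m%:R <= y.
  have [k0|k0] := posnP k.
    apply: le_trans y0; rewrite subr_le0 ler_pdivlMr //.
    by move: h2; rewrite k0; lra.
  have kx : x - 2 / m%:R <= k.-1%:R / m%:R.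
    rewrite ler_pdivlMr // mulrBl divfK ?gt_eqF //.
    by move: h2; rewrite -(prednK k0) -!natr1 /=; lra.
  apply: le_trans kx _; apply: ltW; apply: nth_count_gt => //; rewrite sizes ltn_ord andbT.
  rewrite -ltnS -(ltr_nat R) cnts.
  have km : (k.-1 < m.+1)%N.
    have : k%:R <= m%:R :> R by apply: le_trans h1 _; rewrite ler_piMr.
    by rewrite ler_nat => km; rewrite ltnS (leq_trans (leq_pred k)).
  have := Xcnt (inord k.-1) I; rewrite /= inordK // ltr_norml => /andP[_ +].
  have : n%:R * (k.-1%:R / m%:R) + n%:R / m%:R <= i.+1%:R :> R.
    rewrite -nx -mulrDr ler_wpM2l // -[m%:R^-1]mul1r mulrA mulr1 -mulrDl ler_pdivrMr //.
    by move: h1; rewrite -{1}(prednK k0) -natr1; lra.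
  by lra.
by rewrite ler_norml; lra.
Qed.

End uniform_samples.

Section empirical_counts.
Context {R : realType} {d : measure_display} {Omega : measurableType d}.
Variable P : probability Omega R.
Variable X : nat -> {RV P >-> R}.
Hypothesis X_unif : forall k, uniform01 (X k).
Hypothesis X_ind : mutually_independent setT X.

Let measurable_X_preimage k (B : set R) : measurable B -> measurable (X k @^-1` B).
Proof. by move=> mB; rewrite -[X in measurable X]setTI; exact: measurable_funP. Qed.

Lemma sample_joint n (B : set R) (q : R) : measurable B ->
  uniform_prob (@ltr01 R) B = q%:E ->
  forall J : {set 'I_n},
  P (\bigcap_(j in [set` J]) (X j @^-1` B)) = (\prod_(j in J) q)%:E.
Proof.
move=> mB Bq J; have [K [KJ Kprod]] := @fset_of_image 'I_n nat val J val_inj.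
have -> : \bigcap_(j in [set` J]) (X j @^-1` B) = \bigcap_(k in [set` K]) (X k @^-1` B).
  apply/seteqP; split=> w /= h k /=.
    by move=> /KJ[i iJ ->]; apply: h.
  by move=> kJ; apply: h; apply/KJ; exists k.
rewrite (X_ind (J := K) (B := fun=> B)) // (Kprod _ _ _ (fun k => P (X k @^-1` B))).
by rewrite -prodEFin; apply: eq_bigr => j _; rewrite -Bq; apply: X_unif.
Qed.

(** The Chernoff bounds once more, for the events X_j <= t. *)
Lemma sample_count_tail n (t del : R) : 0 <= t <= 1 -> 0 < del <= 1 ->
  measurable [set w | n%:R * del <= `|sample_count (fun j => X j : Omega -> R) n t w - n%:R * t|] /\
  (P [set w | (n%:R * del <= `|sample_count (fun j => X j : Omega -> R) n t w - n%:R * t|)%R] <=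
   (2 * expR (- (n%:R * (del ^+ 2 / 8))))%:E)%E.
Proof.
move=> t01 /andP[del0 del1]; have /andP[t0 t1] := t01.
have mE : measurable (`]-oo, t]%classic : set R) by exact: measurable_itv.
have pE := uniform_prob01_le t01.
have pC : uniform_prob (@ltr01 R) (~` `]-oo, t]) = (1 - t)%:E.
  by rewrite probability_setC // [X in (_ - X)%E](_ : _ = t%:E).
pose Y (j : 'I_n) w := X j w <= t.
have mY (j : 'I_n) : measurable [set w | Y j w].
  rewrite (_ : [set w | _] = X j @^-1` `]-oo, t]); first exact: measurable_X_preimage.
  by apply/seteqP; split=> w; rewrite /= in_itv.
have joint : jointly_at_most P setT predT Y (fun=> t).
  move=> J _; rewrite setTI.
  have -> : [set w | [forall j in J, Y j w]] = \bigcap_(j in [set` J]) (X j @^-1` `]-oo, t]).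
    apply/seteqP; split=> w /=.
      by move=> /forall_inP h j /h; rewrite /= in_itv.
    by move=> h; apply/forall_inP => j jJ; have := h j jJ; rewrite /= in_itv.
  by rewrite (sample_joint mE pE).
have jointC : jointly_at_most P setT predT (fun j w => ~~ Y j w) (fun=> 1 - t).
  move=> J _; rewrite setTI.
  have -> : [set w | [forall j in J, ~~ Y j w]] = \bigcap_(j in [set` J]) (X j @^-1` (~` `]-oo, t])).
    apply/seteqP; split=> w /=.
      by move=> /forall_inP h j /h; rewrite /= in_itv /= => /negP.
    by move=> h; apply/forall_inP => j jJ; have := h j jJ; rewrite /= in_itv /= => /negP.
  by rewrite (sample_joint (measurableC mE) pC).
pose b (j : 'I_n) : R := 1.
have b0 j : 0 <= b j by [].
have bD j : j \notin (predT : {pred 'I_n}) -> b j = 0 by [].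
have sumE w : sample_count (fun j => X j : Omega -> R) n t w = \sum_j b j * (Y j w)%:R.
  by apply: eq_bigr => j _; rewrite mul1r.
have mT : measurable [set: Omega] by [].
set Up := [set w | n%:R * t + n%:R * del <= \sum_j b j * (Y j w)%:R].
set Dn := [set w | \sum_j b j * (Y j w)%:R <= n%:R * t - n%:R * del].
have mUp : measurable Up.
  by rewrite -[Up]setTI; exact: (measurable_weighted_sum_le b _ true mT mY).
have mDn : measurable Dn.
  by rewrite -[Dn]setTI; exact: (measurable_weighted_sum_le b _ false mT mY).
have -> : [set w | n%:R * del <= `|sample_count (fun j => X j : Omega -> R) n t w - n%:R * t|] = Up `|` Dn.
  apply/seteqP; split=> w; rewrite /Up /Dn /= -sumE.
    by rewrite ler_normr => /orP[h|h]; [left|right]; lra.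
  by rewrite ler_normr => -[h|h]; apply/orP; [left|right]; lra.
split; first exact: measurableU.
apply: le_trans (measureU2 _ mUp mDn) _.
have -> : 2 * expR (- (n%:R * (del ^+ 2 / 8))) =
  expR (- (n%:R * (del ^+ 2 / 8))) + expR (- (n%:R * (del ^+ 2 / 8))) :> R by ring.
rewrite EFinD; pose tau := del / 4.
have tau0 : 0 <= tau by rewrite divr_ge0 // ltW.
have taub j : tau * b j <= 1/2 by rewrite mulr1 /tau; lra.
have nt2 : 0 <= n%:R * del ^+ 2 :> R by rewrite mulr_ge0 ?sqr_ge0.
have nt3 : n%:R * del ^+ 2 * t <= n%:R * del ^+ 2 by rewrite ler_piMr.
apply: leeD.
  rewrite -[Up]setTI.
  apply: le_trans (chernoff_upper _ mT mY joint (fun=> t0) b0 bD tau0 taub) _.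
  rewrite lee_fin ler_expR /b sumr_const card_ord -[X in _ <= X]addr0 -mulr_natl mulr1 /tau; lra.
rewrite -[Dn]setTI.
apply: le_trans (chernoff_lower _ mT mY jointC (fun=> t01) b0 bD tau0) _.
rewrite lee_fin ler_expR /b sumr_const card_ord -[X in _ <= X]addr0 -mulr_natl mulr1 /tau; lra.
Qed.

Lemma spread_tail n m : (0 < m)%N ->
  (P (~` spread (fun j => X j : Omega -> R) n m) <=
   (m.+1%:R * (2 * expR (- (n%:R * (m%:R^-1 ^+ 2 / 8)))))%:E)%E.
Proof.
move=> m0; have mR : 0 < m%:R :> R by rewrite ltr0n.
have m1 : 0 < (m%:R^-1 : R) <= 1 by rewrite invr_gt0 mR /= invf_le1 // ler1n.
pose F1 (j : 'I_n) := X j @^-1` (~` `[0, 1]).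
pose F2 (k : 'I_m.+1) := [set w | n%:R * m%:R^-1 <=
   `|sample_count (fun j => X j : Omega -> R) n (k%:R / m%:R) w - n%:R * (k%:R / m%:R)|].
have k01 (k : 'I_m.+1) : 0 <= (k%:R / m%:R : R) <= 1.
  by rewrite divr_ge0 //= ler_pdivrMr // mul1r ler_nat -ltnS.
have mC : measurable (~` `[0, 1] : set R) by apply: measurableC; exact: measurable_itv.
have PF1 j : (P (F1 j) <= 0%:E)%E.
  rewrite [P _](X_unif j mC) uniform_prob01E //.
  by rewrite setIC setICr measure0.
have [mB1 pB1] := @union_bound _ _ _ P 'I_n predT F1 _ (fun j _ => measurable_X_preimage _ mC) (fun j _ => PF1 j).
have [mB2 pB2] := @union_bound _ _ _ P 'I_m.+1 predT F2 _ (fun k _ => (sample_count_tail n (k01 k) m1).1)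
  (fun k _ => (sample_count_tail n (k01 k) m1).2).
apply: (@le_trans _ _ (P ((\bigcup_(j in [set` (predT : {pred 'I_n})]) F1 j) `|`
    (\bigcup_(k in [set` (predT : {pred 'I_m.+1})]) F2 k)))).
  apply: le_measure; rewrite ?inE //.
  - by apply: measurableC; apply: measurable_spread.
  - exact: measurableU.
  - move=> w; apply: contra_notP => /not_orP[n1 n2]; split.
      move=> j _ /=; apply: contrapT => /negP h; apply: n1; exists j => //.
      by move=> /=; rewrite in_itv /=; exact/negP.
    move=> k _ /=; rewrite ltNge; apply/negP => h; apply: n2; exists k => //.
apply: le_trans (measureU2 _ mB1 mB2) _; apply: le_trans (leeD pB1 pB2) _.
rewrite -EFinD lee_fin big1 // add0r sumr_const cardT size_enum_ord -[leLHS]mulr_natl.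
by [].
Qed.

End empirical_counts.

Section model_B.
Context {R : realType} {d : measure_display} {Omega : measurableType d}.
Variable P : probability Omega R.

Lemma sigma_preimage_measurable n (X : nat -> {RV P >-> R}) :
  g_sigma_preimage (fun k : 'I_n => X k : Omega -> R) `<=` measurable.
Proof.
apply: smallest_sub; first exact: sigma_algebra_measurable.
elim/big_ind: _ => [B []|s1 s2 h1 h2 B [/h1|/h2]//|i _ B [C mC <-]] //.
by rewrite -[X in measurable X]setTI setIA setTI; exact: measurable_funP.
Qed.

Lemma spread_sigma_preimage n (X : nat -> {RV P >-> R}) m :
  g_sigma_preimage (fun k : 'I_n => X k : Omega -> R)
    (spread (fun j => X j : Omega -> R) n m).
Proof.
set S := \big[setU/set0]_(i < n) preimage_set_system setT (X i : Omega -> R) measurable.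
(* The generated sigma-algebra is seen as that of a measurable type on the same
   carrier. *)
change (measurable (spread (fun j => X j : g_sigma_algebraType S -> R) n m)).
apply: measurable_spread => j jn _ B mB; apply: sub_sigma_algebra.
rewrite /S (bigD1 (Ordinal jn)) //=; left; exists B => //.
Qed.

(** On the event [spread] the arguments of W are within 2/m of the grid
    points.  This event belongs to the sigma-algebra of the sample, so the
    conditional probabilities can be integrated over it. *)
Lemma modelB_sandwiched (W : R -> R -> R) (X : nat -> {RV P >-> R}) n m (e eta del : R)
    (A : 'I_n -> 'I_n -> {RV P >-> bool}) :
  (forall x y : R, x \in `[0, 1] -> y \in `[0, 1] -> 0 <= W x y <= 1) ->
  (forall x y : R, x \in `[0, 1] -> y \in `[0, 1] -> W x y = W y x) ->
  (forall x x' y y' : R, x \in `[0, 1] -> x' \in `[0, 1] -> y \in `[0, 1] -> y' \in `[0, 1] ->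
    `|x - x'| <= del -> `|y - y'| <= del -> `|W x y - W x' y'| <= eta) ->
  (0 < m)%N -> 2 / m%:R <= del -> 0 <= eta <= 1 -> 0 < e <= 1 ->
  modelB_graph W e X A ->
  sandwiched P (spread (fun j => X j : Omega -> R) n m) (fun i j => A i j)
     (fun i j => W (grid i) (grid j)) e eta.
Proof.
move=> W01 Wsym Wuc m0 mdel eta01 e01 [[Asym Adiag] Aind Aprob].
have /andP[eta0 eta1] := eta01; have /andP[e0 e1] := e01.
set G := spread _ _ _.
set H := g_sigma_preimage (fun k : 'I_n => X k : Omega -> R) in Aind Aprob.
have Hm : H `<=` measurable by exact: sigma_preimage_measurable.
have HG : H G by exact: spread_sigma_preimage.
have edge_neq p : p \in @edge n -> p.1 != p.2.
  by rewrite -[p \in _]/(edge p) /edge => /ltn_eqF pe; rewrite -val_eqE /= pe.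
pose q (p : 'I_n * 'I_n) w := e * W (order_stat X p.1 w) (order_stat X p.2 w).
have joint (b : bool) (J : {set 'I_n * 'I_n}) (g : 'I_n * 'I_n -> Omega -> R) (F : 'I_n * 'I_n -> R) :
    J \subset @edge n ->
    (forall p, p \in J -> cond_prob P H (A p.1 p.2 @^-1` [set b]) (g p)) ->
    (forall p w, G w -> 0 <= g p w <= F p) -> (forall p, 0 <= F p) ->
    (P (G `&` [set w | [forall p in J, A p.1 p.2 w == b]]) <= (\prod_(p in J) F p)%:E)%E.
  move=> JE Hg gF F0; have [K [KJ Kprod]] := fset_of_set J.
  rewrite setIC (forall_in_bigcap (fun p => A p.1 p.2) b KJ).
  apply: (@cond_prob_le _ _ _ P H _ G (fun w => \prod_(p <- K) g p w)) => //.
  - by apply: prodr_ge0 => p _.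
  - move=> w Gw; rewrite Kprod; apply/andP; split.
      by apply: prodr_ge0 => p _; case/andP: (gF p w Gw).
    by apply: ler_prod => p _; apply: gF.
  - apply: (Aind K (fun=> [set b]) g) => //.
    + by move=> p /=; rewrite KJ => /(fintype.subsetP JE).
    + by move=> p; rewrite KJ; exact: Hg.
have Wg (i j : 'I_n) : 0 <= W (grid i) (grid j) <= 1 by rewrite W01 ?grid01.
have osW (p : 'I_n * 'I_n) w : G w ->
    0 <= W (order_stat X p.1 w) (order_stat X p.2 w) <= 1 /\
    `|W (grid p.1) (grid p.2) - W (order_stat X p.1 w) (order_stat X p.2 w)| <= eta.
  move=> Gw; have [a1 b1] := spread_order_stat m0 Gw p.1.
  have [a2 b2] := spread_order_stat m0 Gw p.2.
  by split; [exact: W01|apply: Wuc; rewrite ?grid01 // (le_trans _ mdel)].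
split => //.
- exact: Hm.
- by move=> i j; rewrite -preimage_true; exact: measurable_rv_bool.
- by move=> i j; rewrite Wsym ?grid01.
- move=> J JE.
  have -> : [set w | [forall p in J, A p.1 p.2 w]] = [set w | [forall p in J, A p.1 p.2 w == true]].
    by apply/seteqP; split=> w /= /forall_inP h; apply/forall_inP => p /h; rewrite eqb_id.
  apply: (joint true J q (fun p => e * (W (grid p.1) (grid p.2) + eta))) => //.
  + by move=> p /(fintype.subsetP JE)/edge_neq/Aprob.
  + move=> p w /(osW p)[/andP[h1 h2]]; rewrite ler_norml => h3.
    rewrite /q mulr_ge0 ?(ltW e0) //= ler_wpM2l ?(ltW e0) //; lra.
  + by move=> p; rewrite mulr_ge0 ?(ltW e0) // addr_ge0 //; case/andP: (Wg p.1 p.2).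
- move=> J JE.
  have -> : [set w | [forall p in J, ~~ A p.1 p.2 w]] = [set w | [forall p in J, A p.1 p.2 w == false]].
    by apply/seteqP; split=> w /= /forall_inP h; apply/forall_inP => p /h; rewrite eqbF_neg.
  apply: (joint false J (fun p w => 1 - q p w)
    (fun p => 1 - e * Num.max (W (grid p.1) (grid p.2) - eta) 0)) => //.
  + move=> p /(fintype.subsetP JE)/edge_neq/Aprob.
    move=> /(cond_prob_setC Hm (measurable_rv_bool _ _)).
    by rewrite preimage_true preimage_false (_ : ~` _ = [set w | ~~ A p.1 p.2 w]) //;
      apply/seteqP; split=> w /= /negP.
  + move=> p w /(osW p)[/andP[h1 h2]]; rewrite ler_norml => h3.
    rewrite subr_ge0 mulr_ile1 ?(ltW e0) //= lerD2l lerN2 /q ler_wpM2l ?(ltW e0) //.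
    by rewrite ge_max h1 andbT; lra.
  + move=> p; have /andP[h1 h2] := Wg p.1 p.2.
    rewrite subr_ge0 mulr_ile1 ?(ltW e0) // ?le_max ?lexx ?orbT // ge_max ler01 andbT; lra.
Qed.

End model_B.

(** * Uniform continuity and Riemann sums *)

Section uniform_continuity.
Context {R : realType}.

(** Heine's theorem, from the near-covering characterization of compactness:
    the filter is that of small positive radii. *)
Lemma compact_unif_continuous (T : pseudoMetricType R) (A : set T) (f : T -> R) :
  compact A -> {within A, continuous f} -> forall eta : R, 0 < eta ->
  exists2 del : R, 0 < del & forall x y, A x -> A y -> ball x del y -> `|f x - f y| <= eta.
Proof.
move=> /compact_near_coveringP cA /subspace_continuousP fc eta eta0.
have := cA R (0^'+) (fun del x => forall y, A x -> A y -> ball x del y -> `|f x - f y| <= eta) _.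
case=> [x Ax|].
  have /cvgrPdist_le /(_ (eta / 2)) := fc x Ax.
  rewrite divr_gt0 // => /(_ isT) /nbhs_ballP[r /= r0 rf].
  have r20 : 0 < r / 2 by rewrite divr_gt0.
  near=> x' del => y Ax' Ay xy.
  have xx' : ball x (r / 2) x' by near: x'; apply: nbhsx_ballx.
  have delr : del <= r / 2 by near: del; apply: nbhs_right_le.
  have h1 : `|f x - f x'| <= eta / 2.
    by apply: rf => //; apply: le_ball xx'; lra.
  have h2 : `|f x - f y| <= eta / 2.
    by apply: rf => //; rewrite [r]splitr; apply: ball_triangle xx' _; apply: le_ball xy.
  have -> : f x' - f y = (f x - f y) - (f x - f x') by ring.
  by apply: le_trans (ler_normB _ _) _; lra.
move=> del0 /= [del00 H].
exists (del0 / 2); first by rewrite divr_gt0.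
move=> x y Ax Ay xy; apply: (H (del0 / 2)) => //=.
- by rewrite sub0r normrN gtr0_norm ?divr_gt0 //; lra.
- by rewrite divr_gt0.
Unshelve. all: by end_near. Qed.

(** The uniform form of continuity on [0,1], equivalent to it by
    [continuous_ucont01] and [ucont01_continuous]; it is what Riemann sums
    need, and it ignores the values outside [0,1]. *)
Definition ucont01 (f : R -> R) := forall eta : R, 0 < eta -> exists2 del : R, 0 < del &
  forall x y : R, x \in `[0, 1] -> y \in `[0, 1] -> `|x - y| <= del -> `|f x - f y| <= eta.

Lemma ucont01_cst (c : R) : ucont01 (cst c).
Proof. by move=> eta eta0; exists 1 => // *; rewrite subrr normr0 ltW. Qed.

Lemma continuous_ucont01 (f : R -> R) : {within `[0, 1], continuous f} -> ucont01 f.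
Proof.
move=> fc eta eta0.
have [del del0 H] := compact_unif_continuous (@segment_compact R 0 1) fc eta0.
exists (del / 2); first by rewrite divr_gt0.
move=> x y x01 y01 xy; apply: H => //.
by rewrite -ball_normE /=; lra.
Qed.

Lemma ucont01_continuous (f : R -> R) : ucont01 f -> {within `[0, 1], continuous f}.
Proof.
move=> fu; apply/subspace_continuousP => x x01; apply/cvgrPdist_le => eta eta0.
have [del del0 H] := fu eta eta0.
apply/nbhs_ballP; exists del => //= y; rewrite -ball_normE /= => xy y01.
by apply: H => //; apply: ltW.
Unshelve. all: by end_near. Qed.

Lemma continuous_unif_cont01 (W : R -> R -> R) :
  {within `[0, 1] `*` `[0, 1], continuous (fun p : R * R => W p.1 p.2)} -> unif_cont01 W.
Proof.
move=> Wc eta eta0.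
have cA := compact_setX (@segment_compact R 0 1) (@segment_compact R 0 1).
have [del del0 H] := compact_unif_continuous cA Wc eta0.
exists (del / 2); first by rewrite divr_gt0.
move=> x x' y y' x01 x'01 y01 y'01 xx yy.
apply: (H (x, y) (x', y')) => //.
by split; rewrite /= -ball_normE /=; lra.
Qed.

End uniform_continuity.

Section riemann_sums.
Context {R : realType}.
Local Notation mu := (@lebesgue_measure R).

Lemma ucont01_integrable (f : R -> R) : ucont01 f -> mu.-integrable `[0, 1] (EFin \o f).
Proof.
move=> fu; apply: continuous_compact_integrable; first exact: segment_compact.
exact: ucont01_continuous.
Qed.

Lemma riemann_step (f : R -> R) (a b eta : R) : a < b ->
  mu.-integrable `]a, b] (EFin \o f) ->
  (forall y, a < y <= b -> `|f y - f b| <= eta) ->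
  `|\int[mu]_(y in `]a, b]) f y - (b - a) * f b| <= eta * (b - a).
Proof.
move=> ab fi fb.
have m : measurable (`]a, b]%classic : set (measurableTypeR R)) by exact: measurable_itv.
have muab : fine (mu `]a, b]) = b - a.
  by rewrite lebesgue_measure_itv /= lte_fin ab.
have fin : (mu `]a, b] < +oo)%E by rewrite lebesgue_measure_itv /= lte_fin ab -EFinB ltry.
have ci (c : R) : mu.-integrable `]a, b] (EFin \o cst c).
  have ii : mu.-integrable `[a, b] (EFin \o cst c).
    apply: continuous_compact_integrable; first exact: segment_compact.
    by apply: continuous_subspaceT => x; exact: cvg_cst.
  apply: integrableS ii; [exact: measurable_itv|by []|].
  by move=> x /=; rewrite !in_itv /= => /andP[/ltW -> ->].
have -> : (b - a) * f b = \int[mu]_(y in `]a, b]) cst (f b) y.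
  by rewrite Rintegral_cst // muab mulrC.
rewrite -RintegralB //.
have ii : mu.-integrable `]a, b] (EFin \o (fun y => f y - cst (f b) y)).
  rewrite (_ : EFin \o _ = ((EFin \o f) \- (EFin \o cst (f b)))%E) //.
  exact: integrableB.
apply: le_trans (le_normr_Rintegral m ii) _.
have -> : eta * (b - a) = \int[mu]_(y in `]a, b]) cst eta y by rewrite Rintegral_cst // muab.
apply: le_Rintegral => //.
- exact: (integrable_abse ii).
Qed.

Lemma riemann_sum (f : R -> R) n (eta : R) : (0 < n)%N ->
  mu.-integrable `[0, 1] (EFin \o f) ->
  (forall x y : R, x \in `[0, 1] -> y \in `[0, 1] -> `|x - y| <= n%:R^-1 -> `|f x - f y| <= eta) ->
  `|\int[mu]_(y in `[0, 1]) f y - avg (fun i : 'I_n => f (grid i))| <= eta.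
Proof.
move=> n0 fi fu; have nR : 0 < n%:R :> R by rewrite ltr0n.
have sub01 (a b : R) : 0 <= a -> b <= 1 -> mu.-integrable `]a, b] (EFin \o f).
  move=> a0 b1; apply: (integrableS _ _ _ fi) => //; try exact: measurable_itv.
  by move=> x /=; rewrite !in_itv /= => /andP[/ltW ax xb]; rewrite (le_trans a0) ?(le_trans xb).
suff H k : (k <= n)%N -> `|\int[mu]_(y in `[0, k%:R / n%:R]) f y -
    n%:R^-1 * \sum_(0 <= i < k) f (i.+1%:R / n%:R)| <= eta * (k%:R / n%:R).
  by have := H n (leqnn n); rewrite divff ?gt_eqF // mulr1 /avg big_mkord.
elim: k => [_|k IHk kn].
  by rewrite big_geq // mulr0 mul0r subr0 mulr0 set_itv1 Rintegral_set1 normr0.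
have {}IHk := IHk (ltnW kn).
set a := k%:R / n%:R in IHk *; set b := k.+1%:R / n%:R.
have ban : b - a = n%:R^-1 by rewrite /a /b -natr1; field; rewrite gt_eqF.
have ab : a < b by rewrite -subr_gt0 ban invr_gt0.
have a0 : 0 <= a by rewrite divr_ge0.
have b1 : b <= 1 by rewrite ler_pdivrMr // mul1r ler_nat.
have step := @riemann_step f a b eta ab (sub01 a b a0 b1).
have {}step : `|\int[mu]_(y in `]a, b]) f y - (b - a) * f b| <= eta * (b - a).
  apply: step => y /andP[ay yb]; apply: fu.
  - by rewrite in_itv /= (le_trans a0 (ltW ay)) (le_trans yb b1).
  - by rewrite in_itv /= (le_trans a0 (ltW ab)).
  - rewrite -ban ler_norml; lra.
have split : \int[mu]_(y in `[0, b]) f y =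
    \int[mu]_(y in `[0, a]) f y + \int[mu]_(y in `]a, b]) f y.
  rewrite -(@Rintegral_itvB _ f (BLeft 0) (BRight b) a) ?bnd_simp ?(ltW ab) //.
    by rewrite addrC subrK.
  apply: (integrableS _ _ _ fi) => //; try exact: measurable_itv.
  by move=> x /=; rewrite !in_itv /= => /andP[-> xb]; rewrite (le_trans xb).
rewrite [in X in `|_ - X|]ban in step.
rewrite split big_nat_recr //= mulrDr -/b.
have -> : eta * b = eta * a + eta * (b - a) by ring.
rewrite opprD addrACA.
by apply: le_trans (ler_normD _ _) _; apply: lerD.
Qed.

End riemann_sums.

(** * The continuous eigenfunction *)

Section restricted_lebesgue.
Context {R : realType}.
Local Notation mu := (@lebesgue_measure R).
Local Notation D := (`[0%R, 1%R]%classic : set (measurableTypeR R)).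

Lemma ae_lebesgue01 (Q : R -> Prop) : {ae lebesgue01, forall x, Q x} ->
  {ae mu, forall x, D x -> Q x}.
Proof.
move=> [N [mN N0 QN]]; exists (N `&` D); split.
- exact: measurableI mN measurable_I01.
- exact: N0.
- move=> x /= /not_implyP[Dx nQ]; split => //; exact: QN.
Qed.

(** f agrees with its restriction to [0,1] almost everywhere for the restricted
    measure, and on subsets of [0,1] both measures agree. *)
Lemma lebesgue01_integral (f : R -> \bar R) : measurable_fun setT f ->
  (\int[lebesgue01]_x f x = \int[mu]_(x in D) f x)%E.
Proof.
move=> mf; transitivity (\int[lebesgue01]_(x in D) f x)%E.
  rewrite [RHS]integral_mkcond; apply: ae_eq_integral => //.
    by apply/(measurable_restrictT _ measurable_I01); exact: measurable_funTS.
  exists (~` D); split.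
  - by apply: measurableC; exact: measurable_I01.
  - by rewrite /lebesgue01 /= /mrestr setICl measure0.
  - by move=> x /= nE Dx; apply: nE => _; rewrite patchE mem_set.
apply: eq_measure_integral => B mB BD.
by rewrite /lebesgue01 /= /mrestr setIidl.
Qed.

Lemma L2_integrable01 (f : R -> R) : f \in L2 -> mu.-integrable D (EFin \o f).
Proof.
move=> fL2; have mf : measurable_fun setT f.
  by have := sub_Lfun_mfun fL2; rewrite inE.
have fin : lebesgue01 setT \is a @fin_num R.
  rewrite /lebesgue01 /= /mrestr setTI lebesgue_measure_itv /= lte01.
  by rewrite oppr0 adde0.
have /Lfun1_integrable/integrableP[_ H] := Lfun_subset12 fin fL2.
apply/integrableP; split; first exact/measurable_EFinP/measurable_funTS.
rewrite -lebesgue01_integral //.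
by apply: measurableT_comp => //; exact/measurable_EFinP.
Qed.

Lemma L2norm1_sqr (f : R -> R) : f \in L2 -> L2norm f = 1%E ->
  \int[mu]_(x in D) (f x ^+ 2) = 1.
Proof.
move=> fL2 fn; have mf : measurable_fun setT f.
  by have := sub_Lfun_mfun fL2; rewrite inE.
have H := @poweR_Lnorm _ _ R lebesgue01 (EFin \o f) 2 (lt0r_neq0 (ltr0n R 2)).
rewrite -/(L2norm f) fn poweR1r in H.
rewrite /Rintegral (_ : (\int[mu]_(x in D) (f x ^+ 2)%:E)%E = 1%:E) //.
rewrite -lebesgue01_integral; last by apply/measurable_EFinP; apply: measurable_funX.
rewrite [RHS]H; apply: eq_integral => x _ /=.
by rewrite powR_mulrn ?normr_ge0 // real_normK ?num_real.
Qed.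

End restricted_lebesgue.

Section kernel_operator.
Context {R : realType}.
Local Notation mu := (@lebesgue_measure R).
Local Notation D := (`[0%R, 1%R]%classic : set (measurableTypeR R)).
Variable W : R -> R -> R.
Hypothesis Wuc : unif_cont01 W.
Hypothesis W01 : forall x y : R, x \in `[0, 1] -> y \in `[0, 1] -> 0 <= W x y <= 1.

Let mD : measurable D. Proof. exact: measurable_I01. Qed.

Lemma lebesgue_measure01 : mu D = 1%E.
Proof. by rewrite lebesgue_measure_itv /= lte01 oppr0 adde0. Qed.

Lemma kernel_section_ucont (x : R) : x \in `[0, 1] -> ucont01 (W x).
Proof.
move=> x01 eta eta0; have [del del0 H] := Wuc eta0; exists del => // y y' y01 y'01 yy.
by apply: H => //; rewrite subrr normr0 ltW.
Qed.

Lemma ucont01_measurable (f : R -> R) : ucont01 f -> measurable_fun D f.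
Proof.
move=> /ucont01_integrable/integrableP[/measurable_EFinP mf _]; exact: mf.
Qed.

Lemma kernel_integrable (x : R) (f : R -> R) : x \in `[0, 1] ->
  mu.-integrable D (EFin \o f) -> mu.-integrable D (EFin \o (fun y => W x y * f y)).
Proof.
move=> x01 fi; apply: (le_integrable mD _ _ fi).
  apply/measurable_EFinP; apply: measurable_funM.
    apply: ucont01_measurable. exact: kernel_section_ucont x01.
  by have /integrableP[/measurable_EFinP mf _] := fi; exact: mf.
move=> y Dy; rewrite /= lee_fin normrM ler_piMl //.
have /andP[h1 h2] := W01 x01 Dy; by rewrite ger0_norm.
Qed.

Lemma integrable_sub (f g : R -> R) : mu.-integrable D (EFin \o f) ->
  mu.-integrable D (EFin \o g) -> mu.-integrable D (EFin \o (fun y => f y - g y)).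
Proof.
move=> fi gi; rewrite (_ : EFin \o _ = ((EFin \o f) \- (EFin \o g))%E) //.
exact: integrableB.
Qed.

Lemma integrable_scale (c : R) (f : R -> R) : mu.-integrable D (EFin \o f) ->
  mu.-integrable D (EFin \o (fun y => c * f y)).
Proof.
move=> fi; rewrite (_ : EFin \o _ = (cst c%:E \* (EFin \o f))%E) //.
exact: integrableZl.
Qed.

(** |T f x - T f x'| is at most the modulus of continuity of W times the L^1
    norm of f. *)
Lemma integral_op_ucont (f : R -> R) : mu.-integrable D (EFin \o f) ->
  ucont01 (integral_op W f).
Proof.
move=> fi eta eta0.
pose L := \int[mu]_(y in D) `|f y|.
have L0 : 0 <= L by apply: Rintegral_ge0.
have L1 : 0 < L + 1 by lra.
have [del del0 H] := Wuc (divr_gt0 eta0 L1).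
exists del => // x x' x01 x'01 xx.
rewrite /integral_op -RintegralB //; try exact: kernel_integrable.
have ii : mu.-integrable D (EFin \o (fun y => W x y * f y - W x' y * f y)).
  by apply: integrable_sub; exact: kernel_integrable.
have fai : mu.-integrable D (EFin \o (fun y => `|f y|)) by exact: (integrable_abse fi).
apply: le_trans (le_normr_Rintegral mD ii) _.
apply: (@le_trans _ _ (\int[mu]_(y in D) (eta / (L + 1) * `|f y|))).
  apply: le_Rintegral => //.
  - exact: (integrable_abse ii).
  - exact: integrable_scale.
  - move=> y Dy; rewrite -mulrBl normrM ler_wpM2r //.
    by apply: H => //; rewrite subrr normr0 ltW.
rewrite RintegralZl // -/L mulrAC ler_pdivrMr // ler_wpM2l ?(ltW eta0) //; lra.
Qed.

Lemma eq_ae_integral_op (x : R) (f g : R -> R) : x \in `[0, 1] ->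
  mu.-integrable D (EFin \o f) -> mu.-integrable D (EFin \o g) ->
  {ae mu, forall y, D y -> f y = g y} -> integral_op W f x = integral_op W g x.
Proof.
move=> x01 fi gi fg; rewrite /integral_op /Rintegral; congr fine.
apply: ae_eq_integral => //.
- by case/integrableP: (kernel_integrable x01 fi).
- by case/integrableP: (kernel_integrable x01 gi).
- by move: fg; apply: filterS => y h Dy /=; rewrite h.
Qed.

Lemma degree_fun_op (x : R) : degree_fun W x = integral_op W (cst 1) x.
Proof. by apply: eq_Rintegral => y _; rewrite /= mulr1. Qed.

Lemma one_integrable : mu.-integrable D (EFin \o cst (1 : R)).
Proof. exact: ucont01_integrable (ucont01_cst 1). Qed.

Lemma Rintegral01_cst (c : R) : \int[mu]_(y in D) c = c.
Proof. by rewrite Rintegral_cst // [X in fine X](_ : _ = 1%E) ?mulr1 //; exact: lebesgue_measure01. Qed.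

Lemma degree_fun_le (x c : R) : x \in `[0, 1] ->
  (forall y, y \in `[0, 1] -> W x y <= c) -> degree_fun W x <= c.
Proof.
move=> x01 Wc; rewrite -[leRHS]Rintegral01_cst; apply: le_Rintegral => //.
- exact/ucont01_integrable/kernel_section_ucont.
- have := integrable_scale c one_integrable.
  by rewrite (_ : (fun y => _) = cst c) //; apply/funext => y; rewrite /= mulr1.
Qed.

(** If the integral of the nonnegative function W x f vanished, W x would
    vanish almost everywhere because f > 0, and so would its integral. *)
Lemma integral_op_gt0 (x : R) (f : R -> R) : x \in `[0, 1] ->
  mu.-integrable D (EFin \o f) -> (forall y, y \in `[0, 1] -> 0 < f y) ->
  0 < degree_fun W x -> 0 < integral_op W f x.
Proof.
move=> x01 fi f0 K0; have Wf := kernel_integrable x01 fi.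
have W0 y : y \in `[0, 1] -> 0 <= W x y by move=> y01; case/andP: (W01 x01 y01).
have h : 0 <= integral_op W f x.
  by apply: Rintegral_ge0 => y Dy; rewrite mulr_ge0 ?W0 // ltW // f0.
rewrite lt_neqAle h andbT; apply/negP => /eqP/esym I0.
have I0' : (\int[mu]_(y in D) `|(W x y * f y)%:E| = 0)%E.
  have fin : (\int[mu]_(y in D) (W x y * f y)%:E \is a fin_num)%E.
    exact: integrable_fin_num.
  transitivity (integral_op W f x)%:E; last by rewrite I0.
  rewrite /integral_op /Rintegral fineK //.
  apply: eq_integral => y; rewrite inE => Dy /=.
  by rewrite ger0_norm // mulr_ge0 ?W0 // ltW // f0.
have := (ae_eq_integral_abs mu mD (measurable_int _ Wf)).1 I0'.
move=> ae0; suff : degree_fun W x = 0 by move: K0 => /[swap] ->; rewrite ltxx.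
rewrite /degree_fun /Rintegral (_ : (\int[mu]_(y in D) (W x y)%:E = 0)%E) //.
rewrite -[RHS](@integral0 _ _ _ mu D); apply: ae_eq_integral => //.
- by apply/measurable_EFinP; apply: ucont01_measurable; exact: kernel_section_ucont x01.
- move: ae0; apply: filterS => y hy Dy /=.
  have := hy Dy; rewrite /= => -[] /eqP; rewrite mulf_eq0 (gt_eqF (f0 y Dy)) orbF.
  by move=> /eqP ->.
Qed.

Lemma ucont01_bounded_below (f : R -> R) : ucont01 f ->
  exists2 c : R, c \in `[0, 1] & forall x : R, x \in `[0, 1] -> f c <= f x.
Proof. by move=> /ucont01_continuous; apply: EVT_min. Qed.

Lemma ucont01_bounded_above (f : R -> R) : ucont01 f ->
  exists2 c : R, c \in `[0, 1] & forall x : R, x \in `[0, 1] -> f x <= f c.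
Proof. by move=> /ucont01_continuous; apply: EVT_max. Qed.

Lemma ucont01_bounded (g : R -> R) : ucont01 g -> exists B, forall x : R, x \in `[0, 1] -> `|g x| <= B.
Proof.
move=> gu; have [a a01 amin] := ucont01_bounded_below gu.
have [b b01 bmax] := ucont01_bounded_above gu.
exists (`|g a| + `|g b|) => x x01; have := amin x x01; have := bmax x x01.
have := ler_norm (g b); have := ler_norm (- g a); rewrite normrN ler_norml.
have := normr_ge0 (g a); have := normr_ge0 (g b); lra.
Qed.

(** v = T_W phi / rho.  It is continuous, agrees with phi almost everywhere,
    and is positive everywhere because T_W phi is; the latter also gives
    rho > 0.  As T_W v = T_W phi, the eigenvalue equation of v holds at every
    point. *)
Lemma continuous_eigenfunction (rho kmin : R) (phi : R -> R) :
  0 < kmin -> (forall x : R, x \in `[0, 1] -> kmin <= degree_fun W x) ->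
  eigenfunction W rho phi -> (forall x : R, x \in `[0, 1] -> 0 < phi x) ->
  L2norm phi = 1%E ->
  0 < rho /\ exists v c0 C0, [/\ ucont01 v, 0 < c0,
    forall x : R, x \in `[0, 1] -> c0 <= v x <= C0,
    forall x : R, x \in `[0, 1] -> integral_op W v x = rho * v x &
    \int[mu]_(y in D) (v y ^+ 2) = 1 /\ {ae mu, forall x, D x -> phi x = v x}].
Proof.
move=> kmin0 Kmin [phiL2 _ phi_eig] phi0 phi1.
have phii := L2_integrable01 phiL2.
have Tu := integral_op_ucont phii.
have T0 x : x \in `[0, 1] -> 0 < integral_op W phi x.
  move=> x01; apply: integral_op_gt0 => //; exact: lt_le_trans (Kmin x x01).
have Tphi : {ae mu, forall x, D x -> integral_op W phi x = rho * phi x}.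
  apply: ae_lebesgue01; case: phi_eig => N [mN N0 TN]; exists N; split => // x h.
  by apply: TN => h'; apply: h; exact: (h' I).
have rho0 : 0 < rho.
  have [x [x01 Ex]] : exists x, D x /\ integral_op W phi x = rho * phi x.
    apply: contrapT => /forallNP H; case: Tphi => N [mN N0 TN].
    have DN : D `<=` N by move=> x Dx; apply: TN => /= h; apply: (H x); split => //; exact: h.
    have : (mu D <= mu N)%E by apply: le_measure => //; rewrite inE.
    by rewrite N0 lebesgue_measure01 lee_fin ler10.
  have := T0 x x01; rewrite Ex pmulr_lgt0 //; exact: phi0.
pose v x := rho^-1 * integral_op W phi x.
have vu : ucont01 v.
  move=> eta eta0; have [del del0 H] := Tu _ (mulr_gt0 eta0 rho0).
  exists del => // x y x01 y01 xy; rewrite /v -mulrBr normrM gtr0_norm ?invr_gt0 //.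
  by rewrite mulrC ler_pdivrMr //; exact: H.
have phiv : {ae mu, forall x, D x -> phi x = v x}.
  by move: Tphi; apply: filterS => x h Dx; rewrite /v h // mulKf // gt_eqF.
have vi := ucont01_integrable vu.
have [c c01 cmin] := ucont01_bounded_below vu.
have [C C01 Cmax] := ucont01_bounded_above vu.
split => //; exists v, (v c), (v C); split => //.
- by rewrite /v mulr_gt0 ?invr_gt0 // T0.
- by move=> x x01; rewrite cmin // Cmax.
- by move=> x x01; rewrite -(eq_ae_integral_op x01 phii vi phiv) /v mulVKf // gt_eqF.
- split => //; transitivity (\int[mu]_(y in D) (phi y ^+ 2)); last exact: L2norm1_sqr.
  have mphi : measurable_fun D phi.
    by have /integrableP[/measurable_EFinP mf _] := phii; exact: mf.
  rewrite /Rintegral; congr fine; apply: ae_eq_integral => //.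
  + by apply/measurable_EFinP; apply: measurable_funX; exact: ucont01_measurable.
  + by apply/measurable_EFinP; apply: measurable_funX.
  + by move: phiv; apply: filterS => x h Dx /=; rewrite h.
Qed.

(** Otherwise W x would be at most kmin / 2 on [0,1], and so would its
    integral. *)
Lemma kernel_neighbour (kmin : R) (x : R) : 0 < kmin -> x \in `[0, 1] ->
  kmin <= degree_fun W x -> exists2 y : R, y \in `[0, 1] & kmin / 2 <= W x y.
Proof.
move=> kmin0 x01 Kx; apply: contrapT => H.
have : degree_fun W x <= kmin / 2.
  apply: degree_fun_le => // y y01; rewrite leNgt; apply/negP => /ltW h.
  by apply: H; exists y.
by move: Kx kmin0; lra.
Qed.

Lemma degree_fun_ucont : ucont01 (degree_fun W).
Proof.
move=> eta eta0; have [del del0 H] := integral_op_ucont one_integrable eta0.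
by exists del => // x y x01 y01 xy; rewrite !degree_fun_op; exact: H.
Qed.

End kernel_operator.

(** * Empirical measures and the limit law *)

Section empirical_integral.
Context {R : realType}.

Lemma ge0_integral_empirical n (x : 'I_n -> R) (f : R -> \bar R) :
  measurable_fun setT f -> (forall y, 0 <= f y)%E ->
  (\int[empirical_measure x]_y f y = (n%:R^-1)%:E * \sum_(i < n) f (x i))%E.
Proof.
move=> mf f0.
pose m k : {measure set R -> \bar R} :=
  if insub k is Some i then dirac (x i) : {measure set R -> \bar R} else mzero.
have c0 : 0 <= n%:R^-1 :> R by rewrite invr_ge0.
pose c : {nonneg R} := NngNum c0.
transitivity (\int[mscale c (msum m n)]_y f y)%E.
  apply: eq_measure_integral => B mB _.
  rewrite /empirical_measure /= /mscale /= /msum.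
  by congr (_ * _)%E; apply: eq_bigr => i _; rewrite /m valK.
rewrite ge0_integral_mscale //= ge0_integral_measure_sum //.
congr (_ * _)%E; apply: eq_bigr => i _; rewrite /m valK integral_dirac //.
by rewrite diracT mul1e.
Qed.

(** The positive and negative parts are treated separately, by
    [ge0_integral_empirical]. *)
Lemma Rintegral_empirical n (x : 'I_n -> R) (F : R -> R) : continuous F ->
  \int[empirical_measure x]_y F y = avg (fun i => F (x i)).
Proof.
move=> Fc; have mF : measurable_fun setT F by exact: continuous_measurable_fun.
have mF' : measurable_fun setT (EFin \o F) by exact/measurable_EFinP.
rewrite /Rintegral integralE !ge0_integral_empirical //; last 2 first.
- exact: measurable_funeneg.
- exact: measurable_funepos.
rewrite (eq_bigr (fun i => (Num.max (F (x i)) 0)%:E)); last first.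
  by move=> i _; rewrite funeposE EFin_max.
rewrite [X in (_ - _ * X)%E](eq_bigr (fun i => (Num.max (- F (x i)) 0)%:E)); last first.
  by move=> i _; rewrite funenegE EFin_max.
rewrite !sumEFin -!EFinM -EFinB /= /avg -mulrBr -sumrB; congr (_ * _).
apply: eq_bigr => i _; case: (leP (F (x i)) 0) => h.
  by rewrite max_l ?oppr_ge0 // sub0r opprK.
by rewrite max_r ?subr0 // oppr_le0 ltW.
Qed.

End empirical_integral.

Section measurability.
Context {R : realType} {d : measure_display} {Omega : measurableType d}.
Variable P : probability Omega R.

(** Inversion of the degree is written as a power with exponent -1, and the
    indicator of a nonzero degree as the degree times its inverse. *)
Lemma measurable_eigen_bias n (A : 'I_n -> 'I_n -> {RV P >-> bool})
    (r : 'I_n -> {RV P >-> R}) (i : 'I_n) :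
  measurable_fun setT (fun w => eigen_bias (adjacency A w) (\col_i r i w) i).
Proof.
have mA j : measurable_fun setT (fun w => (A i j w)%:R : R).
  by apply: measurable_natr_bool; rewrite -preimage_true; exact: measurable_rv_bool.
pose deg w : R := \sum_j (A i j w)%:R.
have mdeg : measurable_fun setT deg by apply: measurable_sum => j.
have deg0 w : 0 <= deg w by apply: sumr_ge0.
pose inv w := deg w `^ (-1).
have minv : measurable_fun setT inv.
  exact: (measurableT_comp (measurable_powR (-1))).
rewrite (_ : (fun w => _) = (fun w => (inv w * (\sum_j (A i j w)%:R * r j w) - r i w) * (deg w * inv w))).
  apply: measurable_funM; last exact: measurable_funM.
  apply: measurable_funB => //; apply: measurable_funM => //.
  by apply: measurable_sum => j; apply: measurable_funM.
apply/funext => w; rewrite /eigen_bias.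
have -> : degree (adjacency A w) i = deg w.
  by apply: eq_bigr => j _; rewrite mxE.
have -> : inv w = (deg w)^-1 by rewrite /inv powR_inv1.
congr (_ * _); last first.
  by have [->|h] := eqVneq (deg w) 0; rewrite ?mul0r // divff.
rewrite mxE; congr (_ * _ - _); apply: eq_bigr => j _; by rewrite !mxE.
Qed.

End measurability.

Section uniform_law.
Context {R : realType} {d : measure_display} {Omega : measurableType d}.
Variable Q : probability Omega R.
Variable U : {RV Q >-> R}.
Hypothesis U_unif : uniform01 U.
Local Notation mu := (@lebesgue_measure R).
Local Notation D := (`[0%R, 1%R]%classic : set (measurableTypeR R)).

Lemma measurable_U_preimage (B : set (measurableTypeR R)) : measurable B ->
  measurable (U @^-1` B).
Proof.
move=> mB; have mB' : measurable (B : set R) by exact: mB.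
by rewrite -[X in measurable X]setTI; exact: (@measurable_funPT _ _ _ _ U measurableT _ mB').
Qed.

Lemma uniform_preimage (B : set (measurableTypeR R)) : measurable B ->
  Q (U @^-1` B) = mu (B `&` D).
Proof. by move=> mB; rewrite -uniform_prob01E //; exact: (U_unif mB). Qed.

Lemma ae_uniform (S : R -> Prop) : {ae mu, forall x, D x -> S x} ->
  {ae Q, forall w, D (U w) /\ S (U w)}.
Proof.
move=> [N [mN N0 SN]]; exists (U @^-1` (N `|` ~` D)).
have mB : measurable (N `|` ~` D) by apply: measurableU => //; exact: measurableC (@measurable_I01 R).
split.
- exact: measurable_U_preimage.
- rewrite uniform_preimage // setIUl setICl setU0; apply: subset_measure0 N0.
  + exact: measurableI mN (@measurable_I01 R).
  + exact: mN.
  + by apply: subIsetl.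
- move=> w /= h; have [DU|nDU] := pselect (D (U w)); last by right.
  by left; apply: SN => /= S'; apply: h; split => //; exact: S'.
Qed.

(** The integral of F against the law of Delta is the expectation of g (U), and
    the law of U is Lebesgue measure restricted to [0,1].  g is extended by 0
    to obtain a measurable function on the line. *)
Lemma uniform_law_integral (Delta : {RV Q >-> R}) (F g : R -> R) (M : R) :
  continuous F -> (forall x, `|F x| <= M) -> ucont01 g ->
  {ae Q, forall w, D (U w) /\ F (Delta w) = g (U w)} ->
  \int[distribution Q Delta]_x F x = \int[mu]_(y in D) g y.
Proof.
move=> Fc FM gu Fg.
have mF : measurable_fun setT F by exact: continuous_measurable_fun.
have mFD : measurable_fun setT (F \o Delta) by exact: measurableT_comp.
have iFD : Q.-integrable setT (EFin \o (F \o Delta)).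
  apply: (le_integrable measurableT _ _ (finite_measure_integrable_cst Q M measurableT)).
    exact/measurable_EFinP.
  by move=> w _; rewrite /= lee_fin (le_trans (FM _)) // ler_norm.
have mg : measurable_fun setT ((EFin \o g) \_ D).
  apply/(measurable_restrictT _ (@measurable_I01 R)).
  by apply/measurable_EFinP; exact: ucont01_measurable.
have mU : measurable_fun setT (U : Omega -> measurableTypeR R).
  by move=> _ B mB; rewrite setTI; exact: measurable_U_preimage.
have mgU : measurable_fun setT (((EFin \o g) \_ D) \o U) by exact: measurableT_comp mg mU.
have ae_eq_gU : ae_eq Q setT (EFin \o (F \o Delta)) (((EFin \o g) \_ D) \o U).
  move: Fg; apply: filterS => w [Dw Fw] _ /=.
  by rewrite patchE mem_set //= Fw.
rewrite /Rintegral; congr fine.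
rewrite integral_distribution //; last exact/measurable_EFinP.
transitivity (\int[Q]_w (((EFin \o g) \_ D) \o U) w)%E.
  by apply: ae_eq_integral => //; exact/measurable_EFinP.
have igU : Q.-integrable setT (((EFin \o g) \_ D) \o U).
  have [B gB] := ucont01_bounded gu.
  apply: (le_integrable measurableT _ _ (finite_measure_integrable_cst Q `|B| measurableT)) => //.
  move=> w _ /=; rewrite patchE; case: ifPn => [/set_mem Dw|_] /=; rewrite lee_fin.
    by rewrite normr_id (le_trans (gB _ Dw)) // ler_norm.
  by rewrite normr0.
transitivity (\int[pushforward Q (U : Omega -> measurableTypeR R)]_y ((EFin \o g) \_ D) y)%E.
  by rewrite integral_pushforward.
transitivity (\int[lebesgue01]_y ((EFin \o g) \_ D) y)%E.
  by apply: eq_measure_integral => B mB _; exact: (uniform_preimage mB).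
rewrite lebesgue01_integral //; apply: eq_integral => y Dy.
by rewrite patchE Dy.
Qed.

End uniform_law.

(** * Sparsity, and both models at once *)

Section sparsity.
Context {R : realType}.

Definition log_dominated (N : nat -> R) := forall k : R, 0 < k ->
  exists n1, forall n, (n1 <= n)%N -> ln n%:R <= k * N n.

Lemma nat_above (x : R) : exists n1, forall n, (n1 <= n)%N -> x <= n%:R.
Proof.
exists (Num.truncn `|x|).+1 => n nn.
apply: le_trans (ler_norm x) _.
have /andP[_ /ltW h] := Num.Theory.truncn_itv (normr_ge0 x).
by apply: le_trans h _; rewrite ler_nat.
Qed.

(** With ln n <= (k / 2) N, the term exp (- N k) is at most 1 / n^2. *)
Lemma failure_bound_cvg (N : nat -> R) (k x : R) : log_dominated N -> 0 < k -> 0 < x ->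
  exists n1, forall n, (n1 <= n)%N -> failure_bound n (N n) k <= x.
Proof.
move=> HN k0 x0; have [n1 Hn1] := HN (k / 2) (divr_gt0 k0 (ltr0n _ 2)).
have [n2 Hn2] := nat_above (6 / x); have [n3 Hn3] := nat_above 2.
exists (maxn n1 (maxn n2 n3)) => n; rewrite !geq_max => /and3P[h1 h2 h3].
have n2R := Hn3 n h3; have nx := Hn2 n h2; have Hl := Hn1 n h1.
have n0 : 0 < n%:R :> R by lra.
set y := expR (- (N n * k)).
have y0 : 0 <= y by exact: expR_ge0.
have yn : n%:R * y <= n%:R^-1.
  have h : y <= n%:R^-1 * n%:R^-1.
    rewrite -{1 2}(@lnK R n%:R) ?posrE // -expRN -expRD ler_expR; lra.
  have := ler_wpM2l (ltW n0) h; rewrite mulrA divff ?gt_eqF // mul1r.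
  exact.
set t := n%:R * y in yn.
have t0 : 0 <= t by rewrite mulr_ge0 // ltW.
have ninv : n%:R^-1 <= 1 / 2 :> R.
  by rewrite -(ler_pM2r n0) mulVf ?gt_eqF //; lra.
have t2 : 0 <= t <= 1 / 2 by rewrite t0 (le_trans yn).
rewrite /failure_bound -/y -/t.
have := expR_le_quadratic t2 => he.
have t3 : 2 * t ^+ 2 <= t.
  by have /andP[_ tt] := t2; have := ler_wpM2l t0 tt; rewrite -expr2; lra.
have t4 : 6 * n%:R^-1 <= x by rewrite ler_pdivrMr // mulrC -ler_pdivrMr.
have -> : n%:R * (4 * y) = 4 * t by rewrite /t; ring.
lra.
Qed.

Lemma log_dominated_nat : log_dominated (fun n => n%:R).
Proof.
move=> k k0; have [n1 Hn1] := nat_above ((2 / k) ^+ 2); have [n2 Hn2] := nat_above 1.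
exists (maxn n1 n2) => n; rewrite geq_max => /andP[h1 h2].
have n0 : 0 < n%:R :> R by have := Hn2 n h2; lra.
set s := Num.sqrt (n%:R : R).
have s0 : 0 < s by rewrite sqrtr_gt0.
have sn : n%:R = s ^+ 2 by rewrite sqr_sqrtr // ltW.
have sk : 2 / k <= s.
  have k2 : 0 <= 2 / k by rewrite divr_ge0 // ltW.
  by rewrite -ler_sqr ?nnegrE ?(ltW s0) // -sn; exact: Hn1.
rewrite sn lnXn // mulr2n; have := ln_sublinear s0.
have : 2 <= s * k by rewrite -ler_pdivrMr.
move=> h /ltW h'; have := ler_wpM2l (ltW s0) h; rewrite expr2; lra.
Qed.

Lemma log_dominated_of_power (xi : R) (eps : nat -> R) : 1 <= xi ->
  (forall n, (0 < n)%N -> 0 < eps n <= 1) ->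
  ln n%:R `^ xi / (n%:R * eps n) @[n --> \oo] --> (0 : R) ->
  log_dominated (fun n => n%:R * eps n).
Proof.
move=> xi1 eps01 lim k k0.
move/cvgrPdist_le : lim => /(_ k k0)[n1 _ Hn1].
have [n2 Hn2] := nat_above (expR 1).
exists (maxn n1 n2) => n; rewrite geq_max => /andP[h1 h2].
have en := Hn2 n h2.
have n0 : 0 < n%:R :> R by apply: lt_le_trans en; exact: expR_gt0.
have ln1 : 1 <= ln n%:R :> R.
  rewrite -[leLHS]expRK; rewrite ler_ln ?posrE //; exact: expR_gt0.
have N0 : 0 < n%:R * eps n.
  have n0N : (0 < n)%N by rewrite -(ltr_nat R).
  by rewrite mulr_gt0 //; case/andP: (eps01 n n0N).
have := Hn1 n h1; rewrite /= sub0r normrN ger0_norm; last first.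
  by rewrite divr_ge0 ?powR_ge0 // ltW.
rewrite ler_pdivrMr //; apply: le_trans.
exact: le1r_powR.
Qed.

End sparsity.

Section both_models.
Context {R : realType} {d : measure_display} {Omega : measurableType d}.
Variable P : probability Omega R.

(** Model A is the case eps = 1 with the sure event. *)
Lemma models_sandwiched (W : R -> R -> R) (A : forall n, 'I_n -> 'I_n -> {RV P >-> bool}) :
  unif_cont01 W ->
  (forall x y : R, x \in `[0, 1] -> y \in `[0, 1] -> 0 <= W x y <= 1) ->
  (forall x y : R, x \in `[0, 1] -> y \in `[0, 1] -> W x y = W y x) ->
  (forall n, modelA W (A n)) \/
    (exists (xi : R) (eps : nat -> R) (X : nat -> {RV P >-> R}), modelB W xi eps X A) ->
  exists2 eps : nat -> R, log_dominated (fun n => n%:R * eps n) &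
  forall eta : R, 0 < eta <= 1 -> exists2 G : nat -> set Omega,
    (forall x : R, 0 < x -> exists n1, forall n, (n1 <= n)%N -> (P (~` G n) <= x%:E)%E) &
    forall n, (0 < n)%N -> sandwiched P (G n) (fun i j => A n i j)
       (fun i j : 'I_n => W (grid i) (grid j)) (eps n) eta.
Proof.
move=> Wuc W01 Wsym [HA|[xi [eps [X [[Xunif Xind] eps01 xi4 lim HB]]]]].
  exists (fun=> 1).
    by move=> k /log_dominated_nat[n1 H]; exists n1 => n /H; rewrite mulr1.
  move=> eta /andP[eta0 eta1]; exists (fun=> setT).
    move=> x x0; exists 0%N => n _; rewrite setCT measure0 lee_fin; exact: ltW.
  by move=> n n0; apply: modelA_sandwiched => //; rewrite (ltW eta0).
have xi1 : 1 <= xi by lra.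
exists eps; first exact: log_dominated_of_power xi1 eps01 lim.
move=> eta /andP[eta0 eta1]; have [del del0 Hdel] := Wuc eta eta0.
have [m' Hm'] := nat_above (2 / del); pose m := (maxn m' 1)%N.
have m0 : (0 < m)%N by rewrite leq_max orbT.
have mR : 0 < m%:R :> R by rewrite ltr0n.
have mdel : 2 / m%:R <= del.
  by rewrite ler_pdivrMr // mulrC -ler_pdivrMr //; apply: Hm'; rewrite leq_maxl.
exists (fun n => spread (fun j => X j : Omega -> R) n m).
  move=> x x0.
  have [a aE] : exists a : R, a = m%:R^-1 ^+ 2 / 8 by eexists.
  have a0 : 0 < a by rewrite aE; apply: divr_gt0 => //; apply: exprn_gt0; rewrite invr_gt0.
  have [b bE] : exists b : R, b = m.+1%:R * 2 by eexists.
  have b0 : 0 < b by rewrite bE mulr_gt0.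
  have [n1 Hn1] := nat_above (b / (x * a)).
  exists n1 => n nn; apply: le_trans (spread_tail Xunif Xind n m0) _.
  rewrite lee_fin -aE mulrA -bE expRN ler_pdivrMr ?expR_gt0 //.
  have h : n%:R * a <= expR (n%:R * a) by apply: le_trans (expR_ge1Dx _); lra.
  apply: le_trans (ler_wpM2l (ltW x0) h).
  have := Hn1 n nn; rewrite ler_pdivrMr ?mulr_gt0 //.
  by rewrite mulrCA.
move=> n n0; apply: (modelB_sandwiched (del := del)) => //.
- by rewrite (ltW eta0).
- exact: eps01.
Qed.

End both_models.

(** * Convergence in probability *)

Section assembly.
Context {R : realType}.
Local Notation mu := (@lebesgue_measure R).
Local Notation D := (`[0%R, 1%R]%classic : set (measurableTypeR R)).

Lemma inv_nat_below (x : R) : 0 < x -> exists n1, forall n, (n1 <= n)%N ->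
  (0 < n)%N /\ n%:R^-1 <= x.
Proof.
move=> x0; have [n1 H] := nat_above (x^-1).
exists (maxn n1 1) => n; rewrite geq_max => /andP[h1 n0]; split => //.
have nR : 0 < n%:R :> R by rewrite ltr0n.
by rewrite -[x]invrK lef_pV2 ?posrE ?invr_gt0 // H.
Qed.

Lemma riemann_sum_cvg (f : R -> R) (eta : R) : ucont01 f -> 0 < eta ->
  exists n1, forall n, (n1 <= n)%N ->
   `|\int[mu]_(y in D) f y - avg (fun i : 'I_n => f (grid i))| <= eta.
Proof.
move=> fu eta0; have [del del0 H] := fu eta eta0.
have [n1 Hn1] := inv_nat_below del0; exists n1 => n /Hn1[n0 nd].
apply: riemann_sum => //; first exact: ucont01_integrable.
by move=> x y x01 y01 xy; apply: H => //; exact: le_trans xy nd.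
Qed.

(** The modulus of continuity of y |-> W x y v y can be chosen independent of
    x, which makes the convergence uniform in x. *)
Lemma kernel_riemann_sum_cvg (W : R -> R -> R) (v : R -> R) (eta : R) :
  unif_cont01 W ->
  (forall x y : R, x \in `[0, 1] -> y \in `[0, 1] -> 0 <= W x y <= 1) ->
  ucont01 v -> 0 < eta ->
  exists n1, forall n, (n1 <= n)%N -> forall x : R, x \in `[0, 1] ->
   `|n%:R^-1 * (\sum_(j < n) W x (grid j) * v (grid j)) - integral_op W v x| <= eta.
Proof.
move=> Wuc W01 vu eta0.
have [B vB] := ucont01_bounded vu.
have [C C0 vC] : exists2 C : R, 0 < C & forall y : R, y \in `[0, 1] -> `|v y| <= C.
  exists (`|B| + 1); first by rewrite ltr_wpDl.
  by move=> y /vB h; apply: le_trans h _; rewrite ler_wpDr // ler_norm.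
have [d1 d10 H1] := Wuc (eta / (2 * C)) (divr_gt0 eta0 (mulr_gt0 (ltr0n _ 2) C0)).
have [d2 d20 H2] := vu (eta / 2) (divr_gt0 eta0 (ltr0n _ 2)).
have [n1 Hn1] := inv_nat_below d10; have [n2 Hn2] := inv_nat_below d20.
exists (maxn n1 n2) => n; rewrite geq_max => /andP[/Hn1[n0 nd1] /Hn2[_ nd2]] x x01.
rewrite distrC; apply: (riemann_sum (f := fun y => W x y * v y)) => //.
  exact: kernel_integrable (ucont01_integrable vu).
move=> y y' y01 y'01 yy.
have -> : W x y * v y - W x y' * v y' = (W x y - W x y') * v y + W x y' * (v y - v y') by ring.
apply: le_trans (ler_normD _ _) _; rewrite [leRHS]splitr; apply: lerD; rewrite normrM.
  have -> : eta / 2 = eta / (2 * C) * C by field; rewrite gt_eqF.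
  apply: ler_pM => //; last exact: vC.
  by apply: H1 => //; [rewrite subrr normr0 ltW | exact: le_trans yy nd1].
have /andP[w0 w1] := W01 x y' x01 y'01.
apply: (@le_trans _ _ `|v y - v y'|); first by rewrite ger0_norm // ler_piMl.
by apply: H2 => //; exact: le_trans yy nd2.
Qed.

(** Uniform continuity handles z near y; for z far from y, the difference is
    at most 2 M, which a multiple of (z - y)^2 dominates.  This turns closeness
    in mean square into closeness of averages of F. *)
Lemma bounded_continuous_quadratic (F : R -> R) (M B eta : R) : continuous F ->
  (forall x, `|F x| <= M) -> 0 < eta ->
  exists2 L : R, 0 <= L & forall y z, `|y| <= B -> `|F z - F y| <= eta + L * (z - y) ^+ 2.
Proof.
move=> Fc FM eta0.
have M0 : 0 <= M by apply: le_trans (normr_ge0 _) (FM 0).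
have Fw : {within `[- (B + 1), B + 1], continuous F} by exact: continuous_subspaceT.
have [del del0 H] := compact_unif_continuous (@segment_compact R (- (B + 1)) (B + 1)) Fw eta0.
pose d := Num.min (del / 2) 1.
have d0 : 0 < d by rewrite lt_min divr_gt0 /=.
have ddel : d <= del / 2 by rewrite ge_min lexx.
have d1 : d <= 1 by rewrite ge_min lexx orbT.
exists (2 * M / d ^+ 2); first by rewrite divr_ge0 ?sqr_ge0 ?mulr_ge0.
move=> y z yB.
have [zy|yz] := leP `|z - y| d.
  apply: (@le_trans _ _ eta); last by rewrite lerDl mulr_ge0 ?sqr_ge0 ?divr_ge0 ?sqr_ge0 ?mulr_ge0.
  move: yB zy; rewrite !ler_norml => /andP[b1 b2] /andP[c1 c2].
  rewrite -ler_norml; apply: H; rewrite /= ?in_itv /=; try (apply/andP; split; lra).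
  by rewrite -ball_normE /= ltr_norml; apply/andP; split; lra.
apply: (@le_trans _ _ (2 * M)).
  apply: le_trans (ler_normB _ _) _; have := FM z; have := FM y; lra.
have h : d ^+ 2 <= (z - y) ^+ 2.
  by rewrite -[leRHS]real_normK ?num_real // ler_sqr ?nnegrE ?(ltW d0) // ltW.
have d20 : 0 < d ^+ 2 by rewrite exprn_gt0.
have : 2 * M <= 2 * M / d ^+ 2 * (z - y) ^+ 2.
  by rewrite mulrAC ler_pdivlMr // ler_wpM2l // mulr_ge0.
lra.
Qed.

Lemma avg_statistic_close (F : R -> R) n (y z : 'I_n -> R) (e L kappa : R) :
  (0 < n)%N -> 0 <= L -> (forall i, `|F (z i) - F (y i)| <= e + L * (z i - y i) ^+ 2) ->
  avg (fun i => (z i - y i) ^+ 2) <= kappa ->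
  `|avg (fun i => F (z i)) - avg (fun i => F (y i))| <= e + L * kappa.
Proof.
move=> n0 L0 HF Hk; have nR : 0 < n%:R :> R by rewrite ltr0n.
have avgc : avg (fun _ : 'I_n => e) = e.
  by rewrite /avg sumr_const card_ord -[X in _ * X]mulr_natl mulKf // gt_eqF.
rewrite {1 2}/avg -mulrBr -sumrB normrM ger0_norm ?invr_ge0 //.
apply: (@le_trans _ _ (avg (fun i : 'I_n => e + L * (z i - y i) ^+ 2))).
  rewrite /avg ler_wpM2l ?invr_ge0 //; apply: le_trans (ler_norm_sum _ _ _) _.
  exact: ler_sum.
by rewrite (avgD (fun=> e)) avgc (avgZ L (fun i => (z i - y i) ^+ 2)) lerD2l ler_wpM2l.
Qed.

End assembly.

Section limit_profile.
Context {R : realType}.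
Local Notation mu := (@lebesgue_measure R).
Local Notation D := (`[0%R, 1%R]%classic : set (measurableTypeR R)).

Lemma ucont01_limit_profile (K v : R -> R) (rho : R) : ucont01 K -> ucont01 v ->
  (forall x : R, x \in `[0, 1] -> K x != 0) -> ucont01 (fun y => (rho / K y - 1) * v y).
Proof.
move=> /ucont01_continuous/subspace_continuousP Kc /ucont01_continuous/subspace_continuousP vc K0.
apply: continuous_ucont01; apply/subspace_continuousP => x x01.
apply: cvgM; last exact: vc.
apply: cvgB; last exact: cvg_cst.
by apply: cvgM; [exact: cvg_cst|apply: cvgV; [exact: K0|exact: Kc]].
Qed.

Lemma ucont01_comp (F g : R -> R) : continuous F -> ucont01 g -> ucont01 (F \o g).
Proof.
move=> Fc /ucont01_continuous/subspace_continuousP gc.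
apply: continuous_ucont01; apply/subspace_continuousP => x x01.
exact: (continuous_cvg _ (Fc (g x)) (gc x x01)).
Qed.

Lemma ucont01_sqr (g : R -> R) : ucont01 g -> ucont01 (fun y => g y ^+ 2).
Proof.
move=> gu; apply: (@ucont01_comp (fun x => x ^+ 2)) => // x; exact: exprn_continuous.
Qed.

Lemma prob_cvg0 {d : measure_display} {Omega : measurableType d} (P : probability Omega R)
    (E : nat -> set Omega) : (forall n, measurable (E n)) ->
  (forall x : R, 0 < x -> exists n1, forall n, (n1 <= n)%N -> (P (E n) <= x%:E)%E) ->
  P (E n) @[n --> \oo] --> 0%E.
Proof.
move=> mE H; apply/fine_cvgP; split.
  by near=> n; rewrite fin_num_measure.
apply/cvgrPdist_le => x x0; have [n1 Hn1] := H x x0; exists n1 => // n /= nn.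
rewrite sub0r normrN ger0_norm ?fine_ge0 //.
by rewrite -lee_fin fineK ?fin_num_measure //; exact: Hn1.
Unshelve. all: by end_near. Qed.

End limit_profile.

Theorem theorem2p1 (R : realType)
    (W : R -> R -> R) (rho : R) (phi : R -> R) (kmin gamma : R)
    (W_cont : {within `[0, 1] `*` `[0, 1],
                 continuous (fun p : R * R => W p.1 p.2)})
    (W_01 : forall x y, x \in `[0, 1] -> y \in `[0, 1] -> 0 <= W x y <= 1)
    (W_sym : forall x y, x \in `[0, 1] -> y \in `[0, 1] -> W x y = W y x)
    (W_neq0 : exists x y, [/\ x \in `[0, 1], y \in `[0, 1] & W x y != 0])
    (rho_largest : largest_op_eigenvalue W rho)
    (phi_eigen : eigenfunction W rho phi)
    (kmin_gt0 : 0 < kmin)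
    (K_ge_kmin : forall x, x \in `[0, 1] -> kmin <= degree_fun W x)
    (rho_simple : simple_op_eigenvalue W rho)
    (gamma_gt0 : 0 < gamma)
    (rho_gap : (gamma%:E <= edist_inf (op_spectrum W `\ rho) rho)%E)
    (phi_gt0 : forall x, x \in `[0, 1] -> 0 < phi x)
    (phi_norm1 : L2norm phi = 1%E)
    (d : measure_display) (Omega : measurableType d) (P : probability Omega R)
    (A : forall n, 'I_n -> 'I_n -> {RV P >-> bool})
    (A_model : (forall n, modelA W (A n)) \/
               (exists (xi : R) (eps : nat -> R) (X : nat -> {RV P >-> R}),
                  modelB W xi eps X A))
    (r : forall n, 'I_n -> {RV P >-> R})
    (r_top : forall n w, (0 < n)%N ->
               top_eigenvector (adjacency (A n) w) (\col_i r n i w))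
    (d' : measure_display) (Omega' : measurableType d')
    (Q : probability Omega' R) (U Delta_inf : {RV Q >-> R})
    (U_unif : uniform01 U)
    (Delta_infE : {ae Q, forall w,
       Delta_inf w = (rho / degree_fun W (U w) - 1) * phi (U w)}) :
  weak_cvg_in_prob P
    (fun n w => empirical_measure
       (eigen_bias (adjacency (A n) w) (\col_i r n i w)))
    (distribution Q Delta_inf).
Proof.
have Wuc := continuous_unif_cont01 W_cont.
have W0 x y : x \in `[0, 1] -> y \in `[0, 1] -> 0 <= W x y.
  by move=> x01 y01; case/andP: (W_01 x y x01 y01).
have [rho0 [v [c0 [C0 [vu c00 vb Tv [vnorm phiv]]]]]] :=
  continuous_eigenfunction Wuc W_01 kmin_gt0 K_ge_kmin phi_eigen phi_gt0 phi_norm1.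
have Ku := degree_fun_ucont Wuc W_01.
set K := degree_fun W in Ku.
have K0 x : x \in `[0, 1] -> K x != 0.
  by move=> x01; rewrite gt_eqF // (lt_le_trans kmin_gt0) // K_ge_kmin.
have K1 x : x \in `[0, 1] -> K x <= 1.
  by move=> x01; apply: degree_fun_le => // y y01; case/andP: (W_01 x y x01 y01).
(* The limit profile, a continuous version of the function defining
   Delta_infty. *)
pose Df y := (rho / K y - 1) * v y.
have Dfu : ucont01 Df by exact: ucont01_limit_profile.
have [B HB] := ucont01_bounded Dfu.
move=> F Fc [M FM].
set l := \int[_]_x F x.
have lE : l = \int[lebesgue_measure]_(y in `[0%R, 1%R]) (F \o Df) y.
  apply: (uniform_law_integral U_unif Fc FM) => //; first exact: ucont01_comp.
  have h1 := ae_uniform U_unif phiv.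
  move: h1 Delta_infE; apply: filterS2 => w [Dw phiw] Dlw; split => //.
  by rewrite /= Dlw phiw.
move=> e e0.
pose Y n w := avg (fun i => F (eigen_bias (adjacency (A n) w) (\col_i r n i w) i)).
have YE n w : \int[empirical_measure (eigen_bias (adjacency (A n) w) (\col_i r n i w))]_x F x = Y n w.
  exact: Rintegral_empirical.
have mY n : measurable_fun setT (Y n).
  apply: measurable_funM => //; apply: measurable_sum => i.
  apply: (measurableT_comp (f := F)); first exact: continuous_measurable_fun.
  exact: measurable_eigen_bias.
have mE n : measurable [set w | e <= `|Y n w - l|].
  rewrite -[X in measurable X]setTI; apply: measurable_fun_le => //.
  by apply: measurableT_comp => //; exact: measurable_funB.
have -> : (fun n => P [set w | e <= `|\int[empirical_measure (eigen_bias (adjacency (A n) w)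
     (\col_i r n i w))]_x F x - l|]) = (fun n => P [set w | e <= `|Y n w - l|]).
  by apply/funext => n; congr (P _); apply/seteqP; split=> w /=; rewrite YE.
apply: prob_cvg0 => // x x0.
(* Three errors of size e / 4: the modulus of continuity of F, the mean-square
   error of the biases, and the Riemann sum. *)
have e4 : 0 < e / 4 by rewrite divr_gt0.
have [L L0 HL] := bounded_continuous_quadratic B Fc FM e4.
have kap0 : 0 < e / 4 / (L + 1) by rewrite divr_gt0 //; lra.
have [c c_gt0 [n1 Hn1]] := @grid_expands R W (kmin / 2) Wuc (divr_gt0 kmin_gt0 (ltr0n _ 2)) W0
  W_sym (fun y y01 => kernel_neighbour Wuc kmin_gt0 y01 (K_ge_kmin y y01)).
pose c0' := Num.min c0 1; pose C0' := Num.max C0 1.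
have c0'0 : 0 < c0' by rewrite lt_min c00 ltr01.
have c0'1 : c0' <= 1 by rewrite ge_min lexx orbT.
have C0'1 : 1 <= C0' by rewrite le_max lexx orbT.
have C0'0 : 0 < C0' by lra.
have vb' y : y \in `[0, 1] -> c0' <= v y <= C0'.
  by move=> /vb/andP[h1 h2]; rewrite ge_min h1 le_max h2.
have [del /andP[del0 del1] Hbias] := bias_close c0'0 C0'0 (divr_gt0 c_gt0 (ltr0n _ 2)) rho0 kmin_gt0 kap0.
have [k k0 [eta1 eta10 [n2 Hn2]]] : exists2 k, 0 < k & exists2 eta1, 0 < eta1 & _ :=
  @typical_graph R _ _ P c0' C0' c del ltac:(by rewrite c0'0) C0'1 c_gt0 ltac:(by rewrite del0).
have [eps epsN HG] := models_sandwiched Wuc W_01 W_sym A_model.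
(* Both exceptional events, G failing and an atypical graph on G, get x / 2. *)
pose eta := Num.min eta1 1.
have eta01 : 0 < eta <= 1 by rewrite lt_min eta10 ltr01 ge_min lexx orbT.
have [G PG SG] := HG eta eta01.
have x2 : 0 < x / 2 by rewrite divr_gt0.
have [n3 Hn3] := PG (x / 2) x2.
have [n4 Hn4] := failure_bound_cvg epsN k0 x2.
have d1 : 0 < del * c0' / 2 by rewrite divr_gt0 // mulr_gt0.
have d2 : 0 < del / 2 by rewrite divr_gt0.
have [n5 Hn5] := kernel_riemann_sum_cvg Wuc W_01 vu d1.
have [n6 Hn6] := kernel_riemann_sum_cvg Wuc W_01 (@ucont01_cst R 1) d2.
have [n7 Hn7] := riemann_sum_cvg (ucont01_sqr vu) del0.
have [n8 Hn8] := riemann_sum_cvg (ucont01_comp Fc Dfu) e4.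
exists (\max_(m <- [:: n1; n2; n3; n4; n5; n6; n7; n8; 1%N]) m)%N => n.
rewrite !big_cons big_nil !geq_max => /andP[h1] /andP[h2] /andP[h3] /andP[h4].
move=> /andP[h5] /andP[h6] /andP[h7] /andP[h8] /andP[n0 _].
have nR : 0 < n%:R :> R by rewrite ltr0n.
pose Mx (i j : 'I_n) := W (grid i) (grid j).
have etale : eta <= eta1 by rewrite ge_min lexx.
have vbn (i : 'I_n) : c0' <= v (grid i) <= C0' by apply: vb'; exact: grid01.
have Mv (i : 'I_n) : `|n%:R^-1 * (\sum_j Mx i j * v (grid j)) - rho * v (grid i)| <= del * c0' / 2.
  by rewrite -Tv ?grid01 //; apply: Hn5 => //; exact: grid01.
have MK (i : 'I_n) : `|n%:R^-1 * (\sum_j Mx i j) - K (grid i)| <= del / 2.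
  have := Hn6 n h6 (grid i) (grid01 i); rewrite -degree_fun_op.
  by under eq_bigr do rewrite mulr1.
have vn : `|avg (fun i : 'I_n => v (grid i) ^+ 2) - 1| <= del.
  by rewrite distrC -[X in `|X - _|]vnorm; exact: Hn7.
have [Bad [mBad PBad Hgood]] := Hn2 n (G n) (fun i j => A n i j) Mx (fun i => v (grid i))
  (fun i => K (grid i)) (eps n) eta rho h2 (SG n n0) etale vbn Mv MK (Hn1 n h1) vn.
have mG : measurable (~` G n) by apply: measurableC; exact: sw_meas (SG n n0).
apply: (@le_trans _ _ (P ((~` G n) `|` Bad))).
  apply: le_measure; rewrite ?inE //; first exact: measurableU.
  move=> w /= ew; apply: contrapT => /not_orP[/contrapT Gw nBad].
  have [lam [_ Ar rge0 rnorm]] := r_top n w n0.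
  have N0 : 0 < n%:R * eps n by rewrite mulr_gt0 //; case/andP: (sw_eps (SG n n0)).
  have rE i : (\col_i r n i w : 'cV[R]_n) i 0 = r n i w by rewrite mxE.
  pose adjw : 'I_n -> 'I_n -> R := adj (fun i j => A n i j) w.
  have adjE i j : adjacency (A n) w i j = adjw i j by rewrite mxE.
  have Ar' i : \sum_j adjw i j * r n j w = lam * r n i w.
    have := congr1 (fun B : 'cV[R]_n => B i 0) Ar; rewrite !mxE => <-.
    by apply: eq_bigr => j _; rewrite adjE rE.
  have r0' i : 0 <= r n i w by rewrite -rE.
  have rn' : avg (fun i => r n i w ^+ 2) = 1.
    by rewrite -rnorm /avg; congr (_ * _); apply: eq_bigr => i _; rewrite rE.
  have Kb (i : 'I_n) : kmin <= K (grid i) <= 1 by rewrite K_ge_kmin ?K1 ?grid01.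
  have a0 i j : 0 <= adjw i j by [].
  have asym i j : adjw i j = adjw j i by rewrite /adjw /adj (sw_sym (SG n n0)).
  have := Hbias n adjw (fun i => v (grid i)) (fun i => K (grid i)) (fun i => r n i w)
    (n%:R * eps n) lam n0 N0 a0 asym vbn Kb r0' rn' Ar' (Hgood w Gw nBad).
  rewrite (@eq_avg _ _ _ (fun i => (eigen_bias (adjacency (A n) w) (\col_i r n i w) i
       - Df (grid i)) ^+ 2)); last first.
    move=> i; rewrite /eigen_bias; congr ((_ * _ - _) ^+ 2).
      congr (_^-1 * _ - _); rewrite ?rE //; apply: eq_bigr => j _; rewrite adjE ?rE //.
    by congr (_ != 0)%:R; apply: eq_bigr => j _; rewrite adjE.
  move=> Hb.
  have step1 : `|Y n w - avg (fun i : 'I_n => F (Df (grid i)))| <= e / 4 + e / 4.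
    apply: le_trans (avg_statistic_close n0 L0 _ Hb) _.
      by move=> i; apply: HL; apply: HB; exact: grid01.
    by rewrite lerD2l mulrCA ler_piMr ?(ltW e4) // ler_pdivrMr ?mul1r ?lerDl ?ler01 // ltr_wpDl.
  have step2 := Hn8 n h8.
  have : `|Y n w - l| < e.
    have -> : Y n w - l = (Y n w - avg (fun i : 'I_n => F (Df (grid i)))) -
      (l - avg (fun i : 'I_n => F (Df (grid i)))) by ring.
    apply: le_lt_trans (ler_normB _ _) _.
    rewrite -lE in step2; apply: le_lt_trans (lerD step1 step2) _; clear -e0; lra.
  by rewrite ltNge ew.
apply: le_trans (measureU2 _ mG mBad) _.
have PBx : (P Bad <= (x / 2)%:E)%E by apply: le_trans PBad _; rewrite lee_fin; exact: Hn4.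
apply: le_trans (leeD (Hn3 n h3) PBx) _.
by rewrite -EFinD lee_fin -splitr.
Qed.
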